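(* Let $\mathcal{S}=\{S_1,\dots,S_m\}$ be an FI($s$)-system of contracting similarities in $\mathbb{R}^2\cong\mathbb{C}$ with attractor $K$, and let $P=\bigcup_{i\ne j}(S_i(K)\cap S_j(K))$. If one of the addresses of a point $p\in P$ is preperiodic, then there is a real number $\lambda(p)$ such that every Jordan arc $\gamma\subset K$ with endpoint $p$ has slope parameter $\lambda(p)$ at $p$; that is, all such arcs have a slope parameter at $p$, and it is the same for all of them.
   Context: The attractor of $\mathcal{S}$ is the unique nonempty compact $K$ with $K=\bigcup_{i=1}^m S_i(K)$. Let $I=\{1,\dots,m\}$, $I^*=\bigcup_{n\ge1}I^n$, and for $\mathbf{j}=j_1\dots j_n\in I^*$ let $S_{\mathbf j}=S_{j_1}\cdots S_{j_n}$ and $K_{\mathbf j}=S_{\mathbf j}(K)$. FI($s$)-system: the attractor $K$ is connected (a continuum), and $\#(K_i\cap K_j)\le s$ for all $i\ne j$ in $I$, where $s$ is a fixed natural number. An address of a point $x\in K$ is an infinite sequence $\alpha=\alpha_1\alpha_2\dots\in I^\infty$ with $\{x\}=\bigcap_{n\ge1}K_{\alpha_1\dots\alpha_n}$. An address $\alpha$ is preperiodic if $\alpha=\mathbf{j}\,\mathbf{i}\,\mathbf{i}\,\mathbf{i}\dots$ for some $\mathbf{i},\mathbf{j}\in I^*$. Slope parameter: a Jordan arc $\gamma\subset\mathbb{C}$ with endpoints $z_0$ and $b$ has slope parameter $\lambda\in\mathbb{R}$ at the endpoint $z_0$ if there is $M>0$ such that for every subarc $\gamma'$ of $\gamma\setminus\{z_0,b\}$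 with endpoints $z_1,z_2$, $$\bigl|\Delta\operatorname{Arg}(z-z_0)|_{\gamma'}-\lambda(\log|z_2-z_0|-\log|z_1-z_0|)\bigr|\le M,$$ where $\Delta\operatorname{Arg}(z-z_0)|_{\gamma'}$ is the increment of a continuous branch of the argument of $z-z_0$ along $\gamma'$ as $z$ travels from $z_1$ to $z_2$. *)

(* Defs.v *)
From HB Require Import structures.
From mathcomp Require Import all_boot all_order all_algebra.
From mathcomp Require Import all_classical all_reals all_analysis.
From mathcomp Require Import complex.
Set Implicit Arguments.
Unset Strict Implicit.
Unset Printing Implicit Defensive.
Import Order.TTheory GRing.Theory Num.Theory.
Import numFieldNormedType.Exports.
Local Open Scope classical_set_scope.
Local Open Scope card_scope.
Local Open Scope complex_scope.
Local Open Scope ring_scope.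

(* R[i] has no canonical topology in the library: take that of its modulus. *)
HB.instance Definition _ (R : rcfType) := NormedModule.copy R[i] (R[i]^o).

Section SelfSimilarSystems.
Context {R : realType} {m : nat}.
Implicit Types (S : 'I_m -> R[i] -> R[i]) (K : set R[i]).

Definition modulus (z : R[i]) : R := Normc.normc z.

(* Orientation-reversing similarities are allowed. *)
Definition contracting_similarity (T : R[i] -> R[i]) : Prop :=
  exists r : R, [/\ 0 < r, r < 1 &
    forall x y, modulus (T x - T y) = r * modulus (x - y)].

Definition is_attractor S K : Prop :=
  [/\ K !=set0, compact K & K = \bigcup_(i in [set: 'I_m]) S i @` K].

Definition FI_system (s : nat) S K : Prop :=
  [/\ forall i, contracting_similarity (S i),
      is_attractor S K,
      connected K &
      forall i j : 'I_m, i != j -> (S i @` K) `&` (S j @` K) #<= `I_s].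

Definition intersection_points S K : set R[i] :=
  [set x | exists i j : 'I_m, i != j /\ ((S i @` K) `&` (S j @` K)) x].

Definition word_map S (w : seq 'I_m) : R[i] -> R[i] :=
  foldr (fun i T => S i \o T) id w.

Definition piece S K (w : seq 'I_m) : set R[i] := word_map S w @` K.

(* Sequences are indexed from 0; [mkseq a n.+1] is the prefix of length n + 1. *)
Definition address S K (a : nat -> 'I_m) (x : R[i]) : Prop :=
  [set x] = \bigcap_(n in [set: nat]) piece S K (mkseq a n.+1).

(* a = v u u u ..., expressed through its prefixes v u ... u. *)
Definition preperiodic (a : nat -> 'I_m) : Prop :=
  exists v u : seq 'I_m, [/\ v != [::], u != [::] &
    forall n, mkseq a (size v + n * size u)%N = v ++ flatten (nseq n u)].

End SelfSimilarSystems.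

Section SlopeParameter.
Context {R : realType}.
Implicit Types (g h : set R[i]) (f : R -> R[i]) (a b : R[i]).

Definition arc_param f g a b : Prop :=
  [/\ {within `[0, 1], continuous f}, set_inj `[0, 1] f,
      f @` `[0, 1] = g, f 0 = a & f 1 = b].

Definition jordan_arc g a b : Prop := exists f, arc_param f g a b.

Definition arg_branch (theta : R -> R) f (z0 : R[i]) : Prop :=
  {within `[0, 1], continuous theta} /\
  forall t, t \in `[0, 1] ->
    f t - z0 = (modulus (f t - z0))%:C * (cos (theta t) +i* sin (theta t)).

(* The increment of Arg (z - z0) from z1 to z2 is theta 1 - theta 0; it depends
   neither on the branch nor on the parametrization, hence the quantification
   over all of them. *)
Definition slope_parameter g (z0 : R[i]) b (lambda : R) : Prop :=
  exists2 M : R, 0 < M &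
    forall h (z1 z2 : R[i]), h `<=` g `\` [set z0; b] ->
    forall f theta, arc_param f h z1 z2 -> arg_branch theta f z0 ->
      `| (theta 1 - theta 0)
         - lambda * (ln (modulus (z2 - z0)) - ln (modulus (z1 - z0))) | <= M.

End SlopeParameter.

(* Main.v *)
(** Write [p = S_v q] with [q] fixed by [S_u], and let [T = S_u o S_u], which preserves
    orientation. The point is that some path in [K \ {q}] joins a point [x] to [T^n x]
    with [n > 0]: the images of such a path under the powers of [T^n] then form a curve in
    a piece [K_i], spiralling towards [p] at bounded distance from a logarithmic spiral.
    By the Poincare-Miranda theorem in logarithmic coordinates, a path close to [p] and
    disjoint from this curve is trapped between two consecutive lifts of it, so it has the
    same slope. As [p] also lies in another piece [K_j], this applies to an arc of [K_j]
    ending at [p]; that arc is in turn a barrier for the arcs which enter [p] through [K_i].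

    Suppose there is no such path. Then for a path [f] in [K] issued from [q] the sets
    [f], [T f], [T^2 f] only meet at [q] and form a triod. If [q] lies in a piece [K_w] with
    [|w| = |uu|] and [w <> uu], then infinitely many similar copies of [K] of comparable
    sizes contain [q] and pairwise meet in at most [s] points; two of them differ by a
    similarity close to the identity, whereas a triod meets its images under maps close to
    the identity because [K_{3,3}] is not planar. Taking [s + 1] disjoint triods gives a
    contradiction. Otherwise [f] leaves [T^n K] through finitely many points up to powers
    of [T], and the pigeonhole principle yields the path after all. *)
Require Import Defs.
From mathcomp Require Import all_boot all_order all_algebra.
From mathcomp Require Import all_classical all_reals all_analysis.
From mathcomp Require Import complex.
From mathcomp Require Import ring lra.
Set Implicit Arguments.
Unset Strict Implicit.
Unset Printing Implicit Defensive.
Import Order.TTheory GRing.Theory Num.Theory.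
Import numFieldNormedType.Exports.
Local Open Scope classical_set_scope.
Local Open Scope complex_scope.
Local Open Scope ring_scope.

(** Planar topology enters only through the argument of a nonvanishing map on a square, whose
    increments along the two boundary routes between opposite corners agree. Applied to differences
    of disjoint paths this excludes [K_{3,3}]; applied to a pair of real functions it gives
    Poincare-Miranda. The slope is fixed once, by the spiral: a power of [T], seen at [p], is a
    translation in logarithmic coordinates, and [lambda] is the slope of its vector. A barrier
    records this slope and a bound on the deviation, so the slope passes unchanged from the spiral
    to a leg and from the leg to other arcs, while only the bound grows. The obstacle is that an arc
    may cross the spiral when both lie in the same piece. Since that piece and the union of the
    others share finitely many points, an arc close to [p], without its endpoint, either lies in the
    piece or avoids it, and in both cases there is a barrier on the other side. *)

Local Notation Re := complex.Re.
Local Notation Im := complex.Im.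

(** * The topology of the complex plane *)

Section Plane.
Context {R : realType}.
Implicit Types (x y z w : R[i]) (a b r s t : R).

Lemma modulusE z : `|z| = (modulus z)%:C.
Proof. by []. Qed.

Lemma modulus_ge0 z : 0 <= modulus z.
Proof. by rewrite /modulus /Normc.normc; case: z => a b; rewrite sqrtr_ge0. Qed.

Lemma modulus0 : modulus (0 : R[i]) = 0.
Proof. exact: Normc.normc0. Qed.

Lemma modulus1 : modulus (1 : R[i]) = 1.
Proof. exact: Normc.normc1. Qed.

Lemma modulusM z w : modulus (z * w) = modulus z * modulus w.
Proof. exact: Normc.normcM. Qed.

Lemma modulusN z : modulus (- z) = modulus z.
Proof. exact: normcN. Qed.

Lemma modulusD z w : modulus (z + w) <= modulus z + modulus w.
Proof. exact: le_normcD. Qed.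

Lemma modulusV z : modulus z^-1 = (modulus z)^-1.
Proof. exact: Normc.normcV. Qed.

Lemma modulus_eq0 z : (modulus z == 0) = (z == 0).
Proof.
by apply/eqP/eqP => [/Normc.eq0_normc//|->]; exact: modulus0.
Qed.

Lemma modulus_gt0 z : (0 < modulus z) = (z != 0).
Proof. by rewrite lt_neqAle modulus_ge0 andbT eq_sym modulus_eq0. Qed.

Lemma modulusC z w : modulus (z - w) = modulus (w - z).
Proof. by rewrite -modulusN opprB. Qed.

Lemma modulus_tri z w u : modulus (z - u) <= modulus (z - w) + modulus (w - u).
Proof. by apply: le_trans (modulusD _ _); rewrite addrA subrK. Qed.

Lemma modulus_real a : modulus a%:C = `|a|.
Proof. by rewrite /modulus /= expr0n addr0 sqrtr_sqr. Qed.

Lemma modulus_sqr z : modulus z ^+ 2 = Re z ^+ 2 + Im z ^+ 2.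
Proof. by case: z => a b /=; rewrite /modulus /= sqr_sqrtr // addr_ge0 // sqr_ge0. Qed.

Lemma modulus_conj z : modulus z^*%C = modulus z.
Proof. by case: z => a b; rewrite /modulus /= sqrrN. Qed.

Lemma modulus_polar t : modulus (cos t +i* sin t) = 1.
Proof. by rewrite /modulus /= cos2Dsin2 sqrtr1. Qed.

Lemma Re_le_modulus z : `|Re z| <= modulus z.
Proof. by have := normc_ge_Re z; rewrite modulusE lecR. Qed.

Lemma Im_le_modulus z : `|Im z| <= modulus z.
Proof.
rewrite -(ler_pXn2r (ltn0Sn 1)) ?nnegrE ?modulus_ge0//.
by rewrite modulus_sqr real_normK ?num_real// lerDr sqr_ge0.
Qed.

Lemma modulus_le_ReIm z : modulus z <= `|Re z| + `|Im z|.
Proof.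
rewrite -(ler_pXn2r (ltn0Sn 1)) ?nnegrE ?modulus_ge0 ?addr_ge0//.
rewrite modulus_sqr sqrrD !real_normK ?num_real//.
by rewrite addrAC lerDl mulrn_wge0// mulr_ge0.
Qed.

Lemma complex_ext z w : Re z = Re w -> Im z = Im w -> z = w.
Proof. by move: z w => [a b] [c d] /= -> ->. Qed.

Lemma Re_mul z w : Re (z * w) = Re z * Re w - Im z * Im w.
Proof. by case: z w => [a b] [c d]. Qed.
Lemma Im_mul z w : Im (z * w) = Re z * Im w + Im z * Re w.
Proof. by case: z w => [a b] [c d]. Qed.

Lemma nbhs_complexP z (A : set R[i]) :
  nbhs z A <-> exists2 e : R, 0 < e & forall w, modulus (w - z) < e -> A w.
Proof.
split.
  rewrite -(@nbhs_ballE R[i] R[i]) => -[e /= e0 hA].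
  exists (Re e); first by case: e e0 {hA} => a b; rewrite ltcE /= => /andP[].
  move=> w hw; apply: hA; rewrite -ball_normE /= distrC modulusE.
  by case: e e0 hw => a b; rewrite !ltcE /= => /andP[/eqP<- _] ->; rewrite eqxx.
move=> [e e0 hA]; rewrite -(@nbhs_ballE R[i] R[i]); exists e%:C => /=.
  by rewrite ltcR.
by move=> w; rewrite -ball_normE /= distrC modulusE ltcR; exact: hA.
Qed.

Lemma cvg_complexP (T : Type) (F : set_system T) (FF : Filter F) (f : T -> R[i]) z :
  (f @ F --> z) <-> forall e : R, 0 < e -> \forall t \near F, modulus (f t - z) < e.
Proof.
split=> [h e e0|h A].
  have := h [set w | modulus (w - z) < e]; apply.
  by apply/nbhs_complexP; exists e.
move/nbhs_complexP => [e e0 hA]; have := h _ e0.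
by apply: filterS => t; exact: hA.
Qed.

Lemma continuous_Re : continuous (@Re R).
Proof.
move=> z; apply/(@cvgrPdist_lt _ _ _ (nbhs z) (nbhs_filter z)) => e e0.
apply/nbhs_complexP; exists e => // w hw.
apply: le_lt_trans hw; rewrite distrC.
by have := Re_le_modulus (w - z); rewrite raddfB.
Qed.

Lemma continuous_Im : continuous (@Im R).
Proof.
move=> z; apply/(@cvgrPdist_lt _ _ _ (nbhs z) (nbhs_filter z)) => e e0.
apply/nbhs_complexP; exists e => // w hw.
apply: le_lt_trans hw; rewrite distrC.
by have := Im_le_modulus (w - z); rewrite raddfB.
Qed.

Lemma continuous_modulus : continuous (@modulus R).
Proof.
move=> z; apply/(@cvgrPdist_lt _ _ _ (nbhs z) (nbhs_filter z)) => e e0.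
apply/nbhs_complexP; exists e => // w hw.
apply: le_lt_trans hw; have := modulus_tri w z 0; have := modulus_tri z w 0.
by rewrite !subr0 (modulusC z w) ler_norml; lra.
Qed.

Lemma cvg_complex (T : Type) (F : set_system T) (FF : Filter F) (f g : T -> R) a b :
  f @ F --> a -> g @ F --> b -> (fun u => f u +i* g u) @ F --> a +i* b.
Proof.
move=> /cvgrPdist_lt hf /cvgrPdist_lt hg; apply/cvg_complexP => e e0.
have e2 : 0 < e / 2 by lra.
apply: filterS2 (hf _ e2) (hg _ e2) => t h1 h2.
apply: le_lt_trans (modulus_le_ReIm _) _ => /=.
by rewrite distrC (distrC (g t)); lra.
Qed.

End Plane.

Section Continuity.
Context {R : realType}.
Implicit Types T U V : topologicalType.

Lemma cont_comp T U V (g : U -> V) (f : T -> U) :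
  continuous f -> continuous g -> continuous (fun u => g (f u)).
Proof. by move=> cf cg u; exact: (cvg_comp _ _ (cf u) (cg (f u))). Qed.

Lemma cont_pair T U V (f : T -> U) (g : T -> V) :
  continuous f -> continuous g -> continuous (fun u => (f u, g u)).
Proof.
by move=> cf cg u; apply: cvg_pair; [exact: cf|exact: cg]. Qed.

Lemma cont_fst U V : continuous (fst : U * V -> U).
Proof. by move=> [u v]; exact: cvg_fst. Qed.

Lemma cont_snd U V : continuous (snd : U * V -> V).
Proof. by move=> [u v]; exact: cvg_snd. Qed.

Lemma cont_cst T U (c : U) : continuous (fun _ : T => c).
Proof. by move=> u; exact: cvg_cst. Qed.

Lemma cont_id T : continuous (fun u : T => u).
Proof. by move=> u; exact: cvg_id. Qed.

Lemma contNr T (f : T -> R) : continuous f -> continuous (fun u => - f u).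
Proof. by move=> cf u; apply: cvgN; exact: cf. Qed.

Lemma contDr T (f g : T -> R) :
  continuous f -> continuous g -> continuous (fun u => f u + g u).
Proof.
by move=> cf cg u; apply: cvgD; [exact: cf|exact: cg]. Qed.

Lemma contBr T (f g : T -> R) :
  continuous f -> continuous g -> continuous (fun u => f u - g u).
Proof.
by move=> cf cg u; apply: cvgB; [exact: cf|exact: cg]. Qed.

Lemma contMr T (f g : T -> R) :
  continuous f -> continuous g -> continuous (fun u => f u * g u).
Proof.
by move=> cf cg u; apply: cvgM; [exact: cf|exact: cg]. Qed.

Lemma contDc T (f g : T -> R[i]) :
  continuous f -> continuous g -> continuous (fun u => f u + g u).
Proof.
by move=> cf cg u; apply: cvgD; [exact: cf|exact: cg]. Qed.

Lemma contBc T (f g : T -> R[i]) :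
  continuous f -> continuous g -> continuous (fun u => f u - g u).
Proof.
by move=> cf cg u; apply: cvgB; [exact: cf|exact: cg]. Qed.

Lemma contMc T (f g : T -> R[i]) :
  continuous f -> continuous g -> continuous (fun u => f u * g u).
Proof.
by move=> cf cg u; apply: cvgM; [exact: cf|exact: cg]. Qed.

Lemma cont_complex T (f g : T -> R) :
  continuous f -> continuous g -> continuous (fun u => f u +i* g u).
Proof. by move=> cf cg t; apply: cvg_complex; [exact: cf|exact: cg]. Qed.

Lemma cont_real T (f : T -> R) : continuous f -> continuous (fun u => (f u)%:C).
Proof. by move=> cf; apply: (cont_complex cf); exact: cont_cst. Qed.

Lemma cont_modulus T (f : T -> R[i]) :
  continuous f -> continuous (fun u => modulus (f u)).
Proof. by move=> cf; exact: (cont_comp cf (@continuous_modulus R)). Qed.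

End Continuity.

(** * Lifting the argument *)

Section Lifting.
Context {R : realType}.
Implicit Types (z w : R[i]) (a b r s t : R).

Definition polar t : R[i] := cos t +i* sin t.

Lemma polarD s t : polar (s + t) = polar s * polar t.
Proof. by apply: complex_ext; rewrite (Re_mul, Im_mul) /= (cosD, sinD) // addrC. Qed.

Lemma polar0 : polar 0 = 1.
Proof. by rewrite /polar cos0 sin0. Qed.

Lemma polarN t : polar (- t) = (polar t)^-1.
Proof.
have h : polar t * polar (- t) = 1 by rewrite -polarD subrr polar0.
have nz : polar t != 0.
  by apply/eqP => e; move: h; rewrite e mul0r => /eqP; rewrite eq_sym oner_eq0.
by apply: (mulfI nz); rewrite h divff.
Qed.

Lemma polarB s t : polar (s - t) = polar s / polar t.
Proof. by rewrite polarD polarN. Qed.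

Lemma polar_neq0 t : polar t != 0.
Proof. by rewrite -modulus_gt0 modulus_polar. Qed.

Lemma polar_pi : polar pi = -1.
Proof. by apply: complex_ext; rewrite /= ?cospi ?sinpi ?oppr0. Qed.

(** This retraction onto the unit interval turns paths into continuous functions on all of [R], so
    that continuity need not be relativised to a segment. *)
Definition clamp t : R := Num.max 0 (Num.min 1 t).

Lemma clamp_itv t : 0 <= clamp t <= 1.
Proof. by rewrite /clamp le_max lexx /= ge_max ler01 ge_min lexx. Qed.

Lemma clamp_ge0 t : 0 <= clamp t. Proof. by case/andP: (clamp_itv t). Qed.
Lemma clamp_le1 t : clamp t <= 1. Proof. by case/andP: (clamp_itv t). Qed.

Lemma clamp_id t : 0 <= t <= 1 -> clamp t = t.
Proof. by move=> /andP[t0 t1]; rewrite /clamp (min_idPr t1) (max_idPr t0). Qed.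

Lemma clamp_le0 t : t <= 0 -> clamp t = 0.
Proof. by move=> t0; rewrite /clamp; apply/max_idPl; rewrite ge_min t0 orbT. Qed.

Lemma clamp_ge1 t : 1 <= t -> clamp t = 1.
Proof. by move=> t1; rewrite /clamp (min_idPl t1); apply/max_idPr. Qed.

Lemma clamp0 : clamp 0 = 0. Proof. by rewrite clamp_le0. Qed.
Lemma clamp1 : clamp 1 = 1. Proof. by rewrite clamp_ge1. Qed.

Lemma continuous_clamp : continuous clamp.
Proof.
move=> t; apply: (@continuous_max R R (cst 0) (fun u => Num.min 1 u) t); first exact: cvg_cst.
by apply: (@continuous_min R R (cst 1) id t); [exact: cvg_cst|exact: cvg_id].
Qed.

Lemma cont_clamp (T : topologicalType) (f : T -> R) :
  continuous f -> continuous (fun u => clamp (f u)).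
Proof. by move=> cf; exact: (cont_comp cf continuous_clamp). Qed.

(** The principal argument, used only on the right half-plane, where it is continuous. *)
Definition parg z := atan (Im z / Re z).

Lemma pargP z : 0 < Re z -> z = (modulus z)%:C * polar (parg z).
Proof.
move=> z0; have m0 : 0 < modulus z.
  by rewrite modulus_gt0; apply/eqP => e; move: z0; rewrite e ltxx.
have key : Num.sqrt (1 + (Im z / Re z) ^+ 2) = modulus z / Re z.
  apply/eqP; rewrite -(@eqrXn2 _ 2) ?sqrtr_ge0 ?divr_ge0 ?modulus_ge0 1?ltW//.
  rewrite sqr_sqrtr ?addr_ge0 ?sqr_ge0// [X in _ == X]expr_div_n modulus_sqr.
  by apply/eqP; field; rewrite gt_eqF.
have cE : cos (parg z) = Re z / modulus z by rewrite /parg cos_atan key invf_div.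
have c0 : cos (parg z) != 0 by rewrite cE mulf_neq0 ?gt_eqF// invr_gt0.
have sE : sin (parg z) = Im z / modulus z.
  have := atanK (Im z / Re z); rewrite /tan -/(parg z) => /(canRL (divfK c0)) ->.
  by rewrite cE; field; rewrite !gt_eqF.
apply: complex_ext; rewrite (Re_mul, Im_mul) /= ?mul0r ?subr0 ?addr0 ?cE ?sE.
  by field; rewrite gt_eqF.
by field; rewrite gt_eqF.
Qed.

Lemma polar_ex z : exists t, z = (modulus z)%:C * polar t.
Proof.
have [z0|z0|z0] := ltgtP 0 (Re z); first by exists (parg z); exact: pargP.
  exists (parg (- z) + pi); rewrite polarD polar_pi mulrN1 mulrN.
  rewrite -[in LHS](opprK z); congr (- _).
  by rewrite [LHS]pargP ?modulusN// raddfN/= oppr_gt0.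
have zE : modulus z = `|Im z|.
  apply/eqP; rewrite -(@eqrXn2 _ 2) ?modulus_ge0//.
  by rewrite modulus_sqr -z0 expr0n add0r real_normK ?num_real.
have [i0|i0] := leP 0 (Im z).
  exists (pi / 2); rewrite zE /polar cos_pihalf sin_pihalf ger0_norm//.
  by apply: complex_ext; rewrite (Re_mul, Im_mul) /= -?z0; ring.
exists (- (pi / 2)); rewrite zE /polar cosN sinN cos_pihalf sin_pihalf ltr0_norm//.
by apply: complex_ext; rewrite (Re_mul, Im_mul) /= -?z0; ring.
Qed.

Lemma cvg_parg (T : Type) (F : set_system T) (FF : Filter F) (f : T -> R[i]) z :
  0 < Re z -> f @ F --> z -> (fun u => parg (f u)) @ F --> parg z.
Proof.
move=> z0 fz.
have h1 : (fun u => Im (f u) / Re (f u)) @ F --> Im z / Re z.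
  apply: cvgM; first exact: (cvg_comp _ _ fz (@continuous_Im R z)).
  apply: cvgV; first by rewrite gt_eqF.
  exact: (cvg_comp _ _ fz (@continuous_Re R z)).
exact: (cvg_comp _ _ h1 (@continuous_atan R (Im z / Re z))).
Qed.

Lemma compact_square : compact [set u : R * R | 0 <= u.1 <= 1 /\ 0 <= u.2 <= 1].
Proof.
have -> : [set u : R * R | 0 <= u.1 <= 1 /\ 0 <= u.2 <= 1] =
  (`[0, 1] `*` `[0, 1] : set (R * R)).
  by apply/seteqP; split=> u /=; rewrite !in_itv.
by apply: compact_setX; exact: segment_compact.
Qed.

(** The quotient is continuous near the diagonal and equals 1 on it; compactness of the square makes
    the neighbourhood uniform. *)
Lemma ratio_right_half_plane (F : R * R -> R[i]) : continuous F ->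
  (forall s t, 0 <= s <= 1 -> 0 <= t <= 1 -> F (s, t) != 0) ->
  exists2 d : R, 0 < d & forall u v : R * R, 0 <= u.1 <= 1 -> 0 <= u.2 <= 1 ->
    `|u - v| < d -> 0 < Re (F v / F u).
Proof.
move=> cF nF.
have := (@compact_near_coveringP _ _).1 compact_square R (0^'+)
  (fun d u => forall v, `|u - v| < d -> 0 < Re (F v / F u)) _.
case.
  move=> u [u1 u2].
  have Fu : F u != 0 by case: u u1 u2 => *; exact: nF.
  have h : (fun q : (R * R) * (R * R) => F q.2 / F q.1) @ nbhs (u, u) --> F u / F u.
    apply: cvgM.
      exact: (cvg_comp _ _ (@cvg_snd _ _ (nbhs u) (nbhs u) _) (cF u)).
    apply: cvgV => //.
    exact: (cvg_comp _ _ (@cvg_fst _ _ (nbhs u) (nbhs u) _) (cF u)).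
  have hR := cvg_comp _ _ h (@continuous_Re R (F u / F u)).
  rewrite divff// in hR.
  have /= [[A B] /= [hA hB] hAB] : \forall q \near (u, u), 0 < Re (F q.2 / F q.1).
    by apply: (hR _ (lt_nbhsr (ltr01))).
  have /nbhs_ballP[e /= e0 he] : nbhs u (A `&` B) by exact: filterI.
  have e2 : 0 < e / 2 by rewrite divr_gt0.
  exists (ball u (e / 2), [set i | i < e / 2]) => /=.
    by split; [exact: nbhsx_ballx|exact: nbhs_right_lt].
  move=> [x i] /= [xu ie] v xv; apply: (hAB (x, v)); split => /=.
    by apply: (he _ _).1; apply: le_ball xu; rewrite ler_pdivrMr// ler_pMr// ler1n.
  apply: (he _ _).2; rewrite [e]splitr; apply: ball_triangle xu _.
  by rewrite -ball_normE /=; exact: lt_trans xv ie.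
move=> d /= d0 hd; exists (d / 2); first by rewrite divr_gt0.
move=> u v u1 u2 huv; apply: (hd (d / 2)) => //=.
- by rewrite sub0r normrN gtr0_norm ?divr_gt0//; lra.
- by rewrite divr_gt0.
Qed.

(* The argument is obtained by adding up, along the segment from the origin to
   [u], the principal arguments of the quotients of values at nearby points. *)
Lemma argument_lift (F : R * R -> R[i]) : continuous F ->
  (forall s t, 0 <= s <= 1 -> 0 <= t <= 1 -> F (s, t) != 0) ->
  exists2 th : R * R -> R, continuous th &
    forall s t, 0 <= s <= 1 -> 0 <= t <= 1 ->
      F (s, t) = (modulus (F (s, t)))%:C * polar (th (s, t)).
Proof.
move=> cF nF; have [d d0 hd] := ratio_right_half_plane cF nF.
have [N hN] : exists N : nat, N.+1%:R^-1 < d.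
  exists (Num.bound d^-1); rewrite -[X in _ < X]invrK ltf_pV2 ?posrE ?invr_gt0//.
  by rewrite (lt_trans (archi_boundP _))// ?invr_ge0 ?ltW// ltr_nat.
have [a0 ha0] := polar_ex (F (0, 0)).
pose pt (k : nat) (u : R * R) : R * R :=
  (k%:R / N.+1%:R * clamp u.1, k%:R / N.+1%:R * clamp u.2).
have cpt k : continuous (pt k).
  apply: cont_pair; (apply: contMr; [exact: cont_cst|apply: cont_clamp]).
    exact: cont_fst.
  exact: cont_snd.
have pt01 k u : (k <= N.+1)%N -> 0 <= (pt k u).1 <= 1 /\ 0 <= (pt k u).2 <= 1.
  move=> kN; have k0 : 0 <= k%:R / N.+1%:R :> R by rewrite divr_ge0.
  have k1 : k%:R / N.+1%:R <= 1 :> R by rewrite ler_pdivrMr ?mul1r ?ler_nat.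
  by split; rewrite mulr_ge0 ?clamp_ge0//= mulr_ile1 ?clamp_ge0 ?clamp_le1.
have nFpt k u : (k <= N.+1)%N -> F (pt k u) != 0.
  by move=> /(pt01 _ u); case: (pt k u) => x y /= [] *; exact: nF.
pose q k u := F (pt k.+1 u) / F (pt k u).
have q0 k u : (k < N.+1)%N -> 0 < Re (q k u).
  move=> kN; have [h1 h2] := pt01 k u (ltnW kN).
  apply: hd => //; apply: le_lt_trans hN.
  have e c : k%:R / N.+1%:R * c - k.+1%:R / N.+1%:R * c = - (c / N.+1%:R) :> R.
    by rewrite -(natr1 k); ring.
  rewrite prod_normE /= !e !normrN ge_max !ger0_norm ?divr_ge0 ?clamp_ge0//.
  by rewrite !ler_piMl ?invr_ge0 ?clamp_le1.
pose th n u := a0 + \sum_(k < n) parg (q k u).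
have thS n u : th n.+1 u = th n u + parg (q n u).
  by rewrite /th big_ord_recr /= addrA.
have cth n : (n <= N.+1)%N -> continuous (th n).
  elim: n => [_|n IH nN] u.
    have -> : th 0%N = cst a0 by apply/funext => v; rewrite /th big_ord0 addr0.
    exact: cvg_cst.
  rewrite (_ : th n.+1 = fun v => th n v + parg (q n v)); last exact/funext.
  apply: cvgD; first exact: (IH (ltnW nN) u).
  apply: cvg_parg; first exact: q0.
  apply: cvgM; first exact: (cvg_comp _ _ (cpt n.+1 u) (cF _)).
  apply: cvgV; first exact: nFpt (ltnW nN).
  exact: (cvg_comp _ _ (cpt n u) (cF _)).
have hth n u : (n <= N.+1)%N -> F (pt n u) = (modulus (F (pt n u)))%:C * polar (th n u).
  elim: n => [_|n IH nN].
    by rewrite /th big_ord0 addr0 /pt !mul0r.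
  rewrite thS polarD.
  have e : F (pt n.+1 u) = q n u * F (pt n u) by rewrite divfK// nFpt// ltnW.
  rewrite [in LHS]e [in LHS](pargP (q0 n u nN)) {1}(IH (ltnW nN)).
  by rewrite e modulusM rmorphM /=; ring.
exists (th N.+1); first exact: cth.
move=> s t s01 t01; have := hth N.+1 (s, t) (leqnn _).
by rewrite /pt /= divff ?pnatr_eq0// !mul1r !clamp_id.
Qed.

End Lifting.

(** * Increments of the argument along paths, and the Poincare-Miranda theorem *)

Section Increment.
Context {R : realType}.
Implicit Types (f g : R -> R[i]) (th : R -> R) (s t : R).

Definition arg_lift f th : Prop := continuous th /\
  forall t, 0 <= t <= 1 -> f t = (modulus (f t))%:C * polar (th t).

Lemma itv01_0 : 0 <= (0 : R) <= 1. Proof. by rewrite lexx ler01. Qed.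
Lemma itv01_1 : 0 <= (1 : R) <= 1. Proof. by rewrite lexx ler01. Qed.
Hint Resolve itv01_0 itv01_1 : core.

Lemma lift_ex f : continuous f -> (forall t, 0 <= t <= 1 -> f t != 0) ->
  exists th, arg_lift f th.
Proof.
move=> cf nf; have [|s t s01 _|th cth hth] := @argument_lift _ (fun u => f u.1).
- by apply: (cont_comp _ cf); exact: cont_fst.
- exact: nf.
exists (fun t => th (t, 0)); split; last by move=> t t01; exact: hth.
by apply: (cont_comp _ cth); apply: cont_pair; [exact: cont_id|exact: cont_cst].
Qed.

(** To get beyond [pi / 2], [H] would have to take a value in the interval from [pi / 2] (excluded)
    to [pi], where the cosine is negative. *)
Lemma cos_ge0_upper (H : R -> R) : continuous H ->
  (forall t, 0 <= t <= 1 -> 0 <= cos (H t)) -> H 0 <= pi / 2 ->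
  forall t, 0 <= t <= 1 -> H t <= pi / 2.
Proof.
move=> cH hH h0 t t01; rewrite leNgt; apply/negP => ht.
have pi0 := @pi_gt0 R; case/andP: t01 => t0 t1.
pose v := Num.min (H t) pi.
have v1 : pi / 2 < v by rewrite lt_min ht /=; lra.
have v2 : v <= pi by rewrite ge_min lexx orbT.
have [c] : exists2 c, c \in `[0, t] & H c = v.
  apply: IVT => //; first exact: continuous_subspaceT.
  rewrite ge_min le_max; apply/andP; split.
    by apply/orP; left; exact: le_trans h0 (ltW v1).
  by apply/orP; right; rewrite ge_min lexx.
rewrite in_itv /= => /andP[c0 ct] Hc.
have : 0 <= cos v by rewrite -Hc; apply: hH; rewrite c0 (le_trans ct t1).
rewrite leNgt => /negP; apply.
by rewrite -cos_pihalf ltr_cos// in_itv/=; apply/andP; split; lra.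
Qed.

Lemma cos_ge0_confined (H : R -> R) : continuous H ->
  (forall t, 0 <= t <= 1 -> 0 <= cos (H t)) -> - (pi / 2) <= H 0 <= pi / 2 ->
  forall t, 0 <= t <= 1 -> - (pi / 2) <= H t <= pi / 2.
Proof.
move=> cH hH /andP[h1 h2] t t01; apply/andP; split; last exact: cos_ge0_upper.
rewrite lerNl; apply: (@cos_ge0_upper (fun t => - H t)) => //.
- exact: contNr.
- by move=> s s01; rewrite cosN; exact: hH.
- by rewrite lerNl.
Qed.

Lemma polar_eq1 t : polar t = 1 :> R[i] -> cos t = 1 /\ sin t = 0.
Proof. by move=> [-> ->]. Qed.

(** The difference of the two lifts, normalised to vanish at 0, has cosine 1 everywhere. It is
    therefore confined to a half-turn around 0, where cosine 1 forces the value 0. *)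
Lemma lift_unique f th th' : (forall t, 0 <= t <= 1 -> f t != 0) ->
  arg_lift f th -> arg_lift f th' ->
  forall t, 0 <= t <= 1 -> th t - th 0 = th' t - th' 0.
Proof.
move=> nf [cth hth] [cth' hth'].
pose H t := (th t - th' t) - (th 0 - th' 0).
have cH : continuous H.
  by apply: contBr; [exact: contBr|exact: cont_cst].
have e t : 0 <= t <= 1 -> polar (th t) = polar (th' t).
  move=> t01; have := hth' t t01; rewrite [in LHS]hth// => /mulfI; apply.
  by rewrite eq_complex /= eqxx andbT modulus_eq0 nf.
have H1 t : 0 <= t <= 1 -> polar (H t) = 1.
  move=> t01; rewrite /H !polarB (e _ t01) (e 0)// !divff ?polar_neq0 ?oner_eq0//.
have c1 t : 0 <= t <= 1 -> cos (H t) = 1 by move=> /H1/polar_eq1[].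
have pi0 := @pi_gt0 R.
have H00 : H 0 = 0 by rewrite /H subrr.
have hH := @cos_ge0_confined H cH.
move=> t t01; suff : H t = 0 by rewrite /H; lra.
have /andP[h1 h2] : - (pi / 2) <= H t <= pi / 2.
  apply: hH => //; first by move=> s s01; rewrite c1.
  by rewrite H00; apply/andP; split; lra.
have := c1 _ t01; have [h0|h0] := leP 0 (H t).
  move=> h; apply: cos_inj; rewrite ?in_itv /= ?h ?cos0//; lra.
move=> h; apply: oppr_inj; apply: cos_inj; rewrite ?in_itv /= ?cosN ?h ?cos0//; lra.
Qed.

(** The choice is harmless: by [lift_unique] all lifts of a nonvanishing path have the same
    increment. The value 0 is a default for paths without a lift. *)
Definition incr f : R := xget 0 [set d | exists th, arg_lift f th /\ d = th 1 - th 0].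

Lemma incrE f th : (forall t, 0 <= t <= 1 -> f t != 0) -> arg_lift f th ->
  incr f = th 1 - th 0.
Proof.
move=> nf hth; rewrite /incr; case: xgetP => [d _ [th' [hth' ->]]|/(_ (th 1 - th 0))].
  exact: (lift_unique nf).
by case; exists th.
Qed.

(** One lift on the whole square computes all four increments, and both sides are its change from
    corner [(0, 0)] to corner [(1, 1)]. *)
Lemma incr_square (F : R * R -> R[i]) : continuous F ->
  (forall s t, 0 <= s <= 1 -> 0 <= t <= 1 -> F (s, t) != 0) ->
  incr (fun s => F (s, 0)) + incr (fun t => F (1, t)) =
  incr (fun t => F (0, t)) + incr (fun s => F (s, 1)).
Proof.
move=> cF nF; have [th cth hth] := argument_lift cF nF.
have hor t : 0 <= t <= 1 -> incr (fun s => F (s, t)) = th (1, t) - th (0, t).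
  move=> t01; apply: (@incrE _ (fun s => th (s, t))) => [s s01|]; first exact: nF.
  split; last by move=> s s01; exact: hth.
  by apply: (cont_comp _ cth); apply: cont_pair; [exact: cont_id|exact: cont_cst].
have ver s : 0 <= s <= 1 -> incr (fun t => F (s, t)) = th (s, 1) - th (s, 0).
  move=> s01; apply: (@incrE _ (fun t => th (s, t))) => [t t01|]; first exact: nF.
  split; last by move=> t t01; exact: hth.
  by apply: (cont_comp _ cth); apply: cont_pair; [exact: cont_cst|exact: cont_id].
by rewrite !hor// !ver//; ring.
Qed.

Lemma incrN f : continuous f -> (forall t, 0 <= t <= 1 -> f t != 0) ->
  incr (fun t => - f t) = incr f.
Proof.
move=> cf nf; have [th [cth hth]] := lift_ex cf nf.
rewrite (incrE nf (conj cth hth)).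
rewrite (@incrE _ (fun t => th t + pi)); first ring.
  by move=> t t01; rewrite oppr_eq0 nf.
split; first by apply: contDr => //; exact: cont_cst.
by move=> t t01; rewrite modulusN polarD polar_pi mulrN1 mulrN -hth.
Qed.

Lemma polar_incr f : continuous f -> (forall t, 0 <= t <= 1 -> f t != 0) ->
  polar (incr f) = (f 1 / (modulus (f 1))%:C) / (f 0 / (modulus (f 0))%:C).
Proof.
move=> cf nf; have [th [cth hth]] := lift_ex cf nf.
rewrite (incrE nf (conj cth hth)) polarB.
have h t : 0 <= t <= 1 -> f t / (modulus (f t))%:C = polar (th t).
  move=> t01; rewrite [X in X / _]hth// mulrAC divff ?mul1r//.
  by rewrite eq_complex /= eqxx andbT modulus_eq0 nf.
by rewrite !h.
Qed.

Lemma incr_half_plane f (w : R[i]) : continuous f ->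
  (forall t, 0 <= t <= 1 -> 0 < Re (f t * w)) ->
  incr f = parg (f 1 * w) - parg (f 0 * w).
Proof.
move=> cf hf.
have w0 : w != 0 by apply/eqP => e; have := hf 0 itv01_0; rewrite e mulr0 ltxx.
have nf t : 0 <= t <= 1 -> f t != 0.
  by move=> t01; apply/eqP => e; have := hf t t01; rewrite e mul0r ltxx.
have [a ha] := polar_ex w.
pose th t := parg (f (clamp t) * w) - a.
have cth : continuous th.
  apply: contBr; last exact: cont_cst.
  move=> t; apply: cvg_parg; first by apply: hf; exact: clamp_itv.
  have : continuous (fun u => f (clamp u) * w).
    by apply: contMc; [exact: (cont_comp (@continuous_clamp R) cf)|exact: cont_cst].
  exact.
rewrite (@incrE _ th) //; first by rewrite /th clamp0 clamp1; ring.
split=> // t t01; rewrite /th clamp_id// polarB.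
have hm : (modulus w)%:C != 0 by rewrite eq_complex /= eqxx andbT modulus_eq0.
apply: (mulIf w0); rewrite [LHS]pargP; last exact: hf.
rewrite modulusM rmorphM /= [X in _ = _ * X]ha.
by field; rewrite polar_neq0.
Qed.

(* The signs prescribed on the four sides make the argument decrease by
   [2 * pi] along the boundary of the square. *)
Lemma poincare_miranda (F1 F2 : R * R -> R) : continuous F1 -> continuous F2 ->
  (forall t, 0 <= t <= 1 -> F1 (0, t) <= 0) ->
  (forall t, 0 <= t <= 1 -> 0 <= F1 (1, t)) ->
  (forall s, 0 <= s <= 1 -> 0 <= F2 (s, 0)) ->
  (forall s, 0 <= s <= 1 -> F2 (s, 1) <= 0) ->
  exists s t, [/\ 0 <= s <= 1, 0 <= t <= 1, F1 (s, t) = 0 & F2 (s, t) = 0].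
Proof.
move=> c1 c2 left right bot top; apply: contrapT => hno.
pose F u : R[i] := F1 u +i* F2 u.
have cF : continuous F by exact: cont_complex.
have nF s t : 0 <= s <= 1 -> 0 <= t <= 1 -> F (s, t) != 0.
  move=> s01 t01; apply/eqP => -[e1 e2]; apply: hno; exists s, t; split=> //.
have [th0 cth0 hth0] := argument_lift cF nF.
have pi0 := @pi_gt0 R.
have m0 s t : 0 <= s <= 1 -> 0 <= t <= 1 -> 0 < modulus (F (s, t)).
  by move=> s01 t01; rewrite modulus_gt0 nF.
(* The lift is shifted so that its value [a] at the corner [(0, 0)] is the representative in the
   second quadrant, between [pi / 2] and [pi], as the signs of [F1] and [F2] there require. *)
pose a := acos (cos (th0 (0, 0))).
pose th u := th0 u - th0 (0, 0) + a.
have hF s t : 0 <= s <= 1 -> 0 <= t <= 1 ->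
    F1 (s, t) = modulus (F (s, t)) * cos (th0 (s, t)) /\
    F2 (s, t) = modulus (F (s, t)) * sin (th0 (s, t)).
  move=> s01 t01; have e := hth0 s t s01 t01; split.
    by have := congr1 (@Re R) e; rewrite Re_mul /= mul0r subr0.
  by have := congr1 (@Im R) e; rewrite Im_mul /= mul0r addr0.
have [e1 e2] := hF _ _ itv01_0 itv01_0.
have s0 : 0 <= sin (th0 (0, 0)) by rewrite -(pmulr_rge0 _ (m0 _ _ itv01_0 itv01_0)) -e2 bot.
have c0 : cos (th0 (0, 0)) <= 0 by rewrite -(pmulr_rle0 _ (m0 _ _ itv01_0 itv01_0)) -e1 left.
have cI : -1 <= cos (th0 (0, 0)) <= 1 by rewrite cos_geN1 cos_le1.
have ca : cos a = cos (th0 (0, 0)) by rewrite acosK.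
have sa : sin a = sin (th0 (0, 0)).
  by rewrite sin_acos// -sin2cos2 sqrtr_sqr ger0_norm.
have a0 : 0 <= a by exact: acos_ge0.
have api : a <= pi by exact: acos_lepi.
have a2 : pi / 2 <= a.
  rewrite leNgt; apply/negP => h; move: c0; rewrite -ca leNgt => /negP; apply.
  by rewrite cos_gt0_pihalf// h andbT; lra.
have pth u : polar (th u) = polar (th0 u).
  have e : polar a = polar (th0 (0, 0)) by rewrite /polar ca sa.
  by rewrite /th polarD polarB e divfK ?polar_neq0.
have cth : continuous th.
  by apply: contDr; [apply: contBr => //|]; exact: cont_cst.
have hc s t : 0 <= s <= 1 -> 0 <= t <= 1 -> F1 (s, t) = modulus (F (s, t)) * cos (th (s, t)).
  by move=> s01 t01; have := congr1 (@Re R) (pth (s, t)) => /= ->; have [] := hF s t s01 t01.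
have hs s t : 0 <= s <= 1 -> 0 <= t <= 1 -> F2 (s, t) = modulus (F (s, t)) * sin (th (s, t)).
  by move=> s01 t01; have := congr1 (@Im R) (pth (s, t)) => /= ->; have [] := hF s t s01 t01.
have ch t : continuous (fun s => th (s, t)).
  by apply: (cont_comp _ cth); apply: cont_pair; [exact: cont_id|exact: cont_cst].
have cv s : continuous (fun t => th (s, t)).
  by apply: (cont_comp _ cth); apply: cont_pair; [exact: cont_cst|exact: cont_id].
have th00 : th (0, 0) = a by rewrite /th subrr add0r.
(* On a side of the square the values stay in a half-plane; [al] is the direction of its axis, and
   an argument starting within [pi / 2] of [al] stays there. Going round the four sides takes [al]
   through [pi / 2], 0, [- (pi / 2)] and [- pi]. *)
have side (H : R -> R) al : continuous H ->
    (forall t, 0 <= t <= 1 -> 0 <= cos (H t - al)) -> al - pi / 2 <= H 0 <= al + pi / 2 ->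
    al - pi / 2 <= H 1 <= al + pi / 2.
  move=> cH hH /andP[h1 h2].
  have := @cos_ge0_confined (fun t => H t - al) _ hH _ 1 itv01_1.
  case/(_ _ _)/andP; [|by apply/andP; split; lra|by move=> *; apply/andP; split; lra].
  by apply: contBr => //; exact: cont_cst.
have /andP[b1 b2] : pi / 2 - pi / 2 <= th (1, 0) <= pi / 2 + pi / 2.
  apply: (side (fun s => th (s, 0))) => //; last by rewrite th00; apply/andP; split; lra.
  move=> t t01; rewrite cosBpihalf -(pmulr_rge0 _ (m0 _ _ t01 itv01_0)) -hs//.
  exact: bot.
have b3 : th (1, 0) <= pi / 2.
  rewrite leNgt; apply/negP => h.
  have := right 0 itv01_0; rewrite hc// pmulr_rge0 ?m0// leNgt => /negP; apply.
  by rewrite -[ltRHS]cos_pihalf ltr_cos// in_itv /=; apply/andP; split; lra.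
have /andP[d1 d2] : 0 - pi / 2 <= th (1, 1) <= 0 + pi / 2.
  apply: (side (fun s => th (1, s))) => //; last by apply/andP; split; lra.
  by move=> t t01; rewrite subr0 -(pmulr_rge0 _ (m0 _ _ itv01_1 t01)) -hc// right.
have d3 : th (1, 1) <= 0.
  rewrite leNgt; apply/negP => h.
  have := top 1 itv01_1; rewrite hs// pmulr_rle0 ?m0// leNgt => /negP; apply.
  by apply: sin_gt0_pi; apply/andP; split; lra.
have /andP[g1 g2] : - (pi / 2) - pi / 2 <= th (0, 1) <= - (pi / 2) + pi / 2.
  have := @side (fun s => th (1 - s, 1)) (- (pi / 2)).
  rewrite subrr subr0; apply; last by apply/andP; split; lra.
    apply: (cont_comp _ (ch 1)); apply: contBr; [exact: cont_cst|exact: cont_id].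
  move=> t /andP[t0 t1]; have t01 : 0 <= 1 - t <= 1 by apply/andP; split; lra.
  rewrite opprK cosDpihalf oppr_ge0 -(pmulr_rle0 _ (m0 _ _ t01 itv01_1)) -hs//.
  exact: top.
have g3 : th (0, 1) <= - (pi / 2).
  rewrite leNgt; apply/negP => h.
  have := left 1 itv01_1; rewrite hc// pmulr_rle0 ?m0// leNgt => /negP; apply.
  have [->|hn] := eqVneq (th (0, 1)) 0; first by rewrite cos0.
  by apply: cos_gt0_pihalf; rewrite h /=; lra.
have /andP[k1 k2] : - pi - pi / 2 <= th (0, 0) <= - pi + pi / 2.
  have := @side (fun s => th (0, 1 - s)) (- pi).
  rewrite subrr subr0; apply; last by apply/andP; split; lra.
    apply: (cont_comp _ (cv 0)); apply: contBr; [exact: cont_cst|exact: cont_id].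
  move=> t /andP[t0 t1]; have t01 : 0 <= 1 - t <= 1 by apply/andP; split; lra.
  rewrite opprK cosDpi oppr_ge0 -(pmulr_rle0 _ (m0 _ _ itv01_0 t01)) -hc//.
  exact: left.
by rewrite th00 in k2; lra.
Qed.

End Increment.

(** * Triods *)

Section Nonplanarity.
Context {R : realType}.
Implicit Types (s t : R).
Let p0 := @itv01_0 R.
Let p1 := @itv01_1 R.
Hint Resolve p0 p1 : core.

(** The minimum of the thresholds works; the property is asked below each threshold because that
    minimum may be smaller. *)
Lemma uniform_pos (I : finType) (P : I -> R -> Prop) :
  (forall i, exists2 d : R, 0 < d & forall d', 0 < d' -> d' <= d -> P i d') ->
  exists2 d : R, 0 < d & forall i, P i d.
Proof.
move=> h; have /choice[d hd] : forall i, exists d : R, 0 < d /\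
    forall d', 0 < d' -> d' <= d -> P i d'.
  by move=> i; have [d] := h i; exists d.
exists (\big[Num.min/1]_i d i).
  by apply: (big_ind (fun x => 0 < x)) => // [x y x0 y0|i _]; [rewrite lt_min x0|have [] := hd i].
move=> i; have [di0 hi] := hd i; apply: hi.
  by apply: (big_ind (fun x => 0 < x)) => // [x y x0 y0|j _]; [rewrite lt_min x0|have [] := hd j].
exact: bigmin_le_cond.
Qed.

(* The graph K_{3,3} with parts {a, b, infinity} and {e 0, e 1, e 2}, where
   [D i] leads from [e i] to a point outside a half-plane containing the rest:
   the relations between the argument increments of the differences of the nine
   edges force an odd multiple of [pi] to vanish. *)
Lemma K33_nonplanar (A B D : 'I_3 -> R -> R[i]) (a b : R[i]) (w : 'I_3 -> R[i]) :
  (forall i, continuous (A i)) -> (forall i, continuous (B i)) ->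
  (forall i, continuous (D i)) ->
  (forall i, A i 0 = a) -> (forall i, B i 0 = b) ->
  (forall i, A i 1 = B i 1) -> (forall i, D i 0 = A i 1) ->
  (forall i j s t, i != j -> 0 <= s <= 1 -> 0 <= t <= 1 -> A i s != B j t) ->
  (forall i j s t, i != j -> 0 <= s <= 1 -> 0 <= t <= 1 -> A i s != D j t) ->
  (forall i j s t, i != j -> 0 <= s <= 1 -> 0 <= t <= 1 -> B i s != D j t) ->
  (forall i k s, 0 <= s <= 1 -> 0 < Re ((A i s - D k 1) * w k)) ->
  (forall i k s, 0 <= s <= 1 -> 0 < Re ((B i s - D k 1) * w k)) ->
  False.
Proof.
move=> cA cB cD A0 B0 AB DA dAB dAD dBD hA hB.
(* Write [e j] for [A j 1]. Then [al i j] and [be i j] are the turns, seen from [e j], of the edges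
   from [a] and [b] to [e i], while [p j] and [q j] are turns seen from [a] and [b]. *)
pose al i j := incr (fun s => A i s - A j 1).
pose be i j := incr (fun s => B i s - A j 1).
pose p j := incr (fun t => a - B j t).
pose q j := incr (fun t => b - A j t).
have sq (F G : R -> R[i]) : continuous F -> continuous G ->
    (forall s t, 0 <= s <= 1 -> 0 <= t <= 1 -> F s != G t) ->
    incr (fun s => F s - G 0) + incr (fun t => F 1 - G t) =
    incr (fun t => F 0 - G t) + incr (fun s => F s - G 1).
  move=> cF cG h; apply: (incr_square (F := fun u => F u.1 - G u.2)).
    apply: contBc; first exact: (cont_comp (@cont_fst R R) cF).
    exact: (cont_comp (@cont_snd R R) cG).
  by move=> s t s01 t01; rewrite subr_eq0; exact: h.
have opp (F : R -> R[i]) c : continuous F -> (forall s, 0 <= s <= 1 -> F s != c) ->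
    incr (fun s => F s - c) = incr (fun s => c - F s).
  move=> cF h; rewrite -incrN.
  - by congr incr; apply/funext => s; rewrite opprB.
  - by apply: contBc; [exact: cF|exact: cont_cst].
  - by move=> s s01; rewrite subr_eq0 h.
have E1 i j : i != j -> q i + be j i = p j + al i j.
  move=> ij; have := sq _ _ (cA i) (cB j) (fun s t => @dAB i j s t ij).
  rewrite A0 B0 -(AB j) => <-; congr (_ + _).
    rewrite /q -opp// => s s01; rewrite -(B0 j); exact: dAB.
  rewrite /be opp// => s s01; rewrite eq_sym; exact: dAB.
(* The turn seen from [e k] is transported along [D k] to a point from which everything lies in a
   half-plane; there it depends on the end points only, and the common end point of [A i] and [B i]
   cancels. *)
have wind k i j : i != k -> j != k -> al i k - be i k = al j k - be j k.
  have h m : m != k -> al m k - be m k =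
    incr (fun t => a - D k t) - incr (fun t => b - D k t) +
    (parg ((b - D k 1) * w k) - parg ((a - D k 1) * w k)).
    move=> mk.
    have h1 := sq _ _ (cA m) (cD k) (fun s t => @dAD m k s t mk).
    have h2 := sq _ _ (cB m) (cD k) (fun s t => @dBD m k s t mk).
    have cc F : continuous F -> continuous (fun s => F s - D k 1).
      by move=> cF; apply: contBc; [exact: cF|exact: cont_cst].
    have h3 := incr_half_plane (cc _ (cA m)) (hA m k).
    have h4 := incr_half_plane (cc _ (cB m)) (hB m k).
    move: h1 h2 h3 h4; rewrite !A0 !B0 !DA -!AB -/(al m k) -/(be m k); lra.
  by move=> ik jk; rewrite !h.
pose o i j := (p j + al i j) - (q j + be i j).
have oC i j : i != j -> o i j = - o j i.
  by move=> ij; have := E1 i j ij; have := E1 j i; rewrite eq_sym ij /o => /(_ isT); lra.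
have ow k i j : i != k -> j != k -> o i k = o j k.
  by move=> ik jk; have := wind k i j ik jk; rewrite /o; lra.
pose i0 : 'I_3 := ord0; pose i1 : 'I_3 := inord 1; pose i2 : 'I_3 := inord 2.
have n01 : i0 != i1 by rewrite -val_eqE /= inordK.
have n02 : i0 != i2 by rewrite -val_eqE /= inordK.
have n12 : i1 != i2 by rewrite -val_eqE /= !inordK.
have ab : a != b by rewrite -(A0 i0) -(B0 i1); apply: dAB.
(* [o] is antisymmetric by [oC], and by [ow] its value depends on the second index alone; with three
   indices this forces it to equal its own opposite. *)
have z : o i0 i2 = 0.
  have := ow i2 i0 i1 n02 n12; have := ow i0 i1 i2; rewrite ![_ == i0]eq_sym n01 n02.
  move=> /(_ isT isT); have := ow i1 i2 i0; rewrite (eq_sym i2) n12 n01 => /(_ isT isT).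
  have := oC _ _ n01; have := oC _ _ n02; have := oC _ _ n12; lra.
(* In the product of unit directions everything cancels except [b - a] against [a - b]. *)
have : polar (o i0 i2) = -1 :> R[i].
  have cc F c : continuous F -> continuous (fun s => F s - c : R[i]).
    by move=> cF; apply: contBc; [exact: cF|exact: cont_cst].
  have cc' F c : continuous F -> continuous (fun s => c - F s : R[i]).
    by move=> cF; apply: contBc; [exact: cont_cst|exact: cF].
  rewrite /o polarB !polarD /p /q /al /be.
  rewrite polar_incr; [|exact: cc'|]; last first.
    by move=> t t01; rewrite subr_eq0 -(A0 i0); exact: dAB.
  rewrite polar_incr; [|exact: cc|]; last first.
    by move=> t t01; rewrite subr_eq0 AB; exact: dAB.
  rewrite polar_incr; [|exact: cc'|]; last first.
    by move=> t t01; rewrite subr_eq0 -(B0 i0) eq_sym; apply: dAB => //; rewrite eq_sym.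
  rewrite polar_incr; [|exact: cc|]; last first.
    by move=> t t01; rewrite subr_eq0 eq_sym; apply: dAB => //; rewrite eq_sym.
  rewrite !A0 !B0 -!AB (modulusC b a).
  have nz x y : x != y -> (x - y != 0) * ((modulus (x - y : R[i]))%:C != 0).
    move=> xy; rewrite subr_eq0 xy; split=> //.
    by rewrite eq_complex /= eqxx andbT modulus_eq0 subr_eq0.
  have /nz[? ?] := ab.
  have /nz[? ?] : a != A i2 1 by rewrite AB -(A0 i0); exact: dAB.
  have /nz[? ?] : b != A i2 1 by rewrite -(B0 i0) eq_sym; apply: dAB => //; rewrite eq_sym.
  have /nz[? ?] : A i0 1 != A i2 1 by rewrite [X in _ != X]AB; exact: dAB.
  have -> : b - a = - (a - b) by rewrite opprB.
  by field; rewrite ?oppr_eq0; do ![apply/andP; split].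
rewrite z polar0 => /eqP; rewrite eq_complex /= => /andP[/eqP h _].
by have := ltr01 (R := R); lra.
Qed.

End Nonplanarity.

Section Triods.
Context {R : realType}.
Implicit Types (s t : R).
Let p0 := @itv01_0 R.
Let p1 := @itv01_1 R.
Hint Resolve p0 p1 : core.

(** The legs are paths and not arcs: distinct legs are kept apart, but a leg may cross itself. *)
Definition triod (L : 'I_3 -> R -> R[i]) (z0 : R[i]) : Prop :=
  [/\ forall i, continuous (L i), forall i, L i 0 = z0 &
      forall i j s t, i != j -> 0 <= s <= 1 -> 0 <= t <= 1 -> L i s = L j t ->
        s = 0 /\ t = 0].

Definition triod_points (L : 'I_3 -> R -> R[i]) : set R[i] :=
  [set z | exists i s, 0 <= s <= 1 /\ L i s = z].

Lemma cont_bounded_below (f : R -> R) : continuous f ->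
  (forall t, 0 <= t <= 1 -> 0 < f t) ->
  exists2 d : R, 0 < d & forall t, 0 <= t <= 1 -> d <= f t.
Proof.
move=> cf f0; have [c] := EVT_min ler01 (continuous_subspaceT cf).
rewrite in_itv /= => c01 hc; exists (f c); first exact: f0.
by move=> t t01; apply: hc; rewrite in_itv.
Qed.

Lemma cont_modulusP (f : R -> R[i]) t (e : R) : continuous f -> 0 < e ->
  exists2 d : R, 0 < d & forall s, `|s - t| <= d -> modulus (f s - f t) < e.
Proof.
move=> cf e0; have /cvg_complexP/(_ e e0)/nbhs_ballP[d /= d0 hd] := cf t.
exists (d / 2); first by rewrite divr_gt0.
move=> s hs; apply: hd; rewrite /ball /= distrC; apply: le_lt_trans hs _.
by rewrite ltr_pdivrMr// ltr_pMr// ltr1n.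
Qed.

(** If the image were disjoint from the triod, then [z0], [f z0] and infinity could be joined to
    three points [e i] of the legs without forbidden crossings: to [z0] along the leg, to [f z0]
    along the image leg and a short segment, and outwards along the rest of the leg. *)
Lemma triod_perturbation (L : 'I_3 -> R -> R[i]) (z0 : R[i]) : triod L z0 ->
  exists2 e : R, 0 < e & forall f : R[i] -> R[i], continuous f ->
    (forall z, triod_points L z -> modulus (f z - z) < e) ->
    exists2 z, triod_points L z & triod_points L (f z).
Proof.
move=> [cL L0 disj].
have other (i : 'I_3) : exists j, i != j.
  by case: (eqVneq i ord0) => [->|]; [exists (inord 1); rewrite -val_eqE /= inordK|exists ord0].
have tip0 i : 0 < modulus (L i 1 - z0).
  rewrite modulus_gt0 subr_eq0; apply/eqP => h; have [j ij] := other i.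
  have [] := disj i j 1 0 ij p1 p0; first by rewrite h L0.
  by move=> /eqP; rewrite oner_eq0.
have [r r0 hr] : exists2 r : R, 0 < r & forall i, r <= modulus (L i 1 - z0).
  by apply: uniform_pos => i; exists (modulus (L i 1 - z0)).
(* The legs are cut at [eta]: the inner parts stay within [r / 2] of the centre, while the tips are
   at distance at least [r]. *)
have [eta e0 he] : exists2 e : R, 0 < e & forall i, e <= 1 /\
    forall s, 0 <= s -> s <= e -> modulus (L i s - z0) < r / 2.
  apply: uniform_pos => i.
  have [d d0 hd] := @cont_modulusP _ 0 (r / 2) (cL i) (divr_gt0 r0 (ltr0Sn _ 1)).
  exists (Num.min 1 d); first by rewrite lt_min ltr01.
  move=> d' d'0; rewrite le_min => /andP[d'1 d'd]; split=> // s s0 sd.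
  by rewrite -(L0 i); apply: hd; rewrite subr0 ger0_norm// (le_trans sd).
have [eta1 _] := he ord0.
have eta01 : 0 <= eta <= 1 by rewrite ltW.
(* [d] separates each cut point from the other two legs, so that the segment from [f (e i)] to
   [e i], shorter than [d], misses them. *)
have [d d0 hd] : exists2 d : R, 0 < d & forall q : 'I_3 * 'I_3, q.1 != q.2 ->
    forall t, 0 <= t <= 1 -> d <= modulus (L q.1 eta - L q.2 t).
  apply: uniform_pos => -[i j] /=.
  have [ij|ij] := boolP (i != j); last by exists 1.
  have [|t t01|d d0 hd] := @cont_bounded_below (fun t => modulus (L i eta - L j t)).
  - by apply: cont_modulus; apply: contBc; [exact: cont_cst|exact: cL].
  - rewrite modulus_gt0 subr_eq0; apply/eqP => /(disj i j _ _ ij eta01 t01)[h _].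
    by rewrite h ltxx in e0.
  by exists d => // d' _ d'd _ t t01; apply: le_trans d'd _; exact: hd.
exists (Num.min d (r / 2)); first by rewrite lt_min d0 divr_gt0.
move=> f cf hf; apply: contrapT => hno.
have hn i s j t : 0 <= s <= 1 -> 0 <= t <= 1 -> f (L i s) != L j t.
  move=> s01 t01; apply/eqP => h; apply: hno; exists (L i s); first by exists i, s.
  by rewrite h; exists j, t.
have hfL i s : 0 <= s <= 1 -> modulus (f (L i s) - L i s) < d /\
    modulus (f (L i s) - L i s) < r / 2.
  move=> s01; have : triod_points L (L i s) by exists i, s.
  by move=> /hf; rewrite lt_min => /andP.
have ec s : 0 <= s <= 1 -> 0 <= eta * s <= 1.
  have e0' := ltW e0; case/andP=> s0 s1; apply/andP; split; first exact: mulr_ge0.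
  exact: mulr_ile1.
pose e i := L i eta.
pose A i s := L i (eta * s).
pose D i t := L i (eta + (1 - eta) * t).
pose B i t := f (L i (eta * clamp (2 * t))) + (clamp (2 * t - 1))%:C * (e i - f (e i)).
have cA i : continuous (A i).
  by apply: (cont_comp _ (cL i)); apply: contMr; [exact: cont_cst|exact: cont_id].
have cD i : continuous (D i).
  apply: (cont_comp _ (cL i)); apply: contDr; first exact: cont_cst.
  by apply: contMr; [exact: cont_cst|exact: cont_id].
have c2 : continuous (fun t : R => 2 * t) by apply: contMr; [exact: cont_cst|exact: cont_id].
have cB i : continuous (B i).
  apply: contDc.
    apply: (cont_comp _ cf); apply: (cont_comp _ (cL i)); apply: contMr.
      exact: cont_cst.
    exact: cont_clamp.
  apply: contMc; last exact: cont_cst.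
  by apply: cont_real; apply: cont_clamp; apply: contBr; [exact: c2|exact: cont_cst].
have Dp t : 0 <= t <= 1 -> 0 <= eta + (1 - eta) * t <= 1.
  case/andP => t0 t1; have h1 : 0 <= 1 - eta by lra.
  have := mulr_ge0 h1 t0; have := ler_wpM2l h1 t1 => *; apply/andP; split; lra.
have Bcase i t : 0 <= t <= 1 ->
    (exists2 s, 0 <= s <= eta & B i t = f (L i s)) \/
    modulus (B i t - e i) < Num.min d (r / 2).
  case/andP => t0 t1; have [h|h] := leP t (1 / 2).
    left; exists (eta * clamp (2 * t)).
      have e0' := ltW e0; apply/andP; split; first by rewrite mulr_ge0 ?clamp_ge0.
      by rewrite ler_piMr ?clamp_le1.
    by rewrite /B (@clamp_le0 _ (2 * t - 1)) ?mul0r ?addr0//; lra.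
  right; rewrite /B (@clamp_ge1 _ (2 * t)) ?mulr1; last lra.
  set c := clamp _; rewrite -/(e i).
  have -> : f (e i) + c%:C * (e i - f (e i)) - e i = (1 - c)%:C * (f (e i) - e i).
    by rewrite rmorphB rmorph1; ring.
  rewrite modulusM modulus_real ger0_norm ?subr_ge0 ?clamp_le1//.
  apply: le_lt_trans (hf (e i) _); last by exists i, eta.
  by rewrite ler_piMl ?modulus_ge0// lerBlDr lerDl clamp_ge0.
have Bd i j s t : i != j -> 0 <= s <= 1 -> 0 <= t <= 1 -> B i s != L j t.
  move=> ij s01 t01; have [[u /andP[u0 u1] ->]|] := Bcase i s s01.
    by apply: hn => //; rewrite u0 (le_trans u1).
  rewrite lt_min => /andP[h _]; apply/eqP => E; move: h; rewrite E modulusC.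
  by rewrite ltNge (hd (i, j)).
(* The disc of radius [r] about the centre does not contain the tip, hence seen from it lies in a
   half-plane whose axis points to the centre. *)
have half (k : 'I_3) z : modulus (z - z0) < r -> 0 < Re ((z - D k 1) * (z0 - D k 1)^*%C).
  have -> : D k 1 = L k 1 by rewrite /D mulr1 addrC subrK.
  move=> hz; have hk := hr k; set T := L k 1 in hk *.
  have -> : z - T = (z - z0) + (z0 - T) by rewrite addrA subrK.
  rewrite mulrDl raddfD /=.
  have -> : Re ((z0 - T) * (z0 - T)^*%C) = modulus (z0 - T) ^+ 2.
    by rewrite modulus_sqr Re_mul; case: (z0 - T) => x y /=; ring.
  have := Re_le_modulus ((z - z0) * (z0 - T)^*%C).
  rewrite modulusM modulus_conj (modulusC z0) ler_norml => /andP[h _].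
  have T0 := lt_le_trans r0 hk.
  have : modulus (z - z0) * modulus (T - z0) < modulus (T - z0) * modulus (T - z0).
    by rewrite ltr_pM2r//; exact: lt_le_trans hz hk.
  by rewrite expr2; lra.
apply: (@K33_nonplanar _ A B D z0 (f z0) (fun k => (z0 - D k 1)^*%C)) => //.
- by move=> i; rewrite /A mulr0.
- move=> i; have h : 2 * 0 - 1 <= 0 :> R by lra.
  by rewrite /B (clamp_le0 h) mul0r addr0 mulr0 clamp0 mulr0 L0.
- move=> i; rewrite /A /B !mulr1 clamp_ge1 ?mulr1 ?ler1n//.
  have -> : 2 - 1 = 1 :> R by ring.
  by rewrite clamp1 mul1r addrC subrK.
- by move=> i; rewrite /A /D mulr0 addr0 mulr1.
- move=> i j s t ij s01 t01; rewrite eq_sym; apply: Bd => //; first by rewrite eq_sym.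
  exact: ec.
- move=> i j s t ij s01 t01; apply/eqP => h.
  have [_] := disj i j _ _ ij (ec s s01) (Dp t t01) h.
  case/andP: t01 => t0 t1; have h1 : 0 <= 1 - eta by lra.
  by have := mulr_ge0 h1 t0; lra.
- by move=> i j s t ij s01 t01; apply: Bd => //; exact: Dp.
- move=> i k s /andP[s0 s1]; apply: half; have [_ h] := he i.
  have e0' := ltW e0; apply: lt_trans (h (eta * s) _ _) _; last by lra.
    exact: mulr_ge0.
  exact: ler_piMr.
- move=> i k s s01; apply: half; have [_ h] := he i.
  have [[u /andP[u0 u1] ->]|] := Bcase i s s01.
    have u01 : 0 <= u <= 1 by rewrite u0 (le_trans u1).
    have [_ h1] := hfL i u u01; have h2 := h u u0 u1.
    by have := modulus_tri (f (L i u)) (L i u) z0; lra.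
  rewrite lt_min => /andP[_ h1]; have h2 := h eta (ltW e0) (lexx _).
  by have := modulus_tri (B i s) (e i) z0; rewrite /e in h1 *; lra.
Qed.

End Triods.

(** * Similarities of the plane *)

Section Similarities.
Context {R : realType}.
Implicit Types (z w a b : R[i]) (T : R[i] -> R[i]) (r : R) (e : bool).

Definition cj e z : R[i] := if e then z^*%C else z.

Lemma cjB e z w : cj e (z - w) = cj e z - cj e w.
Proof. by case: e => //=; rewrite rmorphB. Qed.

Lemma cjM e z w : cj e (z * w) = cj e z * cj e w.
Proof. by case: e => //=; rewrite rmorphM. Qed.

Lemma cjK e z : cj e (cj e z) = z.
Proof. by case: e => //=; rewrite conjcK. Qed.

Lemma modulus_cj e z : modulus (cj e z) = modulus z.
Proof. by case: e => //=; rewrite modulus_conj. Qed.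

Definition similarity T r := 0 < r /\ forall x y, modulus (T x - T y) = r * modulus (x - y).

Lemma similarity_comp T T' r r' : similarity T r -> similarity T' r' -> similarity (T \o T') (r * r').
Proof.
move=> [r0 hT] [r'0 hT']; split; first exact: mulr_gt0.
by move=> x y /=; rewrite hT hT' mulrA.
Qed.

Lemma similarity_id : similarity id 1.
Proof. by split => // x y; rewrite mul1r. Qed.

Lemma similarity_inj T r : similarity T r -> injective T.
Proof.
move=> [r0 hT] x y /eqP; rewrite -subr_eq0 -modulus_eq0 hT mulf_eq0 gt_eqF//=.
by rewrite modulus_eq0 subr_eq0 => /eqP.
Qed.

Lemma similarity_continuous T r : similarity T r -> continuous T.
Proof.
move=> [r0 hT] z; apply/(@cvg_complexP _ _ _ (nbhs_filter z)) => e e0; apply/nbhs_complexP.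
exists (e / r); first exact: divr_gt0.
by move=> w; rewrite hT ltr_pdivlMr// mulrC.
Qed.

(** Normalised to fix 0 and 1, the map is an isometry preserving real parts and imaginary parts up
    to sign; comparing distances to the image of the imaginary unit makes the sign uniform. *)
Lemma similarity_form T r : similarity T r -> exists a e, modulus a = r /\
  forall x y, T x - T y = a * cj e (x - y).
Proof.
move=> [r0 hT]; pose a := T 1 - T 0.
have ha : modulus a = r by rewrite /a hT subr0 modulus1 mulr1.
have a0 : a != 0 by rewrite -modulus_gt0 ha.
pose f z := (T z - T 0) / a.
have hf x y : modulus (f x - f y) = modulus (x - y).
  rewrite /f -mulrBl opprB addrA subrK modulusM modulusV ha hT.
  by field; rewrite gt_eqF.
have f0 : f 0 = 0 by rewrite /f subrr mul0r.
have f1 : f 1 = 1 by rewrite /f divff.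
have sq z w : modulus z = modulus w -> Re z ^+ 2 + Im z ^+ 2 = Re w ^+ 2 + Im w ^+ 2.
  by rewrite -!modulus_sqr => ->.
have h0 z : Re (f z) ^+ 2 + Im (f z) ^+ 2 = Re z ^+ 2 + Im z ^+ 2.
  by apply: sq; have := hf z 0; rewrite f0 !subr0.
have hR z : Re (f z) = Re z.
  have := sq _ _ (hf z 1); rewrite f1 !raddfB /=; have := h0 z.
  by rewrite !sqrrB; lra.
have hI z : Im (f z) ^+ 2 = Im z ^+ 2 by have := h0 z; rewrite hR; lra.
pose J : R[i] := 0 +i* 1.
have form e : (forall z, f z = cj e z) -> exists a e, modulus a = r /\
    forall x y, T x - T y = a * cj e (x - y).
  move=> h; exists a, e; split => // x y; rewrite cjB -!h /f.
  by field.
have := hI J; rewrite /J /= expr1n => /eqP; rewrite sqrf_eq1 => /orP[]/eqP hJ.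
  apply: (form false) => z; apply: complex_ext; first exact: hR.
  have := sq _ _ (hf z J); rewrite !raddfB /= hJ !hR /=; have := hI z.
  by rewrite !sqrrB; lra.
apply: (form true) => z; apply: complex_ext; first by rewrite hR; case: z.
have -> : Im (cj true z) = - Im z by case: z.
have := sq _ _ (hf z J); rewrite !raddfB /= hJ !hR /=; have := hI z.
by rewrite !sqrrB; lra.
Qed.

Lemma similarity_inverse T r : similarity T r -> exists T',
  [/\ similarity T' r^-1, cancel T T' & cancel T' T].
Proof.
move=> hT; have [a [e [ha hf]]] := similarity_form hT.
have r0 : 0 < r by case: hT.
have a0 : a != 0 by rewrite -modulus_gt0 ha.
pose T' z := cj e ((z - T 0) / a).
have c2 : cancel T' T.
  move=> z; have := hf (T' z) 0; rewrite subr0 cjK mulrC divfK//.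
  by move=> /(congr1 (fun u => u + T 0)); rewrite !subrK.
have c1 : cancel T T' by move=> z; apply: (similarity_inj hT); rewrite c2.
exists T'; split=> //; split; first by rewrite invr_gt0.
move=> x y; case: hT => _ hT; rewrite -{2}(c2 x) -{2}(c2 y) hT.
by field; rewrite gt_eqF.
Qed.

(** Two conjugations cancel. This is why the square of [S_u] is iterated: about a fixed point it is
    a complex multiplication. *)
Lemma similarity_square T r : similarity T r -> exists a, modulus a = r * r /\
  forall x y, T (T x) - T (T y) = a * (x - y).
Proof.
move=> hT; have [a [e [ha hf]]] := similarity_form hT.
exists (a * cj e a); split; first by rewrite modulusM modulus_cj ha.
by move=> x y; rewrite !hf cjM cjK mulrA.
Qed.

Lemma bounded_cells (M d : R) : 0 < d -> exists N, exists cell : R -> 'I_N.+1,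
  forall x y, `|x| <= M -> `|y| <= M -> cell x = cell y -> `|x - y| < d.
Proof.
move=> d0; exists (Num.truncn ((M + M) / d)).
exists (fun x => inord (Num.truncn ((x + M) / d))) => x y.
rewrite !ler_norml => /andP[x1 x2] /andP[y1 y2] /(congr1 val) /=.
have h (z : R) : - M <= z -> 0 <= (z + M) / d by move=> ?; rewrite divr_ge0 ?(ltW d0)//; lra.
rewrite !inordK ?ltnS; last 2 first.
  by apply: le_truncn; rewrite ler_pM2r ?invr_gt0// lerD2r.
  by apply: le_truncn; rewrite ler_pM2r ?invr_gt0// lerD2r.
move=> e; have /andP[a1 a2] := truncn_itv (h x x1); have /andP[b1 b2] := truncn_itv (h y y1).
rewrite e in a1 a2.
have : `|(x + M) / d - (y + M) / d| < 1.
  by rewrite ltr_norml; move: a1 a2 b1 b2; rewrite -natr1; lra.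
rewrite -mulrBl normrM normfV (gtr0_norm d0) ltr_pdivrMr// mul1r.
by have -> : x + M - (y + M) = x - y by ring.
Qed.

Lemma infinite_pigeonhole (I : finType) (g : nat -> I) : exists i j, (i < j)%N /\ g i = g j.
Proof.
apply: contrapT => h.
have inj : injective (fun k : 'I_#|I|.+1 => g k).
  move=> i j e; apply/val_inj; have [ij|ij|//] := ltngtP i j.
    by exfalso; apply: h; exists i, j.
  by exfalso; apply: h; exists j, i.
by have := leq_card _ inj; rewrite card_ord ltnn.
Qed.

Lemma close_pair (a x : nat -> R[i]) (e : nat -> bool) (M d : R) : 0 < d ->
  (forall k, modulus (a k) <= M) -> (forall k, modulus (x k) <= M) ->
  exists i j, [/\ (i < j)%N, e i = e j, modulus (a i - a j) < d & modulus (x i - x j) < d].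
Proof.
move=> d0 ha hx; have d2 : 0 < d / 2 by rewrite divr_gt0.
have [N [cell hc]] := @bounded_cells M (d / 2) d2.
have [i [j [ij]]] := infinite_pigeonhole (fun k =>
  (cell (Re (a k)), cell (Im (a k)), cell (Re (x k)), cell (Im (x k)), e k)).
move=> [e1 e2 e3 e4 e5]; exists i, j; split=> //.
  apply: le_lt_trans (modulus_le_ReIm _) _; rewrite !raddfB /=.
  have := hc _ _ (le_trans (Re_le_modulus _) (ha i)) (le_trans (Re_le_modulus _) (ha j)) e1.
  have := hc _ _ (le_trans (Im_le_modulus _) (ha i)) (le_trans (Im_le_modulus _) (ha j)) e2.
  lra.
apply: le_lt_trans (modulus_le_ReIm _) _; rewrite !raddfB /=.
have := hc _ _ (le_trans (Re_le_modulus _) (hx i)) (le_trans (Re_le_modulus _) (hx j)) e3.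
have := hc _ _ (le_trans (Im_le_modulus _) (hx i)) (le_trans (Im_le_modulus _) (hx j)) e4.
lra.
Qed.

End Similarities.

Section AttractorBasics.
Context {R : realType}.
Implicit Types (z w x y : R[i]).

Lemma compact_cluster (K : set R[i]) (u : nat -> R[i]) : compact K -> (forall n, K (u n)) ->
  exists2 z, K z & forall e : R, 0 < e -> forall n, exists2 k, (n <= k)%N & modulus (u k - z) < e.
Proof.
move=> cK Ku; have [|z [Kz hz]] := cK (u @ \oo) _.
  by exists 0%N => // n _; exact: Ku.
exists z => // e e0 n.
have h1 : (u @ \oo) (u @` [set k | (n <= k)%N]) by exists n => // k nk; exists k.
have h2 : nbhs z [set w | modulus (w - z) < e] by apply/nbhs_complexP; exists e.
have [_ [[k /= nk <-] h]] := hz _ _ h1 h2.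
by exists k.
Qed.

Lemma compact_modulus_bounded (K : set R[i]) : compact K ->
  exists2 M : R, 0 < M & forall z, K z -> modulus z <= M.
Proof.
move=> cK; apply: contrapT => h.
have /choice[u hu] : forall n : nat, exists z, K z /\ n%:R < modulus z.
  move=> n; apply: contrapT => hn; apply: h; exists n.+1%:R => // z Kz.
  rewrite leNgt; apply/negP => hz; apply: hn; exists z; split=> //.
  by apply: le_lt_trans hz; rewrite ler_nat.
have [z _ hz] := compact_cluster cK (fun n => (hu n).1).
have [k hk] := hz 1 ltr01 (Num.bound (modulus z + 1)).
have := (hu k).2; have := archi_boundP (addr_ge0 (modulus_ge0 z) ler01).
have : (Num.bound (modulus z + 1))%:R <= k%:R :> R by rewrite ler_nat.
by have := modulus_tri (u k) z 0; rewrite !subr0; lra.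
Qed.

Lemma closed_complexP (A : set R[i]) : closed A <->
  forall z, (forall e : R, 0 < e -> exists2 w, A w & modulus (w - z) < e) -> A z.
Proof.
split=> [cA z h|h z hz].
  apply: cA => B /nbhs_complexP[e e0 he]; have [w Aw hw] := h e e0.
  by exists w; split => //; exact: he.
apply: h => e e0; have h2 : nbhs z [set w | modulus (w - z) < e].
  by apply/nbhs_complexP; exists e.
by have [w [Aw hw]] := hz _ h2; exists w.
Qed.

Lemma complex_hausdorff : hausdorff_space R[i].
Proof.
move=> x y h; apply/eqP; rewrite -subr_eq0 -modulus_eq0.
rewrite eq_le modulus_ge0 andbT leNgt; apply/negP => d0.
have d2 : 0 < modulus (x - y) / 2 by rewrite divr_gt0.
have hn v : nbhs v [set w | modulus (w - v) < modulus (x - y) / 2].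
  by apply/nbhs_complexP; exists (modulus (x - y) / 2).
have [w []] := h _ _ (hn x) (hn y).
by move=> /= h1 h2; have := modulus_tri x w y; rewrite (modulusC x w); lra.
Qed.

Lemma expr_small (q C e : R) : 0 < q -> q < 1 -> 0 < e -> exists N,
  forall n, (N <= n)%N -> C * q ^+ n < e.
Proof.
move=> q0 q1 e0; have := @cvg_expr R q; rewrite gtr0_norm// => /(_ q1) h.
have : (fun n => C * q ^+ n) @ \oo --> C * 0 by apply: cvgMl_tmp.
rewrite mulr0 => /cvgrPdist_lt/(_ e e0)[N _ hN].
exists N => n /hN /=; rewrite sub0r normrN => h1; exact: le_lt_trans (ler_norm _) h1.
Qed.

Lemma clamp_lip s t : `|clamp s - clamp t| <= `|s - t| :> R.
Proof.
have cases u : [\/ u <= 0 /\ clamp u = 0, 0 <= u <= 1 /\ clamp u = u | 1 <= u /\ clamp u = 1 :> R].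
  have [u0|u0] := leP u 0; first by apply: Or31; rewrite clamp_le0.
  have [u1|u1] := leP 1 u; first by apply: Or33; rewrite clamp_ge1.
  by apply: Or32; rewrite clamp_id ltW//= ltW.
rewrite ler_norml; have := ler_norm (s - t); have := ler_norm (t - s); rewrite (distrC t).
move: `|s - t| => d.
by have [[? ->]|[/andP[? ?] ->]|[? ->]] := cases s;
  have [[? ->]|[/andP[? ?] ->]|[? ->]] := cases t => *; apply/andP; split; lra.
Qed.

End AttractorBasics.

(** * Path-connectedness of a connected attractor *)

Section PathConnected.
Context {R : realType} {m : nat}.
Variables (S : 'I_m -> R[i] -> R[i]) (K : set R[i]) (rho : R).
Hypotheses (rho0 : 0 < rho) (rho1 : rho < 1).
Hypothesis contr : forall i x y, modulus (S i x - S i y) <= rho * modulus (x - y).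
Hypothesis attr : is_attractor S K.
Hypothesis connK : connected K.

Lemma attractor_map i x : K x -> K (S i x).
Proof. by case: attr => _ _ hK Kx; rewrite hK; exists i => //; exists x. Qed.

Lemma attractor_cover x : K x -> exists i y, K y /\ S i y = x.
Proof. by case: attr => _ _ hK; rewrite {1}hK => -[i _ [y Ky <-]]; exists i, y. Qed.

(** A triple [(i, a, b)] is a link from [S i a] to [S i b] inside one piece, and consecutive links
    share an end point. There are [n + 1] links, whence the extra successor when chains are
    concatenated. *)
Definition chain n x y := exists F : nat -> 'I_m * R[i] * R[i],
  [/\ forall k, K (F k).1.2 /\ K (F k).2,
      S (F 0%N).1.1 (F 0%N).1.2 = x,
      forall k, (k < n)%N -> S (F k).1.1 (F k).2 = S (F k.+1).1.1 (F k.+1).1.2 &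
      S (F n).1.1 (F n).2 = y].

Lemma chain0 i x y : K x -> K y -> chain 0 (S i x) (S i y).
Proof. by move=> Kx Ky; exists (fun=> (i, x, y)). Qed.

Lemma chain_cat n k x y z : chain n x y -> chain k y z -> chain (n + k).+1 x z.
Proof.
move=> [F [FK F0 FS Fn]] [G [GK G0 GS Gk]].
exists (fun j => if (j <= n)%N then F j else G (j - n.+1)%N); split=> //.
- by move=> j; case: ifP.
- move=> j; rewrite ltnS => jn; have [h2|h2] := ltnP j n.
    by rewrite (ltnW h2); exact: FS.
  have [h1|h1] := leqP j n.
    have -> : j = n by apply/eqP; rewrite eqn_leq h1.
    by rewrite subnn Fn G0.
  rewrite subSn//; apply: GS.
  by rewrite ltn_subLR// addSn ltnS.
- by rewrite leqNgt ltnS leq_addr /= subSS addKn.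
Qed.

Lemma chain_pad n k x y : K y -> chain n x y -> (n <= k)%N -> chain k x y.
Proof.
move=> Ky h /subnK <-; elim: (k - n)%N => // d IH.
have [i [w [Kw e]]] := attractor_cover Ky.
rewrite -[d.+1 in X in chain X]addn1 addnAC addn1 -[(d + n)%N]addn0.
by apply: chain_cat IH _; rewrite -e; exact: chain0.
Qed.

Lemma closed_piece i : closed (S i @` K).
Proof.
case: attr => _ cK _; apply/closed_complexP => z hz.
have /choice[u hu] : forall n : nat, exists w, K w /\ modulus (S i w - z) < n.+1%:R^-1.
  move=> n; have [|_ [w Kw <-] h] := hz n.+1%:R^-1; first by rewrite invr_gt0.
  by exists w.
have [w Kw hw] := compact_cluster cK (fun n => (hu n).1).
exists w => //; apply/eqP; rewrite -subr_eq0 -modulus_eq0 eq_le modulus_ge0 andbT.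
rewrite leNgt; apply/negP; set d := modulus _ => d0.
have [k hk1 hk2] := hw (d / 2) (divr_gt0 d0 (ltr0Sn _ 1)) (Num.bound (d / 2)^-1).
have h1 := (hu k).2; have h2 := modulus_tri (S i w) (S i (u k)) z.
have h3 : k.+1%:R^-1 <= d / 2.
  rewrite -[leRHS]invrK lef_pV2 ?posrE ?invr_gt0 ?divr_gt0//.
  apply: (le_trans (ltW (archi_boundP _))); first by rewrite invr_ge0 divr_ge0 ?ltW.
  by rewrite ler_nat (leq_trans hk1).
have h4 := contr i w (u k); rewrite (modulusC w) in h4.
have h5 : rho * modulus (u k - w) <= modulus (u k - w).
  by rewrite ler_piMl ?modulus_ge0 ?ltW.
rewrite -/d in h2; move: h1 h2 h3 h4 h5 hk2; move: (k.+1%:R^-1) => q; lra.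
Qed.

(** A piece containing one reachable point is reachable entirely. The reachable set and its
    complement in [K] are thus finite unions of closed pieces, and connectedness applies. *)
Lemma chain_exists x y : K x -> K y -> exists n, chain n x y.
Proof.
move=> Kx Ky; pose A := [set z | K z /\ exists n, chain n x z].
suff AK : A = K by have [] : A y by rewrite AK.
pose P := [set i : 'I_m | exists2 z, A z & (S i @` K) z].
have hA i z : P i -> (S i @` K) z -> A z.
  move=> [w [Kw [n h]] [w' Kw' ew]] [z' Kz' <-]; split; first exact: attractor_map.
  by exists (n + 0).+1; apply: chain_cat h _; rewrite -ew; exact: chain0.
have cB (Q : set 'I_m) : closed (\bigcup_(i in Q) (S i @` K)).
  apply: closed_bigcup; last by move=> i _; exact: closed_piece.
  exact: finite_finset.
apply: connK.
- exists x; split=> //; have [i [w [Kw <-]]] := attractor_cover Kx.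
  by exists 0%N; exact: chain0.
- exists (~` \bigcup_(i in ~` P) (S i @` K)); first by rewrite openC.
  apply/seteqP; split=> z.
    move=> Az; have [Kz _] := Az; split=> // -[i nP Siz]; apply: nP.
    by exists z.
  move=> [Kz hz]; have [i [w [Kw e]]] := attractor_cover Kz.
  have [Pi|nPi] := pselect (P i); first by apply: (hA i) => //; exists w.
  by exfalso; apply: hz; exists i => //; exists w.
- exists (\bigcup_(i in P) (S i @` K)) => //.
  apply/seteqP; split=> z.
    move=> Az; have [Kz _] := Az; split=> //.
    have [i [w [Kw e]]] := attractor_cover Kz; exists i; last by exists w.
    by exists z => //; exists w.
  by move=> [_ [i Pi]]; exact: hA.
Qed.

(** One link moves freely inside a piece, so only the finitely many pairs of pieces matter; the two
    additional steps are the links inside the first and the last piece. *)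
Lemma chain_uniform : exists n, forall x y, K x -> K y -> chain n x y.
Proof.
have [[c Kc] _ _] := attr.
have /choice[N hN] : forall ij : 'I_m * 'I_m, exists n, chain n (S ij.1 c) (S ij.2 c).
  by move=> [i j]; apply: chain_exists; exact: attractor_map.
exists (\max_(ij : 'I_m * 'I_m) N ij).+2 => x y Kx Ky.
have [i [x' [Kx' ex]]] := attractor_cover Kx; have [j [y' [Ky' ey]]] := attractor_cover Ky.
have h := chain_cat (chain_cat (chain0 i Kx' Kc) (hN (i, j))) (chain0 j Kc Ky').
rewrite -ex -ey; apply: (chain_pad _ h); first by rewrite ey.
by rewrite add0n addn0 !ltnS; exact: (leq_bigmax (i, j)).
Qed.

(** At level [n] the unit interval is cut into [n1 ^ n] intervals, each carrying a link inside an
    image of [K] contracted by [rho ^ n]. Refining each link by a chain of fixed length gives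
    approximations that converge uniformly. *)
Lemma attractor_path x y : K x -> K y -> exists f : R -> R[i],
  [/\ continuous f, f 0 = x, f 1 = y & forall t, K (f t)].
Proof.
move=> Kx Ky; have [N hN] := chain_uniform; have [_ cK _] := attr.
have [i0 _] := attractor_cover Kx.
have [M M0 hM] := compact_modulus_bounded cK.
have [D D0 hD] : exists2 D : R, 0 < D & forall u v, K u -> K v -> modulus (u - v) <= D.
  exists (M + M); first exact: addr_gt0.
  by move=> u v /hM h1 /hM h2; apply: le_trans (modulusD _ _) _; rewrite modulusN lerD.
have /choice[F hF] : forall ab : R[i] * R[i], exists F : nat -> 'I_m * R[i] * R[i],
    K ab.1 -> K ab.2 ->
    [/\ forall k, K (F k).1.2 /\ K (F k).2,
      S (F 0%N).1.1 (F 0%N).1.2 = ab.1,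
      forall k, (k < N)%N -> S (F k).1.1 (F k).2 = S (F k.+1).1.1 (F k.+1).1.2 &
      S (F N).1.1 (F N).2 = ab.2].
  move=> [a b]; have [[Ka Kb]|h] := pselect (K a /\ K b).
    by have [F hF] := hN a b Ka Kb; exists F.
  by exists (fun=> (i0, a, b)) => Ka Kb; case: h.
pose n1 := N.+1.
(* [st n k = (g, a, b)]: over the [k]-th interval the path goes from [g a] to [g b] inside the image
   of [K] under [g]. The constant links at [y] beyond the first one at level 0 give a value to the
   index reached at time 1. *)
pose fix st (n k : nat) {struct n} : (R[i] -> R[i]) * R[i] * R[i] :=
  if n is n'.+1 then
    let p := st n' (k %/ n1)%N in let c := F (p.1.2, p.2) (k %% n1)%N in
    (p.1.1 \o S c.1.1, c.1.2, c.2)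
  else if k == 0%N then (id, x, y) else (id, y, y).
pose X n k := (st n k).1.1 (st n k).1.2.
have inv n : forall k, [/\ K (st n k).1.2, K (st n k).2,
    forall u, K u -> K ((st n k).1.1 u) &
    forall u v, modulus ((st n k).1.1 u - (st n k).1.1 v) <= rho ^+ n * modulus (u - v)].
  elim: n => [|n IH] k /=.
    by case: ifP => _; split=> //= u v; rewrite mul1r.
  have [Ka Kb Kg Lg] := IH (k %/ n1)%N; have [h1 h2 h3 h4] := hF (_, _) Ka Kb.
  have [h5 h6] := h1 (k %% n1)%N; split=> // [u Ku|u v].
    by apply: Kg; exact: attractor_map.
  apply: le_trans (Lg _ _) _; rewrite exprSr -mulrA.
  by apply: ler_wpM2l; [exact: exprn_ge0 (ltW rho0)|exact: contr].
have cons : forall n k, (st n k).1.1 (st n k).2 = X n k.+1.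
  elim=> [|j IH] k; first by rewrite /X /=; case: ifP.
  have [Ka Kb Kg Lg] := inv j (k %/ n1)%N; have [h1 h2 h3 h4] := hF (_, _) Ka Kb.
  rewrite /X /=; have := ltn_pmod k (ltn0Sn N); rewrite ltnS leq_eqVlt => /orP[/eqP|] hr.
    have e : k.+1 = ((k %/ n1).+1 * n1)%N by rewrite mulSn {1}(divn_eq k n1) hr addnC /n1 addSn.
    rewrite e mulnK// modnMl hr h4 IH /X.
    have [Ka' Kb' _ _] := inv j (k %/ n1).+1; have [_ h2' _ _] := hF (_, _) Ka' Kb'.
    by rewrite h2'.
  have e : k.+1 = ((k %/ n1) * n1 + (k %% n1).+1)%N by rewrite addnS -divn_eq.
  have hr1 : ((k %% n1).+1 < n1)%N by [].
  rewrite e divnMDl// (divn_small hr1) addn0 modnMDl (modn_small hr1).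
  by rewrite h3.
have XS n k : X n.+1 (k * n1)%N = X n k.
  have [Ka Kb Kg Lg] := inv n k; have [h1 h2 h3 h4] := hF (_, _) Ka Kb.
  by rewrite /X /= mulnK// modnMl h2.
have XK n k : K (X n k) by have [Ka _ Kg _] := inv n k; exact: Kg.
have Xdiv n k : modulus (X n.+1 k - X n (k %/ n1)%N) <= D * rho ^+ n.
  have [Ka Kb Kg Lg] := inv n (k %/ n1)%N; have [h1 h2 h3 h4] := hF (_, _) Ka Kb.
  apply: le_trans (Lg _ _) _; rewrite mulrC ler_wpM2r ?exprn_ge0 ?(ltW rho0)//.
  by apply: hD => //; apply: attractor_map; have [] := h1 (k %% n1)%N.
have Xnext n k : modulus (X n k - X n k.+1) <= D * rho ^+ n.
  rewrite -cons; have [Ka Kb Kg Lg] := inv n k.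
  by apply: le_trans (Lg _ _) _; rewrite mulrC ler_wpM2r ?exprn_ge0 ?(ltW rho0) ?hD.
pose T n (t : R) := Num.truncn (n1%:R ^+ n * t).
have n1p n : 0 < n1%:R ^+ n :> R by rewrite exprn_gt0.
have TS n (t : R) : 0 <= t -> (T n.+1 t %/ n1)%N = T n t.
  move=> t0; apply/esym/truncn_def.
  have /andP[a1 a2] : (T n.+1 t)%:R <= n1%:R ^+ n.+1 * t < (T n.+1 t).+1%:R.
    by apply: truncn_itv; rewrite mulr_ge0// (ltW (n1p _)).
  have n10 : 0 < n1%:R :> R by [].
  apply/andP; split.
    rewrite -(ler_pM2l n10) mulrA -exprS -natrM; apply: le_trans a1.
    by rewrite ler_nat mulnC leq_trunc_div.
  rewrite -(ltr_pM2l n10) mulrA -exprS -natrM; apply: lt_le_trans a2 _.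
  by rewrite ler_nat mulnC ltn_ceil.
(* [E * rho ^+ n] is the sum of the geometric tail of the increments [D * rho ^+ k], for
   [k >= n]. *)
pose E := D / (1 - rho).
have rho' : 0 < 1 - rho by rewrite subr_gt0.
have E0 : 0 < E by exact: divr_gt0.
have cau t n j : 0 <= t -> modulus (X (n + j)%N (T (n + j)%N t) - X n (T n t)) <=
    E * (rho ^+ n - rho ^+ (n + j)).
  move=> t0; elim: j => [|j IH]; first by rewrite addn0 !subrr modulus0 mulr0.
  rewrite addnS; have := Xdiv (n + j)%N (T (n + j).+1 t); rewrite TS// => h.
  apply: le_trans (modulus_tri _ (X (n + j)%N (T (n + j)%N t)) _) _.
  have -> : E * (rho ^+ n - rho ^+ (n + j).+1) =
      D * rho ^+ (n + j) + E * (rho ^+ n - rho ^+ (n + j)).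
    by rewrite exprS /E; field; rewrite gt_eqF.
  exact: lerD.
have /choice[f hf] : forall t, exists z, K z /\
    forall n, modulus (X n (T n (clamp t)) - z) <= E * rho ^+ n.
  move=> t; have [z Kz hz] := compact_cluster cK (fun n => XK n (T n (clamp t))).
  exists z; split=> // n; rewrite leNgt; apply/negP => h.
  pose e := modulus (X n (T n (clamp t)) - z) - E * rho ^+ n.
  have e0 : 0 < e by rewrite subr_gt0.
  have [k nk hk] := hz e e0 n.
  have := cau (clamp t) n (k - n)%N (clamp_ge0 t); rewrite subnKC// modulusC mulrBr.
  have := modulus_tri (X n (T n (clamp t))) (X k (T k (clamp t))) z.
  have : 0 < E * rho ^+ k by rewrite mulr_gt0// exprn_gt0.
  by rewrite /e in hk; lra.
have lim0 z w : (forall n, modulus (z - w) <= E * rho ^+ n) -> z = w.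
  move=> h; apply/eqP; rewrite -subr_eq0 -modulus_eq0 eq_le modulus_ge0 andbT leNgt.
  apply/negP => d0; have [n hn] := expr_small E rho0 rho1 d0.
  by have := hn n (leqnn n); rewrite ltNge h.
exists f; split.
- move=> t; apply/cvg_complexP => e e0.
  have [n hn] := expr_small (E + E + D) rho0 rho1 e0.
  have d0 : 0 < (n1%:R ^+ n)^-1 :> R by rewrite invr_gt0.
  exists (n1%:R ^+ n)^-1 => //= s; rewrite /ball /= => hs.
  have [_ /(_ n) h1] := hf s; have [_ /(_ n) h2] := hf t.
  have h3 : modulus (X n (T n (clamp s)) - X n (T n (clamp t))) <= D * rho ^+ n.
    have c : `|n1%:R ^+ n * clamp s - n1%:R ^+ n * clamp t| < 1.
      rewrite -mulrBr normrM (gtr0_norm (n1p n)) -ltr_pdivlMl// mulr1 distrC.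
      exact: le_lt_trans (clamp_lip _ _) hs.
    have := truncn_itv (mulr_ge0 (ltW (n1p n)) (clamp_ge0 s)).
    have := truncn_itv (mulr_ge0 (ltW (n1p n)) (clamp_ge0 t)).
    rewrite -/(T n (clamp s)) -/(T n (clamp t)).
    move: c; rewrite ltr_norml => /andP[c1 c2] /andP[t1 t2] /andP[s1 s2].
    have a1 : (T n (clamp s) <= (T n (clamp t)).+1)%N.
      by rewrite -ltnS -(ltr_nat R) -!natr1; rewrite -natr1 in t2; lra.
    have a2 : (T n (clamp t) <= (T n (clamp s)).+1)%N.
      by rewrite -ltnS -(ltr_nat R) -!natr1; rewrite -natr1 in s2; lra.
    have [lt|lt|->] := ltngtP (T n (clamp s)) (T n (clamp t)).
    + have -> : T n (clamp t) = (T n (clamp s)).+1 by apply/eqP; rewrite eqn_leq a2.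
      exact: Xnext.
    + have -> : T n (clamp s) = (T n (clamp t)).+1 by apply/eqP; rewrite eqn_leq a1.
      by rewrite modulusC; exact: Xnext.
    + by rewrite subrr modulus0 mulr_ge0 ?exprn_ge0 ?(ltW rho0) ?(ltW D0).
  have := hn n (leqnn n); rewrite !mulrDl.
  have := modulus_tri (f s) (X n (T n (clamp s))) (f t).
  have := modulus_tri (X n (T n (clamp s))) (X n (T n (clamp t))) (f t).
  by rewrite (modulusC (f s) (X _ _)); lra.
- apply/esym/lim0 => n; have [_ /(_ n)] := hf 0; rewrite clamp0 /T mulr0 truncn0.
  by suff -> : X n 0%N = x by []; elim: n => [//|n <-]; rewrite -[in LHS](mul0n n1) XS.
- apply/esym/lim0 => n; have [_ /(_ n)] := hf 1; rewrite clamp1 /T mulr1.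
  rewrite -natrX natrK.
  suff -> : X n (n1 ^ n)%N = y by [].
  by elim: n => [//|n <-]; rewrite expnSr XS.
- by move=> t; have [] := hf t.
Qed.

End PathConnected.

(** * Spirals towards a fixed point *)

Section Curves.
Context {R : realType}.
Implicit Types (z w x y : R[i]) (T : R[i] -> R[i]).

Lemma closed_preimage_path (f : R -> R[i]) (A : set R[i]) : continuous f -> closed A ->
  closed (f @^-1` A).
Proof. by move=> cf cA; apply: closed_comp => // t _; exact: cf. Qed.

Lemma covering_path_meets (f : R -> R[i]) (A B : set R[i]) : continuous f ->
  closed A -> closed B -> (forall t, A (f t) \/ B (f t)) -> A (f 0) -> B (f 1) ->
  exists t, [/\ 0 <= t <= 1, A (f t) & B (f t)].
Proof.
move=> cf cA cB AB A0 B1; apply: contrapT => h.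
have E : `[(0 : R), 1]%classic `&` f @^-1` A = `[0, 1]%classic.
  apply: (@segment_connected R 0 1).
  - by exists 0; split=> //=; rewrite in_itv /= lexx ler01.
  - exists (~` (f @^-1` B)); first by rewrite openC; exact: closed_preimage_path.
    apply/seteqP; split=> t [t01 At]; split=> //.
      by move=> Bt; apply: h; exists t; split=> //; move: t01; rewrite /= in_itv.
    by have [] := AB t.
  - by exists (f @^-1` A) => //; exact: closed_preimage_path.
apply: h; exists 1; rewrite ler01 lexx; split=> //.
have : (`[(0 : R), 1]%classic `&` f @^-1` A) 1 by rewrite E /= in_itv /= lexx ler01.
by case.
Qed.

Definition leg (K : set R[i]) p (f : R -> R[i]) : Prop :=
  [/\ continuous f, f 0 = p, forall t, K (f t) & forall t, 0 < t <= 1 -> f t != p].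

Definition path_connected (K : set R[i]) : Prop := forall x y, K x -> K y ->
  exists f : R -> R[i], [/\ continuous f, f 0 = x, f 1 = y & forall t, K (f t)].

(** The path is started anew at its last visit to [p]. *)
Lemma leg_exists (K : set R[i]) p x : path_connected K -> K p -> K x -> x != p ->
  exists2 f, leg K p f & f 1 = x.
Proof.
move=> pK Kp Kx xp; have [f [cf f0 f1 fK]] := pK p x Kp Kx.
pose A := [set t | 0 <= t <= 1 /\ f t = p].
have A0 : A !=set0 by exists 0; split=> //; rewrite lexx ler01.
have hA : has_sup A by split=> //; exists 1 => t [/andP[]].
pose c := sup A.
have c0 : 0 <= c by apply: ub_le_sup; [exact: hA.2|split=> //; rewrite lexx ler01].
have c1 : c <= 1 by apply: ge_sup => // t [/andP[]].
have fc : f c = p.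
  apply/eqP; rewrite -subr_eq0 -modulus_eq0 eq_le modulus_ge0 andbT leNgt; apply/negP => d0.
  have [d d1 hd] := cont_modulusP c cf d0.
  have [t [t01 ft] ht] := sup_adherent d1 hA.
  have tc : t <= c by apply: ub_le_sup; [exact: hA.2|].
  suff h : `|t - c| <= d by have := hd t h; rewrite ft modulusC ltxx.
  by rewrite distrC ger0_norm ?subr_ge0//; rewrite -/c in ht; lra.
have c1' : c < 1.
  by rewrite lt_neqAle c1 andbT; apply: contra_neq xp => e; rewrite -fc e f1.
exists (fun t => f (c + (1 - c) * t)); last by rewrite mulr1 addrC subrK f1.
split.
- apply: (cont_comp _ cf); apply: contDr; first exact: cont_cst.
  by apply: contMr; [exact: cont_cst|exact: cont_id].
- by rewrite mulr0 addr0.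
- by move=> t; exact: fK.
move=> t /andP[t0 t1]; apply/eqP => e.
have h0 : 0 < (1 - c) * t by rewrite mulr_gt0// subr_gt0.
have h1 : (1 - c) * t <= 1 - c by rewrite ler_piMr// subr_ge0.
have : c + (1 - c) * t <= c.
  by apply: ub_le_sup; [exact: hA.2|split=> //; apply/andP; split; lra].
by lra.
Qed.

Definition spiral T (K : set R[i]) q : Prop := exists n (g : R -> R[i]), [/\ (0 < n)%N,
  continuous g, forall t, K (g t) /\ g t != q & g 1 = iter n T (g 0)].

Lemma iter_similarity T r n : similarity T r -> similarity (iter n T) (r ^+ n).
Proof.
move=> hT; elim: n => [|n IH]; first by rewrite expr0; exact: similarity_id.
by rewrite exprS; exact: (similarity_comp hT IH).
Qed.

Lemma iter_fix T q n : T q = q -> iter n T q = q.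
Proof. by move=> h; elim: n => //= n ->. Qed.

Lemma compact_image T r (A : set R[i]) : similarity T r -> compact A -> compact (T @` A).
Proof.
move=> hT cA; apply: continuous_compact => //.
by apply: continuous_subspaceT; exact: similarity_continuous hT.
Qed.

(** * Exits of a leg from the shrinking copies [T^n K] *)

Section Exits.
Variables (T : R[i] -> R[i]) (r : R) (K O : set R[i]) (q : R[i]).
Hypotheses (simT : similarity T r) (r1 : r < 1) (Tq : T q = q).
Hypotheses (cK : compact K) (cO : compact O) (Kq : K q) (OK : O `<=` K).
Hypothesis TK : forall x, K x -> K (T x).
Hypothesis cover : K `<=` (T @` K) `|` O.
Hypothesis finE : finite_set ((T @` K) `&` O).
Hypothesis nOq : ~ O q.

Let r0 : 0 < r. Proof. by case: simT. Qed.

Fixpoint outer n : set R[i] := if n is n'.+1 then O `|` T @` (outer n') else set0.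

Lemma outerP n x : outer n x -> exists k y, [/\ (k < n)%N, O y & iter k T y = x].
Proof.
elim: n x => [//|n IH] x /= [Ox|[y /IH[k [z [kn Oz <-]]] <-]]; first by exists 0%N, x.
by exists k.+1, z.
Qed.

Lemma compact_outer n : compact (outer n).
Proof.
elim: n => [|n IH] /=; first exact: compact0.
by apply: compactU => //; exact: (compact_image simT IH).
Qed.

Lemma outer_cover n x : K x -> (iter n T @` K) x \/ outer n x.
Proof.
elim: n x => [|n IH] x Kx; first by left; exists x.
have [[y Ky <-]|Ox] := cover Kx; last by right; left.
have [[z Kz <-]|h] := IH y Ky; first by left; exists z.
by right; right; exists y.
Qed.

(** For large [n] the leg passes from [T^n K] to [outer n], hence meets some [T^k O] with [k < n]
    inside [T^n K]. Pulled back by [T^k], the meeting point lies in the finite set shared by [O] and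
    [T K]; moreover [n - k] is bounded, since high powers of [T] bring [K] closer to [q] than [O]
    is. Two values of [n] with the same pulled-back point and the same [n - k] give two points of
    the leg related by a power of [T]. *)
Lemma spiral_of_leg f : leg K q f -> spiral T K q.
Proof.
move=> [cf f0 fK fq].
have [M M0 hM] := compact_modulus_bounded cK.
have rn n := (iter_similarity n simT).1.
have far e : 0 < e -> exists N, forall n, (N <= n)%N -> forall x, K x -> modulus (iter n T x - q) < e.
  move=> e0; have [N hN] := expr_small (M + M) r0 r1 e0.
  exists N => n Nn x Kx; apply: le_lt_trans (hN n Nn).
  rewrite -{1}(iter_fix n Tq) (iter_similarity n simT).2 mulrC ler_pM2r//.
  by apply: le_trans (modulusD _ _) _; rewrite modulusN lerD// hM.
have [d d0 hd] : exists2 d : R, 0 < d & forall y, O y -> d <= modulus (y - q).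
  apply: contrapT => h; apply: nOq.
  have cl := compact_closed complex_hausdorff cO.
  apply: (closed_complexP O).1 => // e e0; apply: contrapT => h1; apply: h; exists e => // y Oy.
  by rewrite leNgt; apply/negP => h2; apply: h1; exists y.
have [J hJ] := far d d0.
have f1 : 0 < modulus (f 1 - q) by rewrite modulus_gt0 subr_eq0 fq// ltr01 lexx.
have [n0 hn0] := far _ f1.
have [E hE] := (finite_seqP _).1 finE.
have step n : (n0 <= n)%N -> exists t j y, [/\ 0 < t <= 1, (j <= J)%N, (j <= n)%N,
    y \in E & f t = iter (n - j) T y].
  move=> n0n.
  have [t [t01 [w Kw ew] /outerP[k [y [kn Oy ey]]]]] :
      exists t, [/\ 0 <= t <= 1, (iter n T @` K) (f t) & outer n (f t)].
    apply: covering_path_meets => //.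
    - apply: compact_closed; first exact: complex_hausdorff.
      exact: (compact_image (iter_similarity n simT) cK).
    - by apply: compact_closed; [exact: complex_hausdorff|exact: compact_outer].
    - by move=> t; exact: outer_cover.
    - by exists q; rewrite ?f0 ?iter_fix.
    have [[z Kz ez]|//] := outer_cover n (fK 1).
    by have := hn0 n n0n z Kz; rewrite ez ltxx.
  have yw : y = iter (n - k) T w.
    apply: (similarity_inj (iter_similarity k simT)).
    by rewrite ey -ew -iterD subnKC// ltnW.
  exists t, (n - k)%N, y; split.
  - case/andP: t01 => t0 ->; rewrite andbT lt_neqAle t0 andbT eq_sym.
    apply/eqP => e; apply: nOq; move: ey; rewrite e f0 -{1}(iter_fix k Tq).
    by move=> /(similarity_inj (iter_similarity k simT)) <-.
  - rewrite leqNgt; apply/negP => /ltnW h; have := hJ _ h w Kw.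
    by rewrite -yw ltNge hd.
  - exact: leq_subr.
  - have : ((T @` K) `&` O) y.
      split=> //; rewrite yw -(subnSK kn); exists (iter (n - k.+1) T w) => //.
      by elim: (n - k.+1)%N => //= ? ?; exact: TK.
    by rewrite hE.
  - by rewrite subKn ?ey// ltnW.
have /choice[F hF] : forall n, exists F : R * nat * R[i], [/\ 0 < F.1.1 <= 1, (F.1.2 <= J)%N,
    (F.1.2 <= n0 + n)%N, F.2 \in E & f F.1.1 = iter (n0 + n - F.1.2) T F.2].
  by move=> n; have [t [j [y h]]] := step (n0 + n)%N (leq_addr _ _); exists (t, j, y).
have [a [b [ab]]] := infinite_pigeonhole
  (fun n => (inord (F n).1.2 : 'I_J.+1, inord (index (F n).2 E) : 'I_(size E).+1)).
move=> [/(congr1 val) /= + /(congr1 val) /=].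
have [ta ja1 ja2 ya ea] := hF a; have [tb jb1 jb2 yb eb] := hF b.
rewrite !inordK ?ltnS ?(ltnW (_ : (index _ _ < _)%N)) ?index_mem// => ej ei.
have ey : (F a).2 = (F b).2 by rewrite -(nth_index 0 ya) ei nth_index.
exists (b - a)%N, (fun s => f ((F a).1.1 + ((F b).1.1 - (F a).1.1) * clamp s)); split.
- by rewrite subn_gt0.
- apply: (cont_comp _ cf); apply: contDr; first exact: cont_cst.
  by apply: contMr; [exact: cont_cst|exact: continuous_clamp].
- move=> s; split; first exact: fK.
  apply: fq; move: ta tb => /andP[a0 a1] /andP[b0 b1].
  have c0 := clamp_ge0 s; have c1 := clamp_le1 s.
  have c1' : 0 <= 1 - clamp s by rewrite subr_ge0.
  have e1 : (F a).1.1 + ((F b).1.1 - (F a).1.1) * clamp s =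
    (F a).1.1 * (1 - clamp s) + (F b).1.1 * clamp s by ring.
  have e2 : 1 - ((F a).1.1 + ((F b).1.1 - (F a).1.1) * clamp s) =
    (1 - (F a).1.1) * (1 - clamp s) + (1 - (F b).1.1) * clamp s by ring.
  apply/andP; split; last first.
    by rewrite -subr_ge0 e2 addr_ge0// mulr_ge0// subr_ge0.
  rewrite e1; have [->|h] := eqVneq (clamp s) 0; first by rewrite subr0 mulr1 mulr0 addr0.
  have : 0 < (F b).1.1 * clamp s by rewrite mulr_gt0// lt_neqAle eq_sym h.
  by have := mulr_ge0 (ltW a0) c1'; lra.
- rewrite clamp1 clamp0 mulr1 mulr0 addr0 addrC subrK eb ea -ey -ej -iterD; congr iter.
  by rewrite addnBA// addnCA subnK// ltnW.
Qed.

End Exits.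

End Curves.

(** * Words, their pieces, and the pieces through a fixed point *)

Section System.
Context {R : realType} {m s : nat}.
Variables (S : 'I_m -> R[i] -> R[i]) (K : set R[i]) (rat : 'I_m -> R).
Hypothesis simS : forall i, similarity (S i) (rat i).
Hypothesis rat1 : forall i, rat i < 1.
Hypothesis attr : is_attractor S K.
Hypothesis connK : connected K.
Hypothesis FI : forall i j : 'I_m, i != j -> ((S i @` K) `&` (S j @` K) #<= `I_s)%card.
Implicit Types (w v : seq 'I_m) (x y z : R[i]).

Let cK : compact K. Proof. by case: attr. Qed.

Lemma ratio_upper : exists rho : R, [/\ 0 < rho, rho < 1 & forall i, rat i <= rho].
Proof.
have [|d d0 hd] := @uniform_pos R 'I_m (fun i d => d < 1 /\ rat i <= 1 - d).
  move=> i; exists (Num.min (1 - rat i) (1 / 2)).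
    by rewrite lt_min subr_gt0 rat1 divr_gt0.
  by move=> d' _; rewrite le_min => /andP[h1 h2]; split; lra.
have [[c Kc] _ _] := attr; have [i _] := attractor_cover attr Kc.
exists (1 - d); split; last by move=> j; have [] := hd j.
  by rewrite subr_gt0; have [] := hd i.
by rewrite ltrBlDr ltrDl.
Qed.

Lemma ratio_lower : exists2 c : R, 0 < c & forall i, c <= rat i.
Proof. by apply: uniform_pos => i; exists (rat i) => //; have [] := simS i. Qed.

Lemma attractor_path_connected : path_connected K.
Proof.
have [rho [rho0 rho1 hr]] := ratio_upper; move=> x y.
apply: (@attractor_path _ _ S K rho rho0 rho1 _ attr connK x y) => i u v.
by rewrite (simS i).2 ler_wpM2r// modulus_ge0.
Qed.

Definition word_ratio w : R := \prod_(i <- w) rat i.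

Lemma word_similarity w : similarity (word_map S w) (word_ratio w).
Proof.
elim: w => [|i w IH]; rewrite /word_ratio ?big_nil ?big_cons; first exact: similarity_id.
exact: similarity_comp.
Qed.

Lemma word_map_cat w v : word_map S (w ++ v) = word_map S w \o word_map S v.
Proof. by elim: w => //= i w ->. Qed.

Lemma word_attractor w x : K x -> K (word_map S w x).
Proof. by move=> Kx; elim: w => //= i w; exact: (attractor_map attr). Qed.

Lemma piece_cat w v : piece S K (w ++ v) `<=` piece S K w.
Proof. by move=> _ [x Kx <-]; rewrite word_map_cat; exists (word_map S v x) => //; exact: word_attractor. Qed.

Lemma piece_cover n x : K x -> exists2 w, size w = n & piece S K w x.
Proof.
elim: n x => [|n IH] x Kx; first by exists [::] => //; exists x.
have [i [y [Ky <-]]] := attractor_cover attr Kx; have [w <- [z Kz <-]] := IH y Ky.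
by exists (i :: w) => //; exists z.
Qed.

Lemma piece_extend w x : piece S K w x -> exists i, piece S K (rcons w i) x.
Proof.
move=> [y Ky <-]; have [i [z [Kz <-]]] := attractor_cover attr Ky.
by exists i; rewrite -cats1; exists z => //; rewrite word_map_cat.
Qed.

(** A common prefix only applies an injective map; at the first differing letter the bound for
    first-level pieces applies. *)
Lemma piece_inter w v : size w = size v -> w != v ->
  (piece S K w `&` piece S K v #<= `I_s)%card.
Proof.
elim: w v => [|i w IH] [|j v] //= [swv]; rewrite eqseq_cons negb_and.
have [->|ij _] := eqVneq i j => /= [wv|].
  apply: card_le_trans (IH v swv wv).
  apply: card_le_trans (card_image_le (S j) _); apply: subset_card_le.
  move=> _ [[x Kx <-] [y Ky /(similarity_inj (simS j)) e]] /=.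
  by exists (word_map S w x) => //; split; [exists x|exists y].
apply: card_le_trans (FI ij); apply: subset_card_le => z [[x Kx ex] [y Ky ey]].
by split; [exists (word_map S w x)|exists (word_map S v y)] => //; exact: word_attractor.
Qed.

Lemma card_le_no_inj (A : set R[i]) (g : nat -> R[i]) : (A #<= `I_s)%card ->
  (forall k, (k <= s)%N -> A (g k)) ->
  (forall j k, (j <= s)%N -> (k <= s)%N -> g j = g k -> j = k) -> False.
Proof.
move=> hA gA ginj.
have h : (`I_s.+1 #<= A)%card.
  apply: (@card_le_trans _ _ _ (g @` `I_s.+1)).
    have /card_eqPle[_] // : (g @` `I_s.+1 #= `I_s.+1)%card.
    by apply: inj_card_eq => j k; rewrite !inE /= !ltnS; exact: ginj.
  by apply: subset_card_le => _ [k /= ks <-]; exact: gA.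
by have := card_le_trans h hA; rewrite card_le_II ltnn.
Qed.

Lemma word_ratio_lt1 (w : seq 'I_m) : w != [::] -> word_ratio w < 1.
Proof.
case: w => // i w _; have h v : 0 < word_ratio v <= 1.
  rewrite /word_ratio; apply: (big_ind (fun b : R => 0 < b <= 1)) => [|a b|j _].
  - by rewrite ltr01 lexx.
  - move=> /andP[a0 a1] /andP[b0 b1]; rewrite mulr_gt0//=.
    by apply: mulr_ile1 => //; exact: ltW.
  - by rewrite (simS j).1 ltW.
have /andP[h0 h1] := h w; rewrite /word_ratio big_cons.
apply: le_lt_trans (rat1 i); rewrite ler_piMr//; exact: ltW (simS i).1.
Qed.

Section FixedPoint.
Variables (U : seq 'I_m) (q al : R[i]).
Hypothesis U0 : U != [::].
Hypothesis Kq : K q.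
Let T := word_map S U.
Hypothesis Tq : T q = q.
Hypothesis Tal : forall x y, T x - T y = al * (x - y).
Let r := word_ratio U.
Let simT : similarity T r := word_similarity U.

(** This is the set [O] of the exit argument. Indexing by tuples makes the union finite, hence
    compact. *)
Definition others : set R[i] :=
  \bigcup_(w in [set w : (size U).-tuple 'I_m | tval w != U]) piece S K w.

Lemma compact_others : compact others.
Proof.
have fin : finite_set [set w : (size U).-tuple 'I_m | tval w != U] by exact: finite_finset.
have [l hl] := (finite_seqP _).1 fin.
rewrite /others hl bigcup_seq; apply: bigsetU_compact => w _.
exact: (compact_image (word_similarity w) cK).
Qed.

Lemma others_cover : K `<=` (T @` K) `|` others.
Proof.
move=> x Kx; have [w sw hw] := piece_cover (size U) Kx.
have [e|e] := eqVneq w U; first by left; rewrite e in hw.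
by right; exists (Tuple (introT eqP sw)).
Qed.

Lemma finite_others : finite_set ((T @` K) `&` others).
Proof.
rewrite /others setI_bigcupr; apply: bigcup_finite; first exact: finite_finset.
move=> w /= wU; apply: card_le_finite (finite_II s).
by apply: piece_inter; rewrite ?size_tuple// eq_sym.
Qed.

(* [G] and [H] parametrize a piece inside [T K] and a piece inside [K_w], both
   containing [q], and [f] is [G^-1 o H]. There are such pairs at all scales, and
   up to a power of [T] the pieces vary in a compact family, so the pigeonhole
   principle makes [f] close to the identity. *)
Lemma near_identity_pair (w : seq 'I_m) (e : R) : 0 < e -> piece S K w q ->
  exists G H f : R[i] -> R[i], [/\ continuous f, injective G,
    (forall z, K z -> modulus (f z - z) < e),
    (forall z, G (f z) = H z) &
    (forall z, K z -> (T @` K) (G z)) /\ (forall z, K z -> piece S K w (H z))].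
Proof.
move=> e0 hw.
have [c c0 hc] := ratio_lower; have [rho [rho0 rho1 hr]] := ratio_upper.
have r0 : 0 < r by case: simT.
have r1 : r < 1 by exact: word_ratio_lt1.
have wr v : 0 < word_ratio v by case: (word_similarity v).
(* The word is extended, always through [q], until its ratio first drops to [b]; the last letter
   costs a factor at least [c]. The exponent [n] bounds the number of letters. *)
have pieces_at_scale b : 0 < b -> forall n v, piece S K v q -> word_ratio v * rho ^+ n <= b ->
    b <= word_ratio v -> exists u, [/\ piece S K (v ++ u) q, c * b <= word_ratio (v ++ u) &
      word_ratio (v ++ u) <= b].
  move=> b0; elim=> [|n IH] v hv.
    rewrite expr0 mulr1 => h1 h2; exists [::]; rewrite cats0; split=> //.
    have [i _] := attractor_cover attr Kq.
    have := hc i; have := rat1 i => h3 h4.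
    by apply: le_trans h2; rewrite ler_piMl ?(ltW b0)//; lra.
  move=> h1 h2; have [i hi] := piece_extend hv.
  have ei : word_ratio (rcons v i) = word_ratio v * rat i.
    by rewrite /word_ratio -cats1 big_cat big_seq1.
  have [h|h] := leP (word_ratio (rcons v i)) b.
    exists [:: i]; rewrite cats1; split=> //; rewrite ei mulrC.
    apply: ler_pM => //; exact: ltW.
  have [|u] := IH _ hi _ (ltW h); last by rewrite -cats1 -catA => ?; exists (i :: u).
  apply: le_trans h1; rewrite ei exprS mulrA ler_wpM2r ?exprn_ge0 ?(ltW rho0)//.
  by rewrite ler_wpM2l ?(ltW (wr v)).
have /choice[u hu] : forall k : nat, exists u, [/\ piece S K (w ++ u) q,
    c * (word_ratio w * r ^+ k) <= word_ratio (w ++ u) &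
    word_ratio (w ++ u) <= word_ratio w * r ^+ k].
  move=> k; have b0 : 0 < word_ratio w * r ^+ k by rewrite mulr_gt0 ?exprn_gt0.
  have [n hn] := expr_small (word_ratio w) rho0 rho1 b0.
  apply: (pieces_at_scale _ b0 n) => //; first by apply: ltW; exact: hn.
  by rewrite ler_piMr ?(ltW (wr w))// exprn_ile1 ?(ltW r0) ?(ltW r1).
pose tau k := word_map S (w ++ u k).
have /choice[F hF] : forall k, exists F : R[i] * bool * R[i],
    [/\ K F.2, tau k F.2 = q, modulus F.1.1 = word_ratio (w ++ u k) &
      forall x y, tau k x - tau k y = F.1.1 * cj F.1.2 (x - y)].
  move=> k; have [[x Kx ex] _ _] := hu k.
  by have [a [b [ha hb]]] := similarity_form (word_similarity (w ++ u k)); exists (a, b, x).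
have hal : modulus al = r.
  have := simT.2 1 0; rewrite Tal modulusM subr0 modulus1 !mulr1 //.
have al0 k : al ^+ k != 0 by rewrite expf_neq0// -modulus_gt0 hal.
have mal k : modulus (al ^+ k) = r ^+ k.
  elim: k => [|k IH]; first by rewrite !expr0 modulus1.
  by rewrite !exprS modulusM IH hal.
have iterT k x y : iter k T x - iter k T y = al ^+ k * (x - y).
  elim: k => [|k IH]; first by rewrite expr0 mul1r.
  by rewrite /= Tal IH mulrA exprS.
(* Division by the coefficient of [T^k] keeps the moduli of [a k] between [c * b0] and [b0]. *)
have [a aE] : exists a : nat -> R[i], forall k, (F k).1.1 = a k * al ^+ k.
  by exists (fun k => (F k).1.1 / al ^+ k) => k; rewrite divfK.
pose b0 := word_ratio w.
have rk k : 0 < r ^+ k by rewrite exprn_gt0.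
have ma k : modulus (a k) = word_ratio (w ++ u k) / r ^+ k.
  have [_ _ <- _] := hF k; rewrite aE modulusM mal mulfK// gt_eqF ?rk//.
have ma1 k : modulus (a k) <= b0 by rewrite ma ler_pdivrMr//; have [] := hu k.
have ma2 k : c * b0 <= modulus (a k).
  by rewrite ma ler_pdivlMr// -mulrA; have [] := hu k.
have [M M0 hM] := compact_modulus_bounded cK.
have b00 : 0 < b0 by exact: wr.
have [B B0 BE] : exists2 B : R, 0 < B & B = (M + M) + b0.
  by exists (M + M + b0) => //; rewrite !addr_gt0.
(* By the formula [HG] below, [H] and [G] differ by at most [r ^+ j * (d * B)]; applying [G^-1]
   divides this by [r ^+ j * modulus (a i)], leaving at most [e / 2]. *)
pose d := e * (c * b0) / (B + B).
have d0 : 0 < d by rewrite divr_gt0 ?mulr_gt0 ?addr_gt0.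
have hb0 : b0 <= b0 + M by rewrite lerDl ltW.
have hbM : M <= b0 + M by rewrite lerDr ltW.
have KF k : K (F k).2 by have [] := hF k.
have [i [j [ij eij hai hxi]]] := @close_pair R a (fun k => (F k).2) (fun k => (F k).1.2) _ d d0
  (fun k => le_trans (ma1 k) hb0) (fun k => le_trans (hM _ (KF k)) hbM).
(* The power of [T] brings the [i]-th piece to the scale of the [j]-th; it is positive, so the image
   of [G] lies in [T K]. *)
pose G := iter (j - i) T \o tau i; pose H := tau j.
have simG : similarity G (r ^+ (j - i) * word_ratio (w ++ u i)).
  by apply: similarity_comp; [exact: iter_similarity|exact: word_similarity].
have [G' [simG' GK G'K]] := similarity_inverse simG.
have simH : similarity H (word_ratio (w ++ u j)) by exact: word_similarity.
have Iij : (i + (j - i))%N = j by rewrite subnKC// ltnW.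
exists G, H, (G' \o H); split.
- apply: cont_comp; first exact: similarity_continuous simH.
  exact: similarity_continuous simG'.
- exact: similarity_inj simG.
- move=> z Kz.
  have [_ qi _ Fi] := hF i; have [_ qj _ Fj] := hF j.
  have HG : H z - G z = al ^+ j * ((a j - a i) * cj (F j).1.2 (z - (F j).2) +
      a i * cj (F j).1.2 ((F i).2 - (F j).2)).
    have -> : H z = tau j z - tau j (F j).2 + q by rewrite qj subrK.
    have -> : G z = iter (j - i) T (tau i z) - iter (j - i) T (tau i (F i).2) + q.
      by rewrite qi (iter_fix _ Tq) subrK.
    have alj : al ^+ j = al ^+ i * al ^+ (j - i) by rewrite -exprD Iij.
    by rewrite iterT Fi Fj !aE (eij : (F i).1.2 = (F j).1.2) !cjB alj; ring.
  have h := simG.2 (G' (H z)) z; rewrite G'K HG modulusM mal in h.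
  have bnd : modulus ((a j - a i) * cj (F j).1.2 (z - (F j).2) +
      a i * cj (F j).1.2 ((F i).2 - (F j).2)) <= d * B.
    apply: le_trans (modulusD _ _) _; rewrite !modulusM !modulus_cj BE mulrDr; apply: lerD.
      apply: ler_pM; rewrite ?modulus_ge0//; first by rewrite modulusC ltW.
      by apply: le_trans (modulusD _ _) _; rewrite modulusN lerD ?hM.
    by rewrite [d * _]mulrC; apply: ler_pM; rewrite ?modulus_ge0// ?(ltW hxi).
  have e1 : r ^+ (j - i) * word_ratio (w ++ u i) = r ^+ j * modulus (a i).
    by rewrite ma -[in RHS]Iij exprD; field; rewrite gt_eqF.
  move: h; rewrite e1 -mulrA => /(mulfI (lt0r_neq0 (rk j))) h.
  have dB : d * B = e * (c * b0) / 2.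
    by rewrite /d; field; rewrite !gt_eqF ?addr_gt0.
  have h2 : modulus (a i) * modulus (G' (H z) - z) < c * b0 * e.
    rewrite -h; apply: le_lt_trans bnd _; rewrite dB mulrC mulrA.
    have : 0 < c * b0 * e by rewrite !mulr_gt0.
    lra.
  rewrite -(ltr_pM2l (mulr_gt0 c0 b00)); apply: le_lt_trans h2.
  by rewrite ler_wpM2r ?modulus_ge0.
- by move=> z; rewrite /= G'K.
- split=> z Kz; last by apply: (@piece_cat _ (u j)); exists z.
  have : (0 < j - i)%N by rewrite subn_gt0.
  rewrite /G /=; case: (j - i)%N => // k _; exists (iter k T (tau i z)) => //.
  by elim: k => [|k IH] /=; exact: word_attractor.
Qed.

End FixedPoint.

End System.

(** * Existence of the spiral *)

Section SpiralExistence.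
Context {R : realType}.
Implicit Types (x y z : R[i]).

Lemma triod_image (L : 'I_3 -> R -> R[i]) z0 g r : similarity g r -> triod L z0 ->
  triod (fun i t => g (L i t)) (g z0).
Proof.
move=> sg [cL L0 d]; split.
- by move=> i; exact: (cont_comp (cL i) (similarity_continuous sg)).
- by move=> i; rewrite L0.
- by move=> i j a b ij a01 b01 /(similarity_inj sg); exact: d.
Qed.

Lemma triod_restrict (L : 'I_3 -> R -> R[i]) z0 (eta : R) : 0 < eta -> eta <= 1 ->
  triod L z0 -> triod (fun i t => L i (eta * t)) z0.
Proof.
move=> e0 e1 [cL L0 d]; have e01 (t : R) : 0 <= t <= 1 -> 0 <= eta * t <= 1.
  have e0' := ltW e0; case/andP=> t0 t1; apply/andP; split; first exact: mulr_ge0.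
  exact: mulr_ile1.
split.
- move=> i; apply: (cont_comp _ (cL i)).
  by apply: contMr; [exact: cont_cst|exact: cont_id].
- by move=> i; rewrite mulr0 L0.
- move=> i j a b ij /e01 a01 /e01 b01 /(d _ _ _ _ ij a01 b01)[/eqP + /eqP].
  by rewrite !mulf_eq0 !(gt_eqF e0) /= => /eqP-> /eqP->.
Qed.

(** Cut short, the triod lies in a thin annulus about [q], and the images of this annulus under the
    powers of [T] are disjoint. *)
Lemma disjoint_triods T r q (L : 'I_3 -> R -> R[i]) z1 : similarity T r -> r < 1 -> T q = q ->
  triod L z1 -> z1 != q -> exists Y : nat -> 'I_3 -> R -> R[i],
  [/\ forall k, triod (Y k) (iter k T z1),
      forall k i t, exists u, Y k i t = iter k T (L i u) &
      forall j k z, (j < k)%N -> triod_points (Y j) z -> triod_points (Y k) z -> False].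
Proof.
move=> sT r1 Tq tL z1q; have [cL L0 _] := tL; have r0 : 0 < r by case: sT.
pose D := modulus (z1 - q); have D0 : 0 < D by rewrite modulus_gt0 subr_eq0.
(* This thickness gives [r * (D + h) < D - h]: the next annulus lies strictly inside. *)
pose h := D * (1 - r) / 4.
have h0 : 0 < h by rewrite divr_gt0// mulr_gt0// subr_gt0.
have [eta e0 [e1 he]] : exists2 e : R, 0 < e & e <= 1 /\ forall i, forall s, 0 <= s -> s <= e ->
    modulus (L i s - z1) < h.
  have [e e0 he] : exists2 e : R, 0 < e & forall i, e <= 1 /\ forall s, 0 <= s -> s <= e ->
      modulus (L i s - z1) < h.
    apply: uniform_pos => i; have [d d0 hd] := @cont_modulusP R (L i) 0 h (cL i) h0.
    exists (Num.min 1 d); first by rewrite lt_min ltr01.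
    move=> d' d'0; rewrite le_min => /andP[d'1 d'd]; split=> // t t0 td.
    by rewrite -(L0 i); apply: hd; rewrite subr0 ger0_norm// (le_trans td).
  by exists e => //; split; [have [] := he ord0|move=> i; have [] := he i].
exists (fun k i t => iter k T (L i (eta * t))); split.
- by move=> k; apply: (triod_image (iter_similarity k sT)); exact: triod_restrict.
- by move=> k i t; exists (eta * t).
have rk k : 0 < r ^+ k by rewrite exprn_gt0.
have annulus k z : triod_points (fun i t => iter k T (L i (eta * t))) z ->
    r ^+ k * (D - h) < modulus (z - q) < r ^+ k * (D + h).
  move=> [i [t [/andP[t0 t1] <-]]]; rewrite -{1 2}(iter_fix k Tq) (iter_similarity k sT).2.
  rewrite !ltr_pM2l//.
  have e0' := ltW e0; have := he i (eta * t) (mulr_ge0 e0' t0) (ler_piMr e0' t1).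
  have := modulus_tri (L i (eta * t)) z1 q; have := modulus_tri z1 (L i (eta * t)) q.
  by rewrite (modulusC z1 (L i _)) -/D => *; apply/andP; split; lra.
move=> j k z jk /annulus/andP[h1 _] /annulus/andP[_ h2].
have Dh : 0 < D + h by exact: addr_gt0.
have h3 : r ^+ k * (D + h) <= r ^+ j * (r * (D + h)).
  rewrite mulrA -exprSr; apply: ler_wpM2r; first exact: ltW.
  by rewrite -(subnKC jk) exprD ler_piMr ?exprn_ile1 ?(ltW r0) ?(ltW r1)// ltW ?rk.
have h4 : r * (D + h) < D - h.
  have rh : r * h < h by rewrite gtr_pMl.
  have e : h * 4 = D - r * D by rewrite /h; field.
  by rewrite mulrDr; lra.
have := lt_trans h1 h2; have := ltr_pM2l (rk j) (r * (D + h)) (D - h); rewrite h4.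
by move=> *; lra.
Qed.

(** Adding the two clamped paths and subtracting the junction point avoids a case distinction: on
    each half one of the terms equals that point. *)
Lemma path_concat (f g : R -> R[i]) : continuous f -> continuous g -> f 1 = g 0 ->
  exists h : R -> R[i], [/\ continuous h, h 0 = f 0, h 1 = g 1 & forall u, exists2 v : R,
    0 <= v <= 1 & h u = f v \/ h u = g v].
Proof.
move=> cf cg e; exists (fun u => f (clamp (2 * u)) + g (clamp (2 * u - 1)) - g 0).
have c2 : continuous (fun u : R => 2 * u) by apply: contMr; [exact: cont_cst|exact: cont_id].
split.
- apply: contBc; last exact: cont_cst.
  apply: contDc.
    by apply: (cont_comp _ cf); exact: cont_clamp.
  apply: (cont_comp _ cg); apply: cont_clamp; apply: contBr; first exact: c2.
  exact: cont_cst.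
- have h : 2 * 0 - 1 <= 0 :> R by lra.
  by rewrite (clamp_le0 h) mulr0 clamp0 addrK.
- have h : 1 <= 2 * 1 :> R by lra.
  by rewrite (clamp_ge1 h) e mulr1 (_ : 2 - 1 = 1) ?clamp1 1?addrC ?addKr//; ring.
- move=> u; have [h|h] := leP u (1 / 2).
    exists (clamp (2 * u)); first exact: clamp_itv.
    by left; rewrite (@clamp_le0 _ (2 * u - 1)) ?addrK//; lra.
  exists (clamp (2 * u - 1)); first exact: clamp_itv.
  by right; rewrite (@clamp_ge1 _ (2 * u)) ?e 1?addrC ?addKr//; lra.
Qed.

(** The path goes from [T^i (f 1)] back along [T^i f] to the meeting point, then along [T^j f] to
    [T^j (f 1)], which is the image of its origin under [T^(j - i)]. *)
Lemma spiral_of_meeting (K : set R[i]) T r q f (i j : nat) (a b : R) : similarity T r ->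
  T q = q -> (forall x, K x -> K (T x)) -> leg K q f -> (i < j)%N ->
  0 < a <= 1 -> 0 < b <= 1 -> iter i T (f a) = iter j T (f b) -> spiral T K q.
Proof.
move=> sT Tq TK [cf f0 fK fq] ij a01 b01 e.
have iK k x : K x -> K (iter k T x) by elim: k => //= k IH /IH; exact: TK.
have ic k : continuous (iter k T) by exact: (similarity_continuous (iter_similarity k sT)).
have iq k t : 0 < t <= 1 -> iter k T (f t) != q.
  move=> t01; rewrite -(iter_fix k Tq); apply: contra (fq t t01) => /eqP h.
  by apply/eqP/(similarity_inj (iter_similarity k sT)).
have [|||h [ch h0 h1 hh]] := @path_concat (fun u => iter i T (f (1 + (a - 1) * u)))
   (fun u => iter j T (f (b + (1 - b) * u))).
- apply: (cont_comp _ (ic i)); apply: (cont_comp _ cf); apply: contDr; first exact: cont_cst.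
  by apply: contMr; [exact: cont_cst|exact: cont_id].
- apply: (cont_comp _ (ic j)); apply: (cont_comp _ cf); apply: contDr; first exact: cont_cst.
  by apply: contMr; [exact: cont_cst|exact: cont_id].
- by rewrite mulr1 mulr0 addr0 addrC subrK e.
exists (j - i)%N, h; split=> //; first by rewrite subn_gt0.
  move=> u; case/andP: a01 => a0 a1; case/andP: b01 => b0 b1.
  have [v /andP[v0 v1] [->|->]] := hh u; (split; first exact: iK); apply: iq.
    have : (1 - a) * v <= 1 - a by rewrite ler_piMr// subr_ge0.
    have : 0 <= (1 - a) * v by rewrite mulr_ge0// subr_ge0.
    have -> : (a - 1) * v = - ((1 - a) * v) by ring.
    by move=> *; apply/andP; split; lra.
  have : (1 - b) * v <= 1 - b by rewrite ler_piMr// subr_ge0.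
  have : 0 <= (1 - b) * v by rewrite mulr_ge0// subr_ge0.
  by move=> *; apply/andP; split; lra.
by rewrite h1 h0 mulr0 addr0 mulr1 addrC subrK -iterD subnK// ltnW.
Qed.

Context {m s : nat}.
Variables (S : 'I_m -> R[i] -> R[i]) (K : set R[i]) (rat : 'I_m -> R).
Hypothesis simS : forall i, similarity (S i) (rat i).
Hypothesis rat1 : forall i, rat i < 1.
Hypothesis attr : is_attractor S K.
Hypothesis connK : connected K.
Hypothesis FI : forall i j : 'I_m, i != j -> ((S i @` K) `&` (S j @` K) #<= `I_s)%card.
Variables (U : seq 'I_m) (q al : R[i]).
Hypothesis U0 : U != [::].
Hypothesis Kq : K q.
Let T := word_map S U.
Hypothesis Tq : T q = q.
Hypothesis Tal : forall x y, T x - T y = al * (x - y).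
Let r := word_ratio rat U.
Let simT : similarity T r := word_similarity simS U.
Let r1 : r < 1 := word_ratio_lt1 simS rat1 U0.

(** If every map fixed [q], all pieces would contain [q] and shrink to it, leaving no other point in
    [K]. *)
Lemma moved_point x : K x -> x != q -> exists i, S i q != q.
Proof.
move=> Kx xq; apply: contrapT => h.
have fixq w : word_map S w q = q.
  elim: w => //= i w ->; apply/eqP/negPn/negP => hi; apply: h; by exists i.
have [rho [rho0 rho1 hr]] := ratio_upper rat1 attr.
have [_ cK _] := attr; have [M M0 hM] := compact_modulus_bounded cK.
have d0 : 0 < modulus (x - q) by rewrite modulus_gt0 subr_eq0.
have [n hn] := expr_small (M + M) rho0 rho1 d0.
have [w sw [y Ky ey]] := piece_cover attr n Kx.
have := hn n (leqnn n); rewrite ltNge => /negP; apply.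
rewrite -ey -{1}(fixq w) (word_similarity simS w).2 mulrC.
apply: ler_pM; rewrite ?modulus_ge0 ?(ltW (word_similarity simS w).1)//.
  by apply: le_trans (modulusD _ _) _; rewrite modulusN lerD ?hM.
rewrite -sw /word_ratio; elim: w {sw ey} => [|i w IH]; first by rewrite big_nil.
rewrite big_cons exprS; apply: ler_pM => //; first exact: ltW (simS i).1.
exact: ltW (word_similarity simS w).1.
Qed.

(** Each of [s + 1] disjoint triods meets its image under the near-identity [f], which yields a
    point [H z = G (f z)] common to [T K] and the piece of [w]. These points are distinct because
    [G] is injective and the triods are disjoint. *)
Lemma no_triod (L : 'I_3 -> R -> R[i]) (z0 : R[i]) (w : seq 'I_m) : triod L z0 ->
  (forall i t, K (L i t)) -> size w = size U -> w != U -> piece S K w q -> False.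
Proof.
move=> tL KL sw wU hw.
(* A triod centred at [q] would share its centre with all its images under the powers of [T]; some
   [S i] moves it away. *)
have [L1 [z1 [tL1 KL1 z1q]]] : exists (L : 'I_3 -> R -> R[i]) z1,
    [/\ triod L z1, forall i t, K (L i t) & z1 != q].
  have [e|ne] := eqVneq z0 q; last by exists L, z0.
  have [cL L0 d] := tL; have [|i hi] := @moved_point (L ord0 1) (KL _ _).
    rewrite -e; apply/eqP => h.
    have [||//|/eqP] := d ord0 (inord 1) 1 0 _ _ _ (etrans h (esym (L0 (inord 1)))).
    - by rewrite -val_eqE /= inordK.
    - by rewrite ler01 lexx.
    - by rewrite ler01 lexx.
    by rewrite oner_eq0.
  exists (fun k t => S i (L k t)), (S i z0); split.
  - exact: triod_image (simS i) tL.
  - by move=> k t; exact: (attractor_map attr).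
  - by rewrite e.
have [Y [tY YL disj]] := disjoint_triods simT r1 Tq tL1 z1q.
have KY k z : triod_points (Y k) z -> K z.
  move=> [i [t [_ <-]]]; have [u ->] := YL k i t.
  by elim: k => [|k IH]; [exact: KL1|exact: (word_attractor attr)].
have [e e0 he] : exists2 e : R, 0 < e & forall k : 'I_s.+1, forall f : R[i] -> R[i], continuous f ->
    (forall z, triod_points (Y k) z -> modulus (f z - z) < e) ->
    exists2 z, triod_points (Y k) z & triod_points (Y k) (f z).
  apply: uniform_pos => k; have [e e0 he] := triod_perturbation (tY k).
  exists e => // e' _ e'e f cf hf; apply: he => // z /hf h; exact: lt_le_trans h e'e.
have [G [H [f [cf Ginj fe GH [GT Hw]]]]] := near_identity_pair simS rat1 attr U0 Kq Tq Tal e0 hw.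
have /choice[g hg] : forall k : nat, exists z, (k <= s)%N ->
    triod_points (Y k) z /\ triod_points (Y k) (f z).
  move=> k; have [ks|ks] := leqP k s; last by exists 0.
  have [z h1 h2] := he (Ordinal (ks : (k < s.+1)%N)) f cf (fun z hz => fe z (KY _ z hz)).
  by exists z.
apply: (@card_le_no_inj R s _ (fun k => H (g k)) (piece_inter simS attr FI sw wU)).
  move=> k /hg[h1 h2]; split; first by apply: Hw; exact: KY h1.
  by rewrite -GH; apply: GT; exact: KY h2.
move=> j k /hg[_ hj] /hg[_ hk]; rewrite -!GH => /Ginj e'.
have [jk|kj|//] := ltngtP j k; exfalso.
  by apply: (disj j k (f (g k))) => //; rewrite -e'.
by apply: (disj k j (f (g k))) => //; rewrite -e'.
Qed.

(* If there is no spiral, the images of a leg under [id], [T] and [T \o T] form a triod. *)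
Lemma spiral_exists x : K x -> x != q -> spiral T K q.
Proof.
move=> Kx xq; apply: contrapT => nspiral.
have [f lf _] := leg_exists (attractor_path_connected simS rat1 attr connK) Kq Kx xq.
have [cf f0 fK fq] := lf.
have TK x' : K x' -> K (T x') by exact: (word_attractor attr).
pose L (i : 'I_3) t := iter i T (f t).
have tL : triod L q.
  split.
  - move=> i; apply: (cont_comp cf).
    exact: (similarity_continuous (iter_similarity i simT)).
  - by move=> i; rewrite /L f0 iter_fix.
  move=> i j a b ij /andP[a0 a1] /andP[b0 b1] e.
  have z k t : 0 <= t -> t <= 1 -> iter k T (f t) = q -> t = 0.
    move=> t0 t1; rewrite -[RHS in _ = RHS -> _](iter_fix k Tq).
    move=> /(similarity_inj (iter_similarity k simT)) h; apply/eqP; apply: contrapT => /negP t0'.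
    by have := fq t; rewrite h eqxx lt_neqAle eq_sym t0' t0 t1 => /(_ isT).
  have [a00|a00] := eqVneq a 0.
    by split=> //; apply: (z j b b0 b1 (etrans (esym e) _)); rewrite a00 /L f0 iter_fix.
  have [b00|b00] := eqVneq b 0.
    by split=> //; apply: (z i a a0 a1 (etrans e _)); rewrite b00 /L f0 iter_fix.
  have a01 : 0 < a <= 1 by rewrite lt_neqAle eq_sym a00 a0.
  have b01 : 0 < b <= 1 by rewrite lt_neqAle eq_sym b00 b0.
  exfalso; apply: nspiral; have [h|h|h] := ltngtP i j.
  - exact: (spiral_of_meeting simT Tq TK lf h a01 b01 e).
  - exact: (spiral_of_meeting simT Tq TK lf h b01 a01 (esym e)).
  - by move: ij; rewrite -val_eqE /= h eqxx.
have LK i t : K (L i t).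
  by rewrite /L; elim: (nat_of_ord i) => //= k; exact: TK.
have nO : ~ others S K U q.
  by move=> [w wU hw]; exact: (no_triod tL LK (size_tuple w) wU hw).
apply: nspiral; have [_ cK _] := attr.
apply: (spiral_of_leg simT r1 Tq cK (compact_others simS attr (U := U)) Kq TK) lf => //.
- exact: others_cover.
- exact: (finite_others simS attr FI).
Qed.

End SpiralExistence.

(** * Barriers *)

Section Barriers.
Context {R : realType}.
Implicit Types (z w p : R[i]) (a b c lam M : R) (W : set R[i]) (f : R -> R[i]).

(* In logarithmic coordinates centred at [p], the set [W] contains curves which
   stay in a strip of slope [lam] and run from abscissas tending to [-oo] to [b]. *)
Definition barrier W p lam b M : Prop := forall a, exists X Y : R -> R,
  [/\ continuous X, continuous Y, X 0 <= a, b <= X 1 &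
      forall t, 0 <= t <= 1 -> `|Y t - lam * X t| <= M /\
        W (p + (expR (X t))%:C * polar (Y t))].

Lemma polar_period (k : int) : polar (k%:~R * (pi *+ 2)) = 1 :> R[i].
Proof.
have h (n : nat) : polar (n%:R * (pi *+ 2)) = 1 :> R[i].
  elim: n => [|n IH]; first by rewrite mul0r polar0.
  rewrite -natr1 mulrDl mul1r polarD IH mul1r /polar cos2pi sin2pi //.
case: k => n; first exact: h.
by rewrite NegzE mulrNz mulNr polarN h invr1.
Qed.

Lemma cont_ln_modulus f p : continuous f -> (forall t, f t != p) ->
  continuous (fun t => ln (modulus (f t - p))).
Proof.
move=> cf fp t; have c : continuous (fun t => modulus (f t - p)).
  by apply: cont_modulus; apply: contBc; [exact: cf|exact: cont_cst].
have m0 : 0 < modulus (f t - p) by rewrite modulus_gt0 subr_eq0.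
exact: (cvg_comp _ _ (c t) (continuous_ln m0)).
Qed.

(** A larger increase of the deviation would leave room for a whole strip of width [2 * M],
    translated by a multiple of [2 * pi], between its initial and final values. The path would cross
    that strip from one edge to the other, hence the barrier curve inside it. *)
Lemma barrier_upper W p lam b M f th : barrier W p lam b M -> continuous f ->
  (forall t, f t != p) -> arg_lift (fun t => f t - p) th ->
  (forall t, 0 <= t <= 1 -> ln (modulus (f t - p)) <= b /\ ~ W (f t)) ->
  (th 1 - lam * ln (modulus (f 1 - p))) - (th 0 - lam * ln (modulus (f 0 - p)))
    <= M + M + pi *+ 2.
Proof.
move=> hW cf fp [cth hth] hf.
pose x t := ln (modulus (f t - p)); pose D t := th t - lam * x t.
have cx : continuous x by exact: cont_ln_modulus.
have cD : continuous D.
  by apply: contBr; [exact: cth|apply: contMr; [exact: cont_cst|exact: cx]].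
rewrite -/(x 1) -/(x 0) -/(D 1) -/(D 0) leNgt; apply/negP => hD.
have [c] := EVT_min ler01 (continuous_subspaceT cx).
rewrite in_itv /= => c01 hc.
have [X [Y [cX cY X0 X1 hXY]]] := hW (x c).
have pi2 : 0 < (pi : R) *+ 2 by rewrite mulrn_wgt0// pi_gt0.
(* This is the highest translate whose upper edge does not exceed [D 1]; its lower edge is still
   above [D 0]. *)
pose k := Num.floor ((D 1 - M) / (pi *+ 2)).
have /andP[k1 k2] : k%:~R <= (D 1 - M) / (pi *+ 2) < (k + 1)%:~R by exact: floor_itv.
move: k1 k2; rewrite ler_pdivlMr// ltr_pdivrMr// intrD mulrDl mul1r => k1 k2.
set P := k%:~R * (pi *+ 2) in k1 k2.
have x01 t : 0 <= t <= 1 -> x c <= x t <= b.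
  by move=> t01; rewrite hc ?in_itv//=; have [] := hf t t01.
have [||||||s [t [s01 t01 e1 e2]]] := @poincare_miranda R (fun u => X u.1 - x u.2)
   (fun u => Y u.1 - lam * X u.1 + P - D u.2).
- apply: contBr; first exact: (cont_comp (@cont_fst R R) cX).
  exact: (cont_comp (@cont_snd R R) cx).
- apply: contBr; last exact: (cont_comp (@cont_snd R R) cD).
  apply: contDr; last exact: cont_cst.
  apply: (@cont_comp _ _ _ (fun s => Y s - lam * X s) (@fst R R)); first exact: cont_fst.
  by apply: contBr; [exact: cY|apply: contMr; [exact: cont_cst|exact: cX]].
- by move=> t /x01/andP[h1 h2] /=; lra.
- by move=> t /x01/andP[h1 h2] /=; lra.
- move=> s /hXY[+ _] /=; rewrite ler_norml => /andP[h1 h2]; lra.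
- move=> s /hXY[+ _] /=; rewrite ler_norml => /andP[h1 h2]; lra.
have [_ Ws] := hXY s s01; have [_] := hf t t01; apply; move: Ws.
have eX : X s = x t by move: e1 => /=; lra.
have eY : th t = Y s + P by move: e2 => /=; rewrite /D eX; lra.
have := hth t t01; rewrite eY polarD polar_period mulr1 => h.
by rewrite eX lnK ?posrE ?modulus_gt0 ?subr_eq0// -h addrC subrK.
Qed.

Lemma barrier_bound W p lam b M f th : barrier W p lam b M -> continuous f ->
  (forall t, f t != p) -> arg_lift (fun t => f t - p) th ->
  (forall t, 0 <= t <= 1 -> ln (modulus (f t - p)) <= b /\ ~ W (f t)) ->
  `|(th 1 - lam * ln (modulus (f 1 - p))) - (th 0 - lam * ln (modulus (f 0 - p)))|
    <= M + M + pi *+ 2.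
Proof.
move=> hW cf fp [cth hth] hf.
have rev (t : R) : 0 <= t <= 1 -> 0 <= 1 - t <= 1 by case/andP=> *; apply/andP; split; lra.
have c1 : continuous (fun t : R => 1 - t) by apply: contBr; [exact: cont_cst|exact: cont_id].
have h1 := barrier_upper hW cf fp (conj cth hth) hf.
have fp' (t : R) : f (1 - t) != p by exact: fp.
have l' : arg_lift (fun t => f (1 - t) - p) (fun t => th (1 - t)).
  by split; [exact: (cont_comp c1 cth)|move=> t /rev; exact: hth].
have hf' (t : R) : 0 <= t <= 1 -> ln (modulus (f (1 - t) - p)) <= b /\ ~ W (f (1 - t)).
  by move=> /rev; exact: hf.
have := barrier_upper hW (cont_comp c1 cf) fp' l' hf'.
rewrite subrr subr0 => h2; rewrite ler_norml; apply/andP; split=> //; lra.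
Qed.

(** The argument has no meaning at time 0, where [f] may be at [p]; freezing the path before [c]
    leaves a path to be lifted. *)
Lemma lift_from f p c : 0 < c -> c <= 1 -> continuous f ->
  (forall t, 0 < t <= 1 -> f t != p) -> exists th,
    arg_lift (fun t => f (Num.max c (clamp t)) - p) th.
Proof.
move=> c0 c1 cf fp; apply: lift_ex => [|t _].
  apply: contBc; last exact: cont_cst.
  apply: (cont_comp _ cf) => t.
  by apply: (@continuous_max R R (cst c) clamp t); [exact: cvg_cst|exact: continuous_clamp].
rewrite subr_eq0; apply: fp; rewrite lt_max c0 ge_max c1 clamp_le1 //.
Qed.

(** The bound is independent of [c], [s] and [t], hence uniform as the segment approaches [p]. *)
Lemma barrier_segment W p lam b M f th (c s t : R) : barrier W p lam b M -> continuous f ->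
  0 < c -> c <= s -> s <= t -> t <= 1 -> (forall u, 0 < u <= 1 -> f u != p) ->
  arg_lift (fun u => f (Num.max c (clamp u)) - p) th ->
  (forall u, s <= u <= t -> ln (modulus (f u - p)) <= b /\ ~ W (f u)) ->
  `|(th t - lam * ln (modulus (f t - p))) - (th s - lam * ln (modulus (f s - p)))|
    <= M + M + pi *+ 2.
Proof.
move=> hW cf c0 cs st t1 fp [cth hth] hf.
pose g (u : R) := s + (t - s) * clamp u.
have cg : continuous g.
  apply: contDr; first exact: cont_cst.
  by apply: contMr; [exact: cont_cst|exact: continuous_clamp].
have gI u : s <= g u <= t.
  have ts : 0 <= t - s by rewrite subr_ge0.
  have := mulr_ge0 ts (clamp_ge0 u); have := ler_piMr ts (clamp_le1 u).
  by rewrite /g => *; apply/andP; split; lra.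
have g0 : g 0 = s by rewrite /g clamp0 mulr0 addr0.
have g1 : g 1 = t by rewrite /g clamp1 mulr1 addrC subrK.
have g01 u : 0 < g u <= 1 by have /andP[h1 h2] := gI u; apply/andP; split; lra.
have fp' u : f (g u) != p by exact: fp (g01 u).
have l' : arg_lift (fun u => f (g u) - p) (fun u => th (g u)).
  split; first exact: (cont_comp cg cth).
  move=> u _; have /andP[h1 h2] := g01 u; have /andP[h3 h4] := gI u.
  have gg : 0 <= g u <= 1 by rewrite (ltW h1).
  by have := hth (g u) gg; rewrite clamp_id// (max_idPr (le_trans cs h3)).
have hf' u : 0 <= u <= 1 -> ln (modulus (f (g u) - p)) <= b /\ ~ W (f (g u)).
  by move=> _; exact: hf (gI u).
have := barrier_bound hW (cont_comp cg cf) fp' l' hf'.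
by rewrite g0 g1.
Qed.

Lemma leg_near_end f p (e : R) : continuous f -> f 0 = p -> 0 < e ->
  exists c, [/\ 0 < c, c < 1 & forall t, 0 <= t -> t <= c -> modulus (f t - p) < e].
Proof.
move=> cf f0 e0; have [d d0 hd] := cont_modulusP 0 cf e0.
exists (Num.min (1 / 2) d); split.
- by rewrite lt_min d0 divr_gt0.
- by rewrite gt_min; apply/orP; left; lra.
- move=> t t0; rewrite le_min => /andP[_ td].
  by rewrite -f0; apply: hd; rewrite subr0 ger0_norm.
Qed.

Lemma cont_max_clamp (c : R) : continuous (fun t : R => Num.max c (clamp t)).
Proof.
by move=> t; apply: (@continuous_max R R (cst c) clamp t); [exact: cvg_cst|exact: continuous_clamp].
Qed.

(** The leg follows the slope of the barrier it avoids with deviation at most [M + M + pi *+ 2] from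
    its value at 1. Translating the lift by a multiple of [2 * pi] brings that value within [2 * pi]
    of 0, whence the last summand. *)
Lemma barrier_of_leg W p lam b M f : barrier W p lam b M -> continuous f -> f 0 = p ->
  (forall t, 0 < t <= 1 -> f t != p) ->
  (forall t, 0 < t <= 1 -> ln (modulus (f t - p)) <= b /\ ~ W (f t)) ->
  barrier [set f t | t in [set t | 0 < t <= 1]] p lam (ln (modulus (f 1 - p)))
    (M + M + pi *+ 2 + pi *+ 2).
Proof.
move=> hW cf f0 fp hf a.
have pi2 : 0 < (pi : R) *+ 2 by rewrite mulrn_wgt0// pi_gt0.
have [c [c0 c1 hc]] := leg_near_end cf f0 (expR_gt0 a).
have [th [cth hth]] := lift_from c0 (ltW c1) cf fp.
pose x t := ln (modulus (f t - p)); pose D t := th t - lam * x t.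
have D1 t : c <= t -> t <= 1 -> `|D 1 - D t| <= M + M + pi *+ 2.
  move=> ct t1; apply: (barrier_segment hW cf c0 ct t1 (lexx _) fp (conj cth hth)).
  by move=> u /andP[u1 u2]; apply: hf; rewrite u2 andbT (lt_le_trans c0)// (le_trans ct).
pose k := Num.floor (- D 1 / (pi *+ 2)).
have /andP[k1 k2] : k%:~R <= - D 1 / (pi *+ 2) < (k + 1)%:~R by exact: floor_itv.
move: k1 k2; rewrite ler_pdivlMr// ltr_pdivrMr// intrD mulrDl mul1r => k1 k2.
set P := k%:~R * (pi *+ 2) in k1 k2.
pose g t := Num.max c (clamp t).
have cg : continuous g by exact: cont_max_clamp.
have gI t : c <= g t <= 1 by rewrite le_max lexx /= ge_max clamp_le1 ltW.
have g01 t : 0 < g t <= 1 by have /andP[h1 h2] := gI t; rewrite h2 (lt_le_trans c0).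
exists (fun t => x (g t)), (fun t => th (g t) + P); split.
- apply: (@cont_ln_modulus (fun t => f (g t))); first exact: (cont_comp cg cf).
  by move=> t; exact: fp (g01 t).
- by apply: contDr; [exact: (cont_comp cg cth)|exact: cont_cst].
- have -> : g 0 = c by rewrite /g clamp0; apply/max_idPl; exact: ltW.
  rewrite -[leRHS]expRK ler_ln ?posrE ?expR_gt0 ?modulus_gt0 ?subr_eq0 ?fp ?c0 ?(ltW c1)//.
  by apply: ltW; apply: hc => //; exact: ltW.
- by have -> : g 1 = 1 by rewrite /g clamp1; apply/max_idPr; exact: ltW.
move=> t _; have /andP[h1 h2] := gI t; split.
  have := D1 (g t) h1 h2; rewrite !ler_norml /D => /andP[h3 h4].
  by rewrite /D in k1 k2; apply/andP; split; lra.
exists (g t); first exact: g01.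
have gg : 0 <= g t <= 1 by have /andP[h3 ->] := g01 t; rewrite ltW.
have := hth (g t) gg; rewrite clamp_id// (max_idPr h1) => h.
rewrite polarD polar_period mulr1 lnK ?posrE ?modulus_gt0 ?subr_eq0 ?fp ?g01//.
by rewrite -h addrC subrK.
Qed.

(* Concatenating the images of the lift under the translations induced by the
   powers of [z |-> p + be (z - p)] *)
Lemma barrier_of_spiral W p (be : R[i]) f : continuous f -> (forall t, f t != p) ->
  (forall t, W (f t)) -> (forall z, W z -> W (p + be * (z - p))) ->
  modulus be < 1 -> f 1 - p = be * (f 0 - p) ->
  exists lam M, barrier W p lam (ln (modulus (f 0 - p))) M.
Proof.
move=> cf fp Wf Wbe be1 f1.
have nf t : f t - p != 0 by rewrite subr_eq0.
have [th [cth hth]] : exists th, arg_lift (fun t => f t - p) th.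
  by apply: lift_ex => [|t _]; [apply: contBc; [exact: cf|exact: cont_cst]|exact: nf].
have be0 : be != 0 by apply/eqP => e; have := nf 1; rewrite f1 e mul0r eqxx.
pose x t := ln (modulus (f t - p)).
have cx : continuous x by exact: cont_ln_modulus.
have ex t : expR (x t) = modulus (f t - p) by rewrite lnK// posrE modulus_gt0.
pose vx := x 1 - x 0; pose vy := th 1 - th 0.
have evx : expR vx = modulus be.
  rewrite /vx expRD expRN !ex f1 modulusM mulfK//.
  by rewrite modulus_eq0.
have vx0 : vx < 0 by rewrite -ltr_expR expR0 evx.
have evy : (modulus be)%:C * polar vy = be.
  have h0 := hth 0 itv01_0; have h1 := hth 1 itv01_1.
  have m0 : (modulus (f 0 - p))%:C != 0 by rewrite eq_complex /= eqxx andbT modulus_eq0.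
  have e1 : f 1 - p = (modulus be * modulus (f 0 - p))%:C * polar (th 1).
    by rewrite -modulusM -f1.
  apply: (mulIf (nf 0)); rewrite -f1 e1 {1}h0 rmorphM /= /vy polarB.
  by field; rewrite polar_neq0.
(* The deviation [y - lam * x] is unchanged by the translation [(vx, vy)] exactly for this slope. *)
pose lam := vy / vx.
have vyE : vy = lam * vx by rewrite /lam divfK// lt_eqF.
have cdev : continuous (fun t => `|th t - lam * x t|).
  have c : continuous (fun t => th t - lam * x t).
    by apply: contBr; [exact: cth|apply: contMr; [exact: cont_cst|exact: cx]].
  by move=> t; apply: cvg_norm; exact: c.
have [c] := EVT_max ler01 (continuous_subspaceT cdev).
rewrite in_itv /= => c01 hc; set M := `|th c - _| in hc.
exists lam, M => a.
have [N hN] : exists N : nat, x 0 + N%:R * vx <= a.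
  exists (Num.bound ((a - x 0) / vx)).
  have [h|h] := leP 0 ((a - x 0) / vx).
    have := ltW (archi_boundP h); rewrite ler_ndivrMr// => *; lra.
  have : 0 < a - x 0 by rewrite -(nmulr_llt0 _ (_ : vx^-1 < 0)) ?invr_lt0.
  have : 0 <= (Num.bound ((a - x 0) / vx))%:R :> R by [].
  move: ((Num.bound _)%:R) => n n0 h2; have : n * vx <= 0 by rewrite mulr_ge0_le0// ltW.
  by lra.
(* The [k]-th summand grows from 0 to the full increment while [s] crosses the interval from [k] to
   [k + 1], so the sum runs through successive translates of the lift. *)
pose X n (s : R) := x 0 + \sum_(k < n) (x (clamp (s - k%:R)) - x 0).
pose Y n (s : R) := th 0 + \sum_(k < n) (th (clamp (s - k%:R)) - th 0).
have XS n s : X n.+1 s = X n s + (x (clamp (s - n%:R)) - x 0) by rewrite /X big_ord_recr addrA.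
have YS n s : Y n.+1 s = Y n s + (th (clamp (s - n%:R)) - th 0) by rewrite /Y big_ord_recr addrA.
have cclamp (g : R -> R) n : continuous g -> continuous (fun s : R => g (clamp (s - n%:R))).
  move=> cg; apply: (cont_comp _ cg); apply: cont_clamp.
  by apply: contBr; [exact: cont_id|exact: cont_cst].
have cX n : continuous (X n).
  elim: n => [|n IH].
    have -> : X 0%N = cst (x 0) by apply/funext => s; rewrite /X big_ord0 addr0.
    exact: cont_cst.
  have -> : X n.+1 = fun s => X n s + (x (clamp (s - n%:R)) - x 0) by apply/funext.
  by apply: contDr; [exact: IH|apply: contBr; [exact: cclamp|exact: cont_cst]].
have cY n : continuous (Y n).
  elim: n => [|n IH].
    have -> : Y 0%N = cst (th 0) by apply/funext => s; rewrite /Y big_ord0 addr0.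
    exact: cont_cst.
  have -> : Y n.+1 = fun s => Y n s + (th (clamp (s - n%:R)) - th 0) by apply/funext.
  by apply: contDr; [exact: IH|apply: contBr; [exact: cclamp|exact: cont_cst]].
have past n (s : R) : n%:R <= s -> X n s = x 0 + n%:R * vx /\ Y n s = th 0 + n%:R * vy.
  elim: n => [|n IH] ns; first by rewrite /X /Y !big_ord0 !mul0r.
  rewrite -natr1 in ns; have [|hX hY] := IH; first lra.
  by rewrite XS YS hX hY clamp_ge1 -?natr1 -/vx -/vy; [split; ring|lra].
have here n (s : R) : 0 <= s -> s <= n%:R -> exists k t, [/\ 0 <= t <= 1,
    X n s = x t + k%:R * vx & Y n s = th t + k%:R * vy].
  elim: n => [|n IH] s0 sn.
    by exists 0%N, 0; rewrite lexx ler01 /X /Y !big_ord0 !mul0r !addr0.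
  have [h|h] := leP s n%:R.
    have [k [t [t01 hX hY]]] := IH s0 h; exists k, t.
    by rewrite XS YS hX hY clamp_le0 ?subrr ?addr0//; lra.
  have [hX hY] := past n s (ltW h); exists n, (s - n%:R).
  rewrite -natr1 in sn; have h01 : 0 <= s - n%:R <= 1 by apply/andP; split; lra.
  by rewrite XS YS hX hY clamp_id//; split=> //; ring.
(* The translates move to the left because [vx < 0], whereas a barrier is read from left to
   right. *)
pose l (t : R) := N%:R * (1 - clamp t).
have cl : continuous l.
  apply: contMr; first exact: cont_cst.
  by apply: contBr; [exact: cont_cst|exact: continuous_clamp].
have l0 t : 0 <= l t by rewrite mulr_ge0// subr_ge0 clamp_le1.
have lN t : l t <= N%:R by rewrite ler_piMr// gerBl clamp_ge0.
exists (fun t => X N (l t)), (fun t => Y N (l t)); split.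
- exact: (cont_comp cl (cX N)).
- exact: (cont_comp cl (cY N)).
- have -> : l 0 = N%:R by rewrite /l clamp0 subr0 mulr1.
  by have [-> _] := past N N%:R (lexx _).
- have -> : l 1 = 0 by rewrite /l clamp1 subrr mulr0.
  rewrite /X big1 ?addr0// => k _; rewrite clamp_le0 ?subrr// sub0r oppr_le0 //.
move=> t _; have [k [u [u01 -> ->]]] := here N (l t) (l0 t) (lN t); split.
  have -> : th u + k%:R * vy - lam * (x u + k%:R * vx) = th u - lam * x u.
    by rewrite vyE; ring.
  by apply: hc; rewrite in_itv.
have WN n : W (p + be ^+ n * (f u - p)).
  elim: n => [|n IH]; first by rewrite expr0 mul1r addrC subrK.
  have e : p + be ^+ n * (f u - p) - p = be ^+ n * (f u - p) by ring.
  by have := Wbe _ IH; rewrite e mulrA -exprS.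
have pN n : polar (n%:R * vy) = polar vy ^+ n.
  by elim: n => [|n IH]; rewrite ?mul0r ?polar0// -natr1 mulrDl mul1r polarD IH exprSr.
have := WN k; congr (W (_ + _)).
rewrite expRD ex expRM_natl evx polarD pN rmorphM /= rmorphXn /= {1}(hth u u01).
by rewrite -[in LHS]evy exprMn; ring.
Qed.

End Barriers.

(** * Slopes of arcs *)

Section Arcs.
Context {R : realType}.
Implicit Types (z w p : R[i]) (a b c lam M : R) (W : set R[i]) (f G : R -> R[i]).

Lemma within_clamp (T : topologicalType) (f : R -> T) :
  {within `[0, 1], continuous f} -> continuous (fun t => f (clamp t)).
Proof.
move=> cf.
move/subspace_continuousP: cf => cf t.
have At (u : R) : `[(0 : R), 1]%classic (clamp u) by rewrite /= in_itv /= clamp_itv.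
apply: (cvg_comp _ _ _ (cf (clamp t) (At t))) => B hB.
apply: (@filterS _ _ (nbhs_filter t) _ _ _ (@continuous_clamp R t _ hB)) => u /=.
by apply; exact: At.
Qed.

(** The auxiliary [k] adds to the distance from [G (phi t)] a tent of radius [e] around [phi t]. By
    injectivity it has a positive minimum [d], so a point of the image closer than [d] has its
    parameter under the tent. *)
Lemma inverse_continuous G (phi : R -> R) f : continuous G -> continuous f ->
  (forall s t, 0 <= s <= 1 -> 0 <= t <= 1 -> G s = G t -> s = t) ->
  (forall t, 0 <= phi t <= 1) -> (forall t, G (phi t) = f t) -> continuous phi.
Proof.
move=> cG cf Ginj phi01 Gphi t; apply/cvgrPdist_lt => e e0.
pose k (u : R) := modulus (G u - G (phi t)) + Num.max 0 (e - `|u - phi t|).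
have ck : continuous k.
  apply: contDr; first by apply: cont_modulus; apply: contBc; [exact: cG|exact: cont_cst].
  have c1 : continuous (fun u => e - `|u - phi t|).
    apply: contBr; first exact: cont_cst.
    have c2 : continuous (fun u => u - phi t) by apply: contBr; [exact: cont_id|exact: cont_cst].
    by move=> u; apply: cvg_norm; exact: c2.
  by move=> u; apply: (@continuous_max R R (cst 0) (fun u => e - `|u - phi t|) u);
    [exact: cvg_cst|exact: c1].
have [|d d0 hd] := cont_bounded_below ck.
  move=> u u01; have [->|ne] := eqVneq u (phi t).
    by rewrite /k !subrr modulus0 add0r normr0 subr0 lt_max e0 orbT.
  rewrite ltr_wpDr ?le_max ?lexx// modulus_gt0 subr_eq0.
  by apply: contra ne => /eqP/(Ginj _ _ u01 (phi01 t)) ->.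
have /cvg_complexP/(_ d d0) := cf t; apply: filterS => s hs.
have := hd (phi s) (phi01 s); rewrite /k !Gphi => h.
have : 0 < Num.max 0 (e - `|phi s - phi t|) by lra.
by rewrite lt_max ltxx /= subr_gt0 distrC.
Qed.

(** Before [c] the barrier bounds the deviation, after [c] compactness does. A subarc is traced on
    [G] by a continuous parameter [phi], so its increment is a difference of two values of a lift
    along [G]. *)
Lemma slope_of_barrier W p lam b M G c : barrier W p lam b M -> continuous G -> G 0 = p ->
  (forall s t, 0 <= s <= 1 -> 0 <= t <= 1 -> G s = G t -> s = t) -> 0 < c -> c < 1 ->
  (forall t, 0 < t -> t <= c -> ln (modulus (G t - p)) <= b /\ ~ W (G t)) ->
  slope_parameter (G @` `[0, 1]) p (G 1) lam.
Proof.
move=> hW cG G0 Ginj c0 c1 hc.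
have Gp t : 0 < t <= 1 -> G t != p.
  move=> /andP[t0 t1]; apply/eqP; rewrite -G0 => /Ginj; rewrite !lexx ler01 (ltW t0) t1.
  by move=> /(_ isT isT) e; rewrite e ltxx in t0.
pose x t := ln (modulus (G t - p)).
have [th1 [cth1 hth1]] := lift_from c0 (ltW c1) cG Gp.
pose M0 := M + M + pi *+ 2.
have [C hC] : exists C, forall s t, c <= s -> s <= 1 -> c <= t -> t <= 1 ->
    `|(th1 t - lam * x t) - (th1 s - lam * x s)| <= C.
  pose g t := Num.max c (clamp t).
  have cg : continuous g by exact: cont_max_clamp.
  have cdev : continuous (fun t => `|th1 (g t) - lam * x (g t)|).
    have c' : continuous (fun t => th1 (g t) - lam * x (g t)).
      apply: contBr; first exact: (cont_comp cg cth1).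
      apply: contMr; first exact: cont_cst.
      apply: (@cont_ln_modulus _ (fun t => G (g t))); first exact: (cont_comp cg cG).
      by move=> t; apply: Gp; rewrite lt_max c0 ge_max clamp_le1 ltW.
    by move=> t; apply: cvg_norm; exact: c'.
  have [d _ hd] := EVT_max ler01 (continuous_subspaceT cdev).
  exists (`|th1 (g d) - lam * x (g d)| + `|th1 (g d) - lam * x (g d)|).
  have gE t : c <= t -> t <= 1 -> g t = t.
    move=> ct t1; rewrite /g clamp_id ?t1 ?andbT; first exact/max_idPr.
    exact: le_trans (ltW c0) ct.
  have bnd t : c <= t -> t <= 1 -> `|th1 t - lam * x t| <= `|th1 (g d) - lam * x (g d)|.
    move=> ct t1; have := hd t; rewrite gE// in_itv /= t1 andbT; apply.
    exact: le_trans (ltW c0) ct.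
  by move=> s t cs s1 ct t1; apply: le_trans (ler_normB _ _) _; rewrite lerD ?bnd.
exists (Num.max 1 (M0 + C)); first by rewrite lt_max ltr01.
move=> h z1 z2 hsub f th [cf finj fh f0 f1] [cth hth].
rewrite le_max; apply/orP; right.
have cF := within_clamp cf; have cTh := within_clamp cth.
have /choice[phi hphi] : forall t : R, exists u, 0 < u < 1 /\ G u = f (clamp t).
  move=> t; have : h (f (clamp t)).
    by rewrite -fh; exists (clamp t) => //=; rewrite in_itv /= clamp_itv.
  move=> /hsub[[u] /=]; rewrite in_itv /= => /andP[u0 u1] <- /not_orP[n1 n2].
  exists u; split=> //; rewrite !lt_neqAle u0 u1 !andbT; apply/andP; split.
    by apply/eqP => e; apply: n1; rewrite -e.
  by apply/eqP => e; apply: n2; rewrite e.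
have phi01 t : 0 <= phi t <= 1 by have [/andP[h1 h2] _] := hphi t; rewrite !ltW.
have phiG t : G (phi t) = f (clamp t) by have [] := hphi t.
have cphi := inverse_continuous cG cF Ginj phi01 phiG.
have [d _ hd] := EVT_min ler01 (continuous_subspaceT cphi).
have [/andP[d0 d1] _] := hphi d.
(* The cut-off [e], and with it the lift [ps], depends on the subarc; the constants [M0] and [C]
   were fixed before and do not. *)
pose e := Num.min c (phi d); have e0 : 0 < e by rewrite lt_min c0.
have ec : e <= c by rewrite ge_min lexx.
have e1 : e <= 1 by apply: le_trans ec _; exact: ltW.
have [ps [cps hps]] := lift_from e0 e1 cG Gp.
have dev (s t : R) : e <= s -> s <= t -> t <= 1 ->
    `|(ps t - lam * x t) - (ps s - lam * x s)| <= M0 + C.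
  have C0 : 0 <= C by apply: le_trans (normr_ge0 _) (hC c c (lexx _) (ltW c1) (lexx _) (ltW c1)).
  have low : forall s t : R, e <= s -> s <= t -> t <= c ->
      `|(ps t - lam * x t) - (ps s - lam * x s)| <= M0.
    move=> {}s {}t es st tc; apply: (barrier_segment hW cG e0 es st (le_trans tc (ltW c1)) Gp (conj cps hps)).
    move=> u /andP[su ut]; apply: hc; last exact: le_trans ut tc.
    exact: lt_le_trans e0 (le_trans es su).
  have high : forall s t : R, c <= s -> s <= t -> t <= 1 ->
      `|(ps t - lam * x t) - (ps s - lam * x s)| <= C.
    move=> {}s {}t cs st t1.
    pose k (u : R) := s + (t - s) * clamp u.
    have ck : continuous k.
      apply: contDr; first exact: cont_cst.
      by apply: contMr; [exact: cont_cst|exact: continuous_clamp].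
    have kI u : s <= k u <= t.
      have ts : 0 <= t - s by rewrite subr_ge0.
      have := mulr_ge0 ts (clamp_ge0 u); have := ler_piMr ts (clamp_le1 u).
      by rewrite /k => *; apply/andP; split; lra.
    have k01 u : 0 <= k u <= 1.
      by have /andP[h1 h2] := kI u; apply/andP; split; lra.
    have kE (v : R) u : v <= c -> Num.max v (clamp (k u)) = k u.
      move=> vc; rewrite clamp_id//; apply/max_idPr; have /andP[h1 _] := kI u; lra.
    have l1 : arg_lift (fun u => G (k u) - p) (fun u => ps (k u)).
      split; first exact: (cont_comp ck cps).
      by move=> u _; have := hps (k u) (k01 u); rewrite kE.
    have l2 : arg_lift (fun u => G (k u) - p) (fun u => th1 (k u)).
      split; first exact: (cont_comp ck cth1).
      by move=> u _; have := hth1 (k u) (k01 u); rewrite kE.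
    have nz u : 0 <= u <= 1 -> G (k u) - p != 0.
      move=> _; rewrite subr_eq0; apply: Gp; have /andP[h1 h2] := kI u.
      by apply/andP; split; lra.
    have := lift_unique nz l1 l2 itv01_1.
    have -> : k 1 = t by rewrite /k clamp1 mulr1 addrC subrK.
    have -> : k 0 = s by rewrite /k clamp0 mulr0 addr0.
    have := hC s t cs (le_trans st t1) (le_trans cs st) t1.
    by rewrite !ler_norml => /andP[h1 h2] h3; apply/andP; split; lra.
  have M00 : 0 <= M0.
    by apply: le_trans (normr_ge0 _) (low e e (lexx _) (lexx _) ec).
  move=> es st t1; have [tc|ct] := leP t c.
    by apply: le_trans (low s t es st tc) _; rewrite lerDl.
  have [cs|sc] := leP c s.
    by apply: le_trans (high s t cs st t1) _; rewrite lerDr.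
  have := low s c es (ltW sc) (lexx _); have := high c t (lexx _) (ltW ct) t1.
  by rewrite !ler_norml => /andP[h1 h2] /andP[h3 h4]; apply/andP; split; lra.
have ephi t : 0 <= t <= 1 -> e <= phi t.
  by move=> t01; rewrite ge_min hd ?orbT// in_itv.
have l1 : arg_lift (fun t => f (clamp t) - p) (fun t => ps (phi t)).
  split; first exact: (cont_comp cphi cps).
  move=> t t01; have := hps (phi t) (phi01 t); rewrite clamp_id// (max_idPr (ephi t t01)).
  by rewrite phiG.
have l2 : arg_lift (fun t => f (clamp t) - p) (fun t => th (clamp t)).
  split; first exact: cTh.
  by move=> t t01; apply: hth; rewrite in_itv /= clamp_itv.
have nz t : 0 <= t <= 1 -> f (clamp t) - p != 0.
  move=> _; rewrite subr_eq0 -phiG; apply: Gp.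
  by have [/andP[-> /ltW ->]] := hphi t.
have := lift_unique nz l1 l2 itv01_1; rewrite clamp1 clamp0 => <-.
have -> : z2 = G (phi 1) by rewrite phiG clamp1.
have -> : z1 = G (phi 0) by rewrite phiG clamp0.
rewrite -/(x (phi 1)) -/(x (phi 0)).
have -> : ps (phi 1) - ps (phi 0) - lam * (x (phi 1) - x (phi 0)) =
  (ps (phi 1) - lam * x (phi 1)) - (ps (phi 0) - lam * x (phi 0)) by ring.
have /andP[_ q0] := phi01 0; have /andP[_ q1] := phi01 1.
have [h01|h10] := leP (phi 0) (phi 1); first exact: dev (ephi _ itv01_0) h01 q1.
by rewrite distrC; exact: dev (ephi _ itv01_1) (ltW h10) q0.
Qed.

End Arcs.

(** * From the preperiodic address to the slope of all arcs *)

Section Assembly.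
Context {R : realType}.
Implicit Types (x y z p q : R[i]).

Lemma finite_isolated (A : set R[i]) p : finite_set A ->
  exists2 d : R, 0 < d & forall z, A z -> modulus (z - p) < d -> z = p.
Proof.
move=> /finite_seqP[l ->]; elim: l => [|w l [d d0 hd]]; first by exists 1.
have [->|wp] := eqVneq w p.
  by exists d => // z /=; rewrite inE => /predU1P[->//|]; exact: hd.
exists (Num.min d (modulus (w - p))).
  by rewrite lt_min d0 modulus_gt0 subr_eq0.
move=> z /=; rewrite inE lt_min => /predU1P[->|zl] /andP[h1 h2]; last exact: hd.
by rewrite ltxx in h2.
Qed.

(** Passing from [A] to [B] would need a common point, and close to [p] the only one is [p], to
    which the path does not return. *)
Lemma germ_dichotomy (A B : set R[i]) (G : R -> R[i]) p (d c : R) : closed A -> closed B ->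
  continuous G -> G 0 = p -> (forall t, 0 < t <= 1 -> G t != p) ->
  (forall t, 0 <= t <= 1 -> A (G t) \/ B (G t)) ->
  (forall z, A z -> B z -> modulus (z - p) < d -> z = p) -> c <= 1 ->
  (forall t, 0 <= t -> t <= c -> modulus (G t - p) < d) ->
  (forall t, 0 < t -> t <= c -> ~ A (G t)) \/ (forall t, 0 < t -> t <= c -> A (G t)).
Proof.
move=> cA cB cG G0 Gp AB iso c1 near_p.
have [[s [s0 [sc As]]]|h] := pselect (exists s : R, 0 < s /\ s <= c /\ A (G s)); last first.
  by left=> t t0 tc At; apply: h; exists t.
right=> t t0 tc; apply: contrapT => nAt.
have Bt : B (G t) by have [|//|//] := AB t; rewrite (ltW t0) (le_trans tc).
pose k (u : R) := s + (t - s) * clamp u.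
have ck : continuous k.
  apply: contDr; first exact: cont_cst.
  by apply: contMr; [exact: cont_cst|exact: continuous_clamp].
have kI u : 0 < k u <= c.
  have h1 := clamp_ge0 u; have h2 : 0 <= 1 - clamp u by rewrite subr_ge0 clamp_le1.
  have e1 : k u = s * (1 - clamp u) + t * clamp u by rewrite /k; ring.
  have e2 : c - k u = (c - s) * (1 - clamp u) + (c - t) * clamp u by rewrite /k; ring.
  apply/andP; split; last by rewrite -subr_ge0 e2 addr_ge0// mulr_ge0// subr_ge0.
  rewrite e1; have [->|h] := eqVneq (clamp u) 0; first by rewrite subr0 mulr1 mulr0 addr0.
  have : 0 < t * clamp u by rewrite mulr_gt0// lt_neqAle eq_sym h.
  by have := mulr_ge0 (ltW s0) h2; lra.
have [||||||u [u01 Au Bu]] := @covering_path_meets R (fun u => G (k u)) A B.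
- exact: (cont_comp ck cG).
- exact: cA.
- exact: cB.
- by move=> u; apply: AB; have /andP[h1 h2] := kI u; rewrite (ltW h1) (le_trans h2).
- by rewrite /k clamp0 mulr0 addr0.
- by rewrite /k clamp1 mulr1 addrC subrK.
have /andP[h1 h2] := kI u.
have := Gp (k u); rewrite h1 (le_trans h2)// => /(_ isT)/eqP; apply.
by apply: iso => //; apply: near_p => //; exact: ltW.
Qed.

Context {m s : nat}.
Variables (S : 'I_m -> R[i] -> R[i]) (K : set R[i]) (rat : 'I_m -> R).
Hypothesis simS : forall i, similarity (S i) (rat i).
Hypothesis rat1 : forall i, rat i < 1.
Hypothesis attr : is_attractor S K.

(** The preimage [q] of [p] under [S_v] lies in every [S_u^n K]. Hence so does its image under
    [S_u], up to one more power, and these sets shrink to a point. *)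
Lemma preperiodic_fixed_point p a : address S K a p -> preperiodic a ->
  exists v u q, [/\ v != [::], u != [::], K q, word_map S u q = q & word_map S v q = p].
Proof.
move=> adr [v [u [v0 u0 hvu]]].
have inv w := similarity_inj (word_similarity simS w).
have pw n : word_map S (flatten (nseq n u)) = iter n (word_map S u).
  by elim: n => //= n IH; rewrite word_map_cat IH.
have pn n : exists2 y, K y & word_map S v (iter n (word_map S u) y) = p.
  have : (\bigcap_(n in [set: nat]) piece S K (mkseq a n.+1)) p by rewrite -adr.
  have sv : (0 < size v)%N by case: v v0 {hvu pw}.
  move=> /(_ (size v + n * size u).-1 I); rewrite prednK ?addn_gt0 ?sv// hvu.
  by move=> [y Ky e]; exists y => //; rewrite -e word_map_cat /= pw.
have [q Kq eq] := pn 0%N; exists v, u, q; split=> //.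
have [_ cK _] := attr; have [M M0 hM] := compact_modulus_bounded cK.
apply/eqP; rewrite -subr_eq0 -modulus_eq0 eq_le modulus_ge0 andbT leNgt; apply/negP => d0.
have r1 := word_ratio_lt1 simS rat1 u0; have [r0 _] := word_similarity simS u.
have [n hn] := expr_small (M + M) r0 r1 d0.
have [y Ky ey] := pn n.
have qy : q = iter n (word_map S u) y by apply: (inv v); rewrite ey.
have := hn n (leqnn n); rewrite ltNge => /negP; apply.
rewrite {1}qy -iterS iterSr {1}qy (iter_similarity n (word_similarity simS u)).2 mulrC.
apply: ler_wpM2r; first exact: exprn_ge0 (ltW r0).
apply: le_trans (modulusD _ _) _; rewrite modulusN lerD ?hM//.
exact: (word_attractor attr).
Qed.

Hypothesis connK : connected K.
Hypothesis FI : forall i j : 'I_m, i != j -> ((S i @` K) `&` (S j @` K) #<= `I_s)%card.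

(** [S_v] carries the spiral at [q] to one at [p], inside the piece of the first letter of [v]; the
    multiplier is conjugated when [S_v] reverses orientation. *)
Lemma piece_barrier i (v' u : seq 'I_m) q x : u != [::] -> K q -> word_map S u q = q ->
  K x -> x != q -> exists W lam b M,
  [/\ barrier W (word_map S (i :: v') q) lam b M, W `<=` S i @` K &
      ~ W (word_map S (i :: v') q)].
Proof.
move=> u0 Kq uq Kx xq; set Sv := word_map S (i :: v'); set p := Sv q.
have simv : similarity Sv (word_ratio rat (i :: v')) by exact: word_similarity.
have [al [mal hal]] := similarity_square (word_similarity simS u).
pose U := u ++ u; pose T := word_map S U.
have U0 : U != [::] by case: u u0 {uq al mal hal} @U @T.
have TE z : T z = word_map S u (word_map S u z) by rewrite /T /U word_map_cat.
have Tq : T q = q by rewrite TE !uq.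
have Tal y z : T y - T z = al * (y - z) by rewrite !TE hal.
have simT : similarity T (word_ratio rat U) by exact: word_similarity.
have [n [f [n0 cf hf f1]]] := spiral_exists simS rat1 attr connK FI U0 Kq Tq Tal Kx xq.
have iterT k y z : iter k T y - iter k T z = al ^+ k * (y - z).
  elim: k => [|k IH]; first by rewrite expr0 mul1r.
  by rewrite /= Tal IH mulrA exprS.
have [a [e [ma hv]]] := similarity_form simv.
pose W := Sv @` [set z | K z /\ z != q].
pose be := cj e (al ^+ n).
have key z : Sv (iter n T z) - p = be * (Sv z - p).
  rewrite /p -{1}(iter_fix n Tq) !hv iterT cjM /be; ring.
have nz z : z != q -> Sv z != p.
  by apply: contra => /eqP/(similarity_inj simv) ->.
have [||||||lam [M hM]] := @barrier_of_spiral R W p be (fun t => Sv (f t)).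
- exact: (cont_comp cf (similarity_continuous simv)).
- by move=> t; apply: nz; have [] := hf t.
- by move=> t; exists (f t) => //; exact: hf.
- move=> _ [z [Kz zq] <-]; rewrite -key addrC subrK; exists (iter n T z) => //; split.
    by elim: (n) => //= k; exact: (word_attractor attr).
  rewrite -(iter_fix n Tq); apply: contra zq => /eqP h; apply/eqP.
  exact: (similarity_inj (iter_similarity n simT)).
- rewrite modulus_cj; have [_ /(_ 1 0)] := iter_similarity n simT.
  rewrite iterT modulusM subr0 modulus1 !mulr1 => ->.
  by rewrite exprn_ilt1 ?(ltW simT.1) ?(word_ratio_lt1 simS rat1 U0) -?lt0n.
- by rewrite f1 key.
exists W, lam, (ln (modulus (Sv (f 0) - p))), M; split=> //.
- by move=> _ [z [Kz _] <-]; exists (word_map S v' z) => //; exact: (word_attractor attr).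
- by move=> [z [_ zq] h]; have := nz z zq; rewrite h eqxx.
Qed.

Lemma closed_attractor_piece i : closed (S i @` K).
Proof.
have [_ cK _] := attr.
by apply: compact_closed; [exact: complex_hausdorff|exact: compact_image (simS i) cK].
Qed.

Lemma slope_at_preperiodic p i j a : i != j -> (S i @` K) p -> (S j @` K) p ->
  address S K a p -> preperiodic a ->
  exists lam : R, forall g b, jordan_arc g p b -> g `<=` K -> slope_parameter g p b lam.
Proof.
move=> ij pi pj adr pre.
have [v [u [q [v0 u0 Kq uq vq]]]] := preperiodic_fixed_point adr pre.
(* If [K] reduces to [q], it contains no arc, and any slope will do. *)
have [[x Kx xq]|triv] := pselect (exists2 x, K x & x != q); last first.
  exists 0 => g b [f [cf finj fg f0 f1]] gK.
  have inK t : 0 <= t <= 1 -> f t = q.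
    move=> t01; apply/eqP; apply: contrapT => /negP h; apply: triv; exists (f t) => //.
    by apply: gK; rewrite -fg; exists t => //=; rewrite in_itv.
  have := finj 0 1; rewrite !inE /= !in_itv /= lexx ler01 lexx.
  move=> /(_ isT isT); rewrite !inK ?lexx ?ler01// => /(_ erefl) /eqP.
  by rewrite eq_sym oner_eq0.
case: v v0 vq => // i0 v' _ vq.
have [W [lam [b [M [hW WS nWp]]]]] := piece_barrier i0 v' u0 Kq uq Kx xq.
rewrite vq in hW nWp.
(* The address fixes the piece [i0] carrying the spiral; since [i] and [j] differ, one of them gives
   a second piece through [p]. *)
have [k [kn [x' Kx' ex']]] : exists k, k != i0 /\ (S k @` K) p.
  have [e|ne] := eqVneq i i0; last by exists i.
  by exists j; rewrite -e eq_sym.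
pose A := S i0 @` K; pose B := \bigcup_(l in [set l : 'I_m | l != i0]) (S l @` K).
have cA : closed A by exact: closed_attractor_piece.
have cB : closed B.
  apply: closed_bigcup; last by move=> l _; exact: closed_attractor_piece.
  exact: finite_finset.
have KAB z : K z -> A z \/ B z.
  move=> Kz; have [l [w [Kw <-]]] := attractor_cover attr Kz.
  by have [->|ne] := eqVneq l i0; [left; exists w|right; exists l => //; exists w].
have finAB : finite_set (A `&` B).
  rewrite /B setI_bigcupr; apply: bigcup_finite; first exact: finite_finset.
  by move=> l /= ln; apply: card_le_finite (finite_II s); apply: FI; rewrite eq_sym.
have [d d0 hd] := finite_isolated p finAB.
have iso z : A z -> B z -> modulus (z - p) < d -> z = p by move=> Az Bz; exact: hd.
have small (f : R -> R[i]) (t c' : R) : f t != p -> modulus (f t - p) < expR c' ->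
    ln (modulus (f t - p)) <= c'.
  move=> ne h; rewrite -[leRHS]expRK ler_ln ?posrE ?expR_gt0 ?modulus_gt0 ?subr_eq0//.
  exact: ltW.
(* A second barrier, in another piece containing [p], for the arcs inside [S i0 K]. *)
have [y Ky yx] : exists2 y, K y & y != x'.
  have [e|ne] := eqVneq x x'; last by exists x.
  by exists q => //; rewrite -e eq_sym.
have [f0 [cf0 f00 fK0 fp0] _] := leg_exists
  (attractor_path_connected simS rat1 attr connK) Kx' Ky yx.
pose f t := S k (f0 t).
have cf : continuous f by exact: (cont_comp cf0 (similarity_continuous (simS k))).
have ff0 : f 0 = p by rewrite /f f00.
have fp t : 0 < t <= 1 -> f t != p.
  move=> t01; rewrite -ex'; apply: contra (fp0 t t01) => /eqP h.
  by apply/eqP/(similarity_inj (simS k)).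
have fB t : B (f t) by exists k => //; exists (f0 t).
have e0 : 0 < Num.min d (expR b) by rewrite lt_min d0 expR_gt0.
have [c [c0 c1 hc]] := leg_near_end cf ff0 e0.
have c01 t : 0 < t <= 1 -> 0 < c * t /\ c * t <= c.
  by move=> /andP[t0 t1]; split; [exact: mulr_gt0|rewrite ler_piMr// ltW].
have fcp t : 0 < t <= 1 -> f (c * t) != p.
  by move=> /c01[h1 h2]; apply: fp; rewrite h1 (le_trans h2)// ltW.
have fcn t : 0 < t <= 1 -> modulus (f (c * t) - p) < d /\ modulus (f (c * t) - p) < expR b.
  by move=> /c01[h1 h2]; have := hc _ (ltW h1) h2; rewrite lt_min => /andP.
have cfc : continuous (fun t => f (c * t)).
  by apply: (cont_comp _ cf); apply: contMr; [exact: cont_cst|exact: cont_id].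
have fc0 : f (c * 0) = p by rewrite mulr0.
have fcW t : 0 < t <= 1 -> ln (modulus (f (c * t) - p)) <= b /\ ~ W (f (c * t)).
  move=> t01; have [n1 n2] := fcn t t01; split.
    by apply: (small (fun t => f (c * t))) => //; exact: fcp.
  by move=> Wt; have := fcp t t01; rewrite (iso _ (WS _ Wt) (fB _) n1) eqxx.
have := barrier_of_leg hW cfc fc0 fcp fcW.
set W1 := image _ _; set b1 := ln _; set M1 := _ + _ => hW1.
have W1B z : W1 z -> B z /\ modulus (z - p) < d.
  by move=> [t /= t01 <-]; split; [exact: fB|exact: (fcn t t01).1].
have nW1p : ~ W1 p by move=> [t /= t01 e]; have := fcp t t01; rewrite e eqxx.
exists lam => g b' [G0 [cG0 Ginj gG G00 G01]] gK.
pose G t := G0 (clamp t).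
have cG : continuous G by exact: within_clamp.
have GE t : 0 <= t <= 1 -> G t = G0 t by move=> t01; rewrite /G clamp_id.
have G0p : G 0 = p by rewrite GE ?lexx ?ler01.
have Gi (t t' : R) : 0 <= t <= 1 -> 0 <= t' <= 1 -> G t = G t' -> t = t'.
  by move=> t01 t'01; rewrite !GE//; apply: Ginj; rewrite inE /= in_itv.
have gE : g = G @` `[0, 1].
  rewrite -gG; apply/seteqP; split=> z [t /= t01 <-]; exists t => //=;
  by move: t01; rewrite in_itv /= => /GE.
have GK t : K (G t).
  by apply: gK; rewrite -gG; exists (clamp t) => //=; rewrite in_itv /= clamp_itv.
have Gp t : 0 < t <= 1 -> G t != p.
  move=> /andP[t0 t1]; apply/eqP; rewrite -G0p => /Gi; rewrite !lexx ler01 (ltW t0) t1.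
  by move=> /(_ isT isT) e; rewrite e ltxx in t0.
have d1 : 0 < Num.min d (Num.min (expR b) (expR b1)) by rewrite !lt_min d0 !expR_gt0.
have [dl [dl0 dl1 hdl]] := leg_near_end cG G0p d1.
have near_p t : 0 <= t -> t <= dl -> modulus (G t - p) < d.
  by move=> t0 t1; have := hdl t t0 t1; rewrite lt_min => /andP[].
have Gpd t : 0 < t -> t <= dl -> G t != p.
  by move=> t0 tdl; apply: Gp; rewrite t0 (le_trans tdl)// ltW.
have -> : b' = G 1 by rewrite GE ?lexx ?ler01.
rewrite gE.
(* Outside the piece [i0] the spiral set [W] is the barrier; inside it, the leg [W1] of the other
   piece is. *)
have [avoid|inside] := germ_dichotomy cA cB cG G0p Gp (fun t _ => KAB _ (GK t)) iso (ltW dl1) near_p.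
  apply: (slope_of_barrier hW cG G0p Gi dl0 dl1) => t t0 tdl; split.
    apply: (small G t) (Gpd t t0 tdl) _; have := hdl t (ltW t0) tdl.
    by rewrite !lt_min => /and3P[].
  by move=> /WS; exact: avoid.
apply: (slope_of_barrier hW1 cG G0p Gi dl0 dl1) => t t0 tdl; split.
  apply: (small G t) (Gpd t t0 tdl) _; have := hdl t (ltW t0) tdl.
  by rewrite !lt_min => /and3P[].
move=> /W1B[Bt nt]; have := Gpd t t0 tdl.
by rewrite (iso _ (inside t t0 tdl) Bt nt) eqxx.
Qed.

End Assembly.

Theorem theorem4p5 (R : realType) (m s : nat) (S : 'I_m -> R[i] -> R[i])
    (K : set R[i]) (hS : FI_system s S K)
    (p : R[i]) (hp : intersection_points S K p)
    (hpre : exists a : nat -> 'I_m, address S K a p /\ preperiodic a) :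
  exists lambda : R, forall (g : set R[i]) (b : R[i]),
    jordan_arc g p b -> g `<=` K -> slope_parameter g p b lambda.
Proof.
have [sim attr conn FI] := hS.
have /choice[rat hrat] : forall i, exists r, similarity (S i) r /\ r < 1.
  by move=> i; have [r [r0 r1 h]] := sim i; exists r.
have [i [j [ij [pi pj]]]] := hp; have [a [adr pre]] := hpre.
exact: (slope_at_preperiodic (fun i => (hrat i).1) (fun i => (hrat i).2) attr conn FI ij pi pj adr pre).
Qed.
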